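(* Let $\mathsf{ClC}$ be the principle: for every sequence $(C_n)_{n\in\mathbb{N}}$ of non-empty closed subsets of $[0,1]$, there is a sequence $(x_n)_{n\in\mathbb{N}}$ of reals with $x_n\in C_n$ for all $n$. Then: (1) the system $\mathsf{Z}_2^\omega$ cannot prove $\mathsf{ClC}$; (2) the system $\mathsf{Z}_2^\Omega$ proves $\mathsf{ClC}$, and so does $\mathsf{RCA}_0^\omega+\mathsf{QF\text{-}AC}^{0,1}$; (3) over $\mathsf{RCA}_0^\omega+\mathsf{ClC}$ it is provable that $\mathsf{WKL}_0$ is equivalent to the statement ''every usco function $f:[0,1]\to\mathbb{R}$ is bounded above''.
   Context: Framework: Kohlenbach's higher-order reverse mathematics in the language of all finite types. $\mathsf{RCA}_0^\omega$ is Kohlenbach's base theory (extensional primitive recursive arithmetic in all finite types with $\mathsf{QF\text{-}AC}^{1,0}$). Reals are represented by fast-converging Cauchy sequences of rationals. $\mathsf{WKL}_0$ denotes weak K\''onig's lemma. $\mathsf{QF\text{-}AC}^{0,1}$: for all $Y^2$, if $(\forall n\in\mathbb{N})(\exists f\in\mathbb{N}^\mathbb{N})(Y(f,n)=0)$ then there is $\Phi^{0\to1}$ with $(\forall n)(Y(\Phi(n),n)=0)$. $\mathsf{Z}_2^\omega$ is $\mathsf{RCA}_0^\omega$ plus, for each $k\ge1$, the existence of a functional $\mathsf{S}^2_k$ deciding $\Pi^1_k$-formulas in Kleene normal form; $\mathsf{Z}_2^\Omega$ is $\mathsf{RCA}_0^\omega$ plus Kleene's $(\exists^3)$: there is $E^3$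 with $(\forall Y^2)[(\exists f)(Y(f)=0)\leftrightarrow E(Y)=0]$. An open set $U\subseteq\mathbb{R}$ is given by $h_U:\mathbb{R}\to\mathbb{R}$, with $x\in U$ meaning $h_U(x)>0$, such that $y\in U$ implies $(\exists N)(\forall z\in B(y,2^{-N}))(z\in U)$; a set is closed if its complement is open; sequences of such sets are sequences of representing functions. $f:[0,1]\to\mathbb{R}$ is upper semi-continuous (usco) if for every $x_0\in[0,1]$ and $k$ there is $N$ with $f(y)<f(x_0)+2^{-k}$ for all $y\in B(x_0,2^{-N})\cap[0,1]$. *)

(* Defs.v *)
From Stdlib Require Import List.
Import ListNotations.

Set Implicit Arguments.
Unset Strict Implicit.
Unset Printing Implicit Defensive.

(** * The language of all finite types *)

Inductive ty : Set :=
| N : ty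
| Arr : ty -> ty -> ty.

Declare Scope fin_scope.
Delimit Scope fin_scope with fin.
Open Scope fin_scope.

Notation "s ~> t" := (Arr s t) (at level 55, right associativity) : fin_scope.

(** The pure types 1, 2 and 3. *)
Notation t1 := (N ~> N).
Notation t2 := (t1 ~> N).
Notation t3 := (t2 ~> N).

Definition ctx := list ty.

(** Intrinsically typed de Bruijn indices; the head of the context is index 0. *)
Inductive var : ctx -> ty -> Type :=
| VZ : forall G s, var (s :: G) s
| VS : forall G s t, var G t -> var (s :: G) t.

(** [CK] and [CS] are the combinators written Pi and Sigma by Kohlenbach, and
    [Rec] is the recursor R_0, which produces values of type 0 only. *)
Inductive tm (G : ctx) : ty -> Type :=
| Var : forall t, var G t -> tm G t
| App : forall s t, tm G (s ~> t) -> tm G s -> tm G t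
| Zero : tm G N
| Succ : tm G (N ~> N)
| CK : forall s t, tm G (s ~> t ~> s)
| CS : forall r s t, tm G ((r ~> s ~> t) ~> (r ~> s) ~> r ~> t)
| Rec : tm G ((N ~> N ~> N) ~> N ~> N ~> N).

Arguments Zero {G}.
Arguments Succ {G}.
Arguments CK {G s t}.
Arguments CS {G r s t}.
Arguments Rec {G}.

Notation "f · a" := (App f a) (at level 26, left associativity) : fin_scope.

Notation v0 := (Var (VZ _ _)).
Notation v1 := (Var (VS _ (VZ _ _))).
Notation v2 := (Var (VS _ (VS _ (VZ _ _)))).
Notation v3 := (Var (VS _ (VS _ (VS _ (VZ _ _))))).

(** ** Substitution *)

Definition subst (G D : ctx) := forall t, var G t -> tm D t.

Fixpoint sub_tm G D (r : subst G D) t (a : tm G t) : tm D t :=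
  match a with
  | Var x => r _ x
  | App f b => App (sub_tm r f) (sub_tm r b)
  | Zero => Zero
  | Succ => Succ
  | CK => CK
  | CS => CS
  | Rec => Rec
  end.

Definition shift {G s} : subst G (s :: G) := fun t x => Var (VS s x).

Definition wk {G s t} (a : tm G t) : tm (s :: G) t := sub_tm shift a.

Notation "↑ a" := (wk a) (at level 9, a at level 9, format "↑ a") : fin_scope.

Definition scons G D s (a : tm D s) (r : subst G D) : subst (s :: G) D :=
  fun t x =>
    match x in var L t
      return match L with
             | [] => unit
             | s' :: G' => tm D s' -> subst G' D -> tm D t
             end
    with
    | VZ _ _ => fun a _ => a
    | VS _ y => fun _ r => r _ y
    end a r.

Definition up G D s (r : subst G D) : subst (s :: G) (s :: D) :=
  scons v0 (fun t x => wk (r t x)).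

(** ** Bracket abstraction: [lam t] is [K u] if [t] is [u] weakened, and is
    otherwise computed with [S] and [I := S K K] *)

Definition str_var {G s t} (x : var (s :: G) t) : option (tm G t) :=
  match x in var L t
    return match L with [] => unit | _ :: G' => option (tm G' t) end
  with
  | VZ _ _ => None
  | VS _ y => Some (Var y)
  end.

Fixpoint str {G s t} (a : tm (s :: G) t) : option (tm G t) :=
  match a with
  | Var x => str_var x
  | App f b =>
      match str f, str b with
      | Some f', Some b' => Some (App f' b')
      | _, _ => None
      end
  | Zero => Some Zero
  | Succ => Some Succ
  | CK => Some CK
  | CS => Some CS
  | Rec => Some Rec
  end.

Definition lam_var {G s t} (x : var (s :: G) t) : tm G (s ~> t) :=
  match x in var L t
    return match L with [] => unit | s' :: G' => tm G' (s' ~> t) end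
  with
  | VZ _ s => CS · CK · (CK (t := s))
  | VS _ y => CK · Var y
  end.

Fixpoint lam {G s t} (a : tm (s :: G) t) : tm G (s ~> t) :=
  match str a with
  | Some u => CK · u
  | None =>
      match a in tm _ t return tm G (s ~> t) with
      | Var x => lam_var x
      | App f b => CS · lam f · lam b
      | Zero => CK · Zero
      | Succ => CK · Succ
      | CK => CK · CK
      | CS => CK · CS
      | Rec => CK · Rec
      end
  end.

(** ** Formulas

    Only equality at type 0 is primitive.  The logic is classical, so the other
    connectives are abbreviations. *)

Inductive form : ctx -> Type :=
| Eq0 : forall G, tm G N -> tm G N -> form G
| Bot : forall G, form G
| Imp : forall G, form G -> form G -> form G
| All : forall G s, form (s :: G) -> form G.

Arguments Bot {G}.
Arguments All {G} s _.

Definition Neg {G} (A : form G) := Imp A Bot.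
Definition And {G} (A B : form G) := Neg (Imp A (Neg B)).
Definition Ex {G} s (A : form (s :: G)) : form G := Neg (All s (Neg A)).
Definition Iff {G} (A B : form G) := And (Imp A B) (Imp B A).
Arguments Ex {G} s _.

Notation "a ≡ b" := (Eq0 a b) (at level 70, no associativity) : fin_scope.
Notation "¬' A" := (Neg A) (at level 72, right associativity) : fin_scope.
Notation "A ∧' B" := (And A B) (at level 75, right associativity) : fin_scope.
Notation "A ⇒ B" := (Imp A B) (at level 80, right associativity) : fin_scope.
Notation "A ⇔ B" := (Iff A B) (at level 85, no associativity) : fin_scope.
Notation "∀' s , A" := (All s A) (at level 90, s at level 60, A at level 90, right associativity)
  : fin_scope.
Notation "∃' s , A" := (Ex s A) (at level 90, s at level 60, A at level 90, right associativity)
  : fin_scope.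

Fixpoint sub_fm G D (r : subst G D) (A : form G) {struct A} : form D :=
  match A in form G return subst G D -> form D with
  | Eq0 a b => fun r => Eq0 (sub_tm r a) (sub_tm r b)
  | Bot => fun _ => Bot
  | Imp A B => fun r => Imp (sub_fm r A) (sub_fm r B)
  | All s A => fun r => All s (sub_fm (up r) A)
  end r.

Definition wk_fm {G s} (A : form G) : form (s :: G) := sub_fm shift A.

Definition inst {G s} (A : form (s :: G)) (a : tm G s) : form G :=
  sub_fm (scons a (fun t x => Var x)) A.

Definition sentence := form [].

Definition lift {G} (A : sentence) : form G :=
  sub_fm (fun t (x : var [] t) => match x with end) A.

Fixpoint closure {G} : form G -> sentence :=
  match G with
  | [] => fun A => A
  | s :: G' => fun A => closure (All s A)
  end.

Fixpoint qf {G} (A : form G) : Prop :=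
  match A with
  | Eq0 _ _ => True
  | Bot => True
  | Imp A B => qf A /\ qf B
  | All _ _ => False
  end.

(** Equality at higher types is extensional. *)
Fixpoint Eq {G} (t : ty) : tm G t -> tm G t -> form G :=
  match t with
  | N => fun a b => a ≡ b
  | s ~> t' => fun f g => ∀' s, Eq (↑f · v0) (↑g · v0)
  end.

(** ** Provability: natural deduction for classical many-sorted logic *)

Definition theory := sentence -> Prop.

Inductive prv (T : theory) : forall G, list (form G) -> form G -> Prop :=
| prv_ax : forall G (H : list (form G)) A, T A -> prv T H (lift A)
| prv_hyp : forall G (H : list (form G)) A, In A H -> prv T H A
| prv_impI : forall G (H : list (form G)) A B, prv T (A :: H) B -> prv T H (A ⇒ B)
| prv_impE : forall G (H : list (form G)) A B, prv T H (A ⇒ B) -> prv T H A -> prv T H B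
| prv_raa : forall G (H : list (form G)) A, prv T (Neg A :: H) Bot -> prv T H A
| prv_allI : forall G (H : list (form G)) s (A : form (s :: G)),
    prv T (map wk_fm H) A -> prv T H (All s A)
| prv_allE : forall G (H : list (form G)) s (A : form (s :: G)) (a : tm G s),
    prv T H (All s A) -> prv T H (inst A a).

Definition proves (T : theory) (A : sentence) : Prop := prv T (G := []) [] A.

Notation "T ⊢ A" := (proves T A) (at level 92, no associativity) : fin_scope.

Definition add_axiom (T : theory) (A : sentence) : theory := fun B => T B \/ B = A.

Notation "T ⊕ A" := (add_axiom T A) (at level 91, left associativity) : fin_scope.

(** * Kohlenbach's base theory *)

(** [A] has [y : t] as index 0 and [x : s] as index 1; in the conclusion the
    context is extended by [Y : s ~> t] and then [x : s]. *)
Definition choice_matrix {G s t} (A : form (t :: s :: G)) : form (s :: (s ~> t) :: G) :=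
  sub_fm (scons (v1 · v0) (scons v0 (fun r x => Var (VS s (VS (s ~> t) x))))) A.

Inductive RCA0w : theory :=
| ax_refl : RCA0w (∀' N, v0 ≡ v0)
| ax_sym : RCA0w (∀' N, ∀' N, v1 ≡ v0 ⇒ v0 ≡ v1)
| ax_trans : RCA0w (∀' N, ∀' N, ∀' N, v2 ≡ v1 ⇒ v1 ≡ v0 ⇒ v2 ≡ v0)
| ax_S_0 : RCA0w (∀' N, ¬' Succ · v0 ≡ Zero)
| ax_S_inj : RCA0w (∀' N, ∀' N, Succ · v1 ≡ Succ · v0 ⇒ v1 ≡ v0)
| ax_K : forall s t, RCA0w (∀' s, ∀' t, Eq (CK · v1 · v0) v1)
| ax_S : forall r s t,
    RCA0w (∀' (r ~> s ~> t), ∀' (r ~> s), ∀' r,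
             Eq (CS · v2 · v1 · v0) (v2 · v0 · (v1 · v0)))
| ax_Rec_0 : RCA0w (∀' (N ~> N ~> N), ∀' N, Rec · v1 · v0 · Zero ≡ v0)
| ax_Rec_S :
    RCA0w (∀' (N ~> N ~> N), ∀' N, ∀' N,
             Rec · v2 · v1 · (Succ · v0) ≡ v2 · v0 · (Rec · v2 · v1 · v0))
| ax_ext : forall s t,
    RCA0w (∀' (s ~> t), ∀' s, ∀' s, Eq v1 v0 ⇒ Eq (v2 · v1) (v2 · v0))
| ax_qf_ind : forall G (A : form (N :: G)),
    qf A ->
    RCA0w (closure
      (inst A Zero ⇒
       (∀' N, A ⇒ sub_fm (scons (Succ · v0) shift) A) ⇒
       ∀' N, A))
| ax_qf_ac : forall G (A : form (N :: t1 :: G)),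
    qf A ->
    RCA0w (closure
      ((∀' t1, ∃' N, A) ⇒ ∃' (t1 ~> N), ∀' t1, choice_matrix A)).

(** * Primitive recursive functions and codes *)

Definition one {G} : tm G N := Succ · Zero.

Definition addN {G} : tm G (N ~> N ~> N) :=
  lam (lam (Rec · lam (lam (Succ · v0)) · v1 · v0)).

Definition mulN {G} : tm G (N ~> N ~> N) :=
  lam (lam (Rec · lam (lam (addN · v0 · v3)) · Zero · v0)).

Definition predN {G} : tm G (N ~> N) := lam (Rec · lam (lam v1) · Zero · v0).

(** Truncated subtraction. *)
Definition subN {G} : tm G (N ~> N ~> N) :=
  lam (lam (Rec · lam (lam (predN · v0)) · v1 · v0)).

Definition pow2N {G} : tm G (N ~> N) :=
  lam (Rec · lam (lam (addN · v0 · v0)) · one · v0).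

Notation "a +' b" := (addN · a · b) (at level 50, left associativity) : fin_scope.
Notation "a -' b" := (subN · a · b) (at level 50, left associativity) : fin_scope.
Notation "a *' b" := (mulN · a · b) (at level 40, left associativity) : fin_scope.

Definition leN {G} (a b : tm G N) : form G := a -' b ≡ Zero.
Definition ltN {G} (a b : tm G N) : form G := leN (Succ · a) b.

(** [triN n] is 0 + 1 + ... + n. *)
Definition triN {G} : tm G (N ~> N) :=
  lam (Rec · lam (lam (v0 +' Succ · v1)) · Zero · v0).

(** The Cantor bijection from pairs of naturals to naturals. *)
Definition pairN {G} : tm G (N ~> N ~> N) := lam (lam (triN · (v1 +' v0) +' v0)).

(** [diagN c] is the largest [w] with [triN w <= c]. *)
Definition diagN {G} : tm G (N ~> N) :=
  lam (Rec · lam (lam (v0 +' (one -' (triN · (Succ · v0) -' Succ · v1)))) · Zero · v0).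

Definition sndN {G} : tm G (N ~> N) := lam (v0 -' triN · (diagN · v0)).
Definition fstN {G} : tm G (N ~> N) := lam (diagN · v0 -' sndN · v0).

(** Finite sequences: 0 codes the empty one and [snocN s x] extends [s] by the
    last entry [x].  Every natural number codes exactly one finite sequence. *)
Definition snocN {G} : tm G (N ~> N ~> N) := lam (lam (Succ · (pairN · v1 · v0))).

(** [barN g n] codes (g(0), ..., g(n-1)). *)
Definition barN {G} : tm G (t1 ~> N ~> N) :=
  lam (lam (Rec · lam (lam (snocN · v0 · (v3 · v1))) · Zero · v0)).

(** ** Rationals: [fracQ p q d] codes (p - q) / d for positive [d], and every
    natural number is a code *)

Definition fracQ {G} (p q d : tm G N) : tm G N := pairN · (pairN · p · q) · (predN · d).
Definition posQ {G} (c : tm G N) : tm G N := fstN · (fstN · c).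
Definition negQ {G} (c : tm G N) : tm G N := sndN · (fstN · c).
Definition denQ {G} (c : tm G N) : tm G N := Succ · (sndN · c).

Definition addQ {G} (c e : tm G N) : tm G N :=
  fracQ (posQ c *' denQ e +' posQ e *' denQ c)
        (negQ c *' denQ e +' negQ e *' denQ c)
        (denQ c *' denQ e).
Definition oppQ {G} (c : tm G N) : tm G N := fracQ (negQ c) (posQ c) (denQ c).
Definition subQ {G} (c e : tm G N) : tm G N := addQ c (oppQ e).
Definition absQ {G} (c : tm G N) : tm G N :=
  fracQ ((posQ c -' negQ c) +' (negQ c -' posQ c)) Zero (denQ c).
Definition ltQ {G} (c e : tm G N) : form G :=
  ltN (posQ c *' denQ e +' negQ e *' denQ c) (posQ e *' denQ c +' negQ c *' denQ e).

Definition natQ {G} (n : tm G N) : tm G N := fracQ n Zero one.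

(** The rational 2^-n. *)
Definition ipow2Q {G} (n : tm G N) : tm G N := fracQ one Zero (pow2N · n).

(** ** Reals *)

(** [x] is a real: |x_n - x_(n+i)| < 2^-n for all n and i. *)
Definition isR {G} (x : tm G t1) : form G :=
  ∀' N, ∀' N, ltQ (absQ (subQ (↑↑x · v1) (↑↑x · (v1 +' v0)))) (ipow2Q v1).

(** x < y if x_n + 2^(-n+1) < y_n for some n. *)
Definition ltR {G} (x y : tm G t1) : form G :=
  ∃' N, ltQ (addQ (↑x · v0) (addQ (ipow2Q v0) (ipow2Q v0))) (↑y · v0).
Definition leR {G} (x y : tm G t1) : form G := ¬' ltR y x.
Definition eqR {G} (x y : tm G t1) : form G := leR x y ∧' leR y x.

Definition constR {G} (q : tm G N) : tm G t1 := lam (↑q).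
Definition addR {G} (x y : tm G t1) : tm G t1 :=
  lam (addQ (↑x · (Succ · v0)) (↑y · (Succ · v0))).
Definition subR {G} (x y : tm G t1) : tm G t1 :=
  lam (subQ (↑x · (Succ · v0)) (↑y · (Succ · v0))).
Definition absR {G} (x : tm G t1) : tm G t1 := lam (absQ (↑x · v0)).

Definition zeroR {G} : tm G t1 := constR (natQ Zero).
Definition oneR {G} : tm G t1 := constR (natQ one).
Definition ipow2R {G} (n : tm G N) : tm G t1 := constR (ipow2Q n).

Definition allR {G} (A : form (t1 :: G)) : form G := ∀' t1, isR v0 ⇒ A.
Definition exR {G} (A : form (t1 :: G)) : form G := ∃' t1, isR v0 ∧' A.

Notation "'∀R' , A" := (allR A) (at level 90, A at level 90, right associativity) : fin_scope.
Notation "'∃R' , A" := (exR A) (at level 90, A at level 90, right associativity) : fin_scope.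

Definition in01 {G} (x : tm G t1) : form G := leR zeroR x ∧' leR x oneR.

(** [y] is in the open ball B(x, 2^-n). *)
Definition in_ball {G} (x : tm G t1) (n : tm G N) (y : tm G t1) : form G :=
  ltR (absR (subR y x)) (ipow2R n).

(** * The principles *)

(** [h] represents a function from the reals to the reals. *)
Definition isRR {G} (h : tm G (t1 ~> t1)) : form G :=
  (∀R, isR (↑h · v0)) ∧'
  (∀R, ∀R, eqR v1 v0 ⇒ eqR (↑↑h · v1) (↑↑h · v0)).

(** [f] represents a function from [0,1] to the reals. *)
Definition is01R {G} (f : tm G (t1 ~> t1)) : form G :=
  (∀R, in01 v0 ⇒ isR (↑f · v0)) ∧'
  (∀R, ∀R, in01 v1 ⇒ in01 v0 ⇒ eqR v1 v0 ⇒ eqR (↑↑f · v1) (↑↑f · v0)).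

(** [x] belongs to the set represented by [h]. *)
Definition mem {G} (x : tm G t1) (h : tm G (t1 ~> t1)) : form G := ltR zeroR (h · x).

(** The complement of the set represented by [h] is open.  The set itself, and
    not its complement, is the one given by a representing function. *)
Definition closed_set {G} (h : tm G (t1 ~> t1)) : form G :=
  isRR h ∧'
  (∀R, ¬' mem v0 ↑h ⇒
    ∃' N, ∀R, in_ball v2 v1 v0 ⇒ ¬' mem v0 ↑↑↑h).

Definition ClC : sentence :=
  ∀' (N ~> t1 ~> t1),
    (∀' N,
      closed_set (v1 · v0) ∧'
      (∀R, mem v0 (v2 · v1) ⇒ in01 v0) ∧'
      (∃R, mem v0 (v2 · v1))) ⇒
    ∃' (N ~> t1), ∀' N, isR (v1 · v0) ∧' mem (v1 · v0) (v2 · v0).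

(** A function [T] stands for the set of [s] with [T s = 0]; such a set of
    numbers is infinite if it is unbounded. *)
Definition infinite_binary_tree {G} (T : tm G t1) : form G :=
  (∀' N, ∀' N, ↑↑T · (snocN · v1 · v0) ≡ Zero ⇒ ↑↑T · v1 ≡ Zero ∧' leN v0 one) ∧'
  (∀' N, ∃' N, leN v1 v0 ∧' ↑↑T · v0 ≡ Zero).

Definition WKL : sentence :=
  ∀' t1, infinite_binary_tree v0 ⇒ ∃' t1, ∀' N, v2 · (barN · v1 · v0) ≡ Zero.

Definition usco {G} (f : tm G (t1 ~> t1)) : form G :=
  ∀R, in01 v0 ⇒ ∀' N, ∃' N, ∀R, in01 v0 ⇒ in_ball v3 v1 v0 ⇒
    ltR (↑↑↑↑f · v0) (addR (↑↑↑↑f · v3) (ipow2R v2)).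

Definition bounded_above {G} (f : tm G (t1 ~> t1)) : form G :=
  ∃R, ∀R, in01 v0 ⇒ leR (↑↑f · v0) v1.

Definition usco_bounded : sentence :=
  ∀' (t1 ~> t1), is01R v0 ⇒ usco v0 ⇒ bounded_above v0.

Definition QFAC01 : sentence :=
  ∀' (t1 ~> N ~> N),
    (∀' N, ∃' t1, v2 · v0 · v1 ≡ Zero) ⇒
    ∃' (N ~> t1), ∀' N, v2 · (v1 · v0) · v0 ≡ Zero.

(** * Higher-order second-order arithmetic *)

Definition quant {G} (b : bool) (s : ty) (A : form (s :: G)) : form G :=
  if b then ∀' s, A else ∃' s, A.

(** [kleene k true f []] is the Pi^1_k formula in Kleene normal form
    (∀g_1)(∃g_2)...(Q g_k)(Q' n) f(<bar g_1 n, ..., bar g_k n>) = 0, where the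
    k+1 quantifiers alternate and the number quantifier comes last. *)
Fixpoint kleene (k : nat) {G} (b : bool) (f : tm G t1) (gs : list (tm G t1)) : form G :=
  match k with
  | 0 =>
      quant b (s := N)
        (↑f · fold_left (fun c g => snocN · c · (barN · ↑g · v0)) gs Zero ≡ Zero)
  | S k' => quant b (s := t1) (kleene k' (negb b) ↑f (map wk gs ++ [v0]))
  end.

(** There is a functional S_k of type 2 deciding Pi^1_k formulas. *)
Definition S_exists (k : nat) : sentence :=
  ∃' t2, ∀' t1, v1 · v0 ≡ Zero ⇔ kleene k true v0 [].

Definition Z2omega : theory := fun A => RCA0w A \/ exists k, 1 <= k /\ A = S_exists k.

(** Kleene's (∃^3). *)
Definition Kleene_E3 : sentence :=
  ∃' t3, ∀' t2, (∃' t1, v1 · v0 ≡ Zero) ⇔ v1 · v0 ≡ Zero.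

Definition Z2Omega : theory := RCA0w ⊕ Kleene_E3.

(* Main.v *)
(** Parts (2) and (3) are proved by the completeness theorem: a Henkin model of the theory,
    divided by extensional equality, is an extensional model in which only the numbers may
    be nonstandard, so it suffices to argue inside an arbitrary such model.

    (2) With [(∃^3)] one can decide whether [C_n] meets an interval, and bisection finds
    the least element of [C_n].  With [QF-AC^{0,1}] one chooses an element of [C_n] together
    with a witness of membership.

    (3) Let [f] be usco and unbounded.  If [(∃^2)] exists, [ClC] applied to the closed sets
    [{x | f(x) >= n}] gives [x_n] with [f(x_n) >= n].  If not, Grilliot's trick shows that
    [f] does not jump at limits of dyadic points, so there are dyadic points [q_n] with
    [f(q_n) > n]; weak König's lemma yields, for each c.e. event [c], a real with the binary
    digits of [q_t] if [c] happens at stage [t], and the value of [f] at this real bounds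
    [t], which gives arithmetical comprehension.  In both cases the limit inferior of the
    unbounded sequence contradicts upper semi-continuity.  Conversely, an infinite binary
    tree without path makes a locally finite sum of tents, one for each node, a continuous
    unbounded function.

    (1) Let [A] be a countable set of functions on the standard numbers that is closed
    under recursion, [(∃^2)] and Skolem functions for the formulas in Kleene normal form.
    The functionals that map sequences coded in [A] to sequences coded in [A] form a model
    of [Z_2^ω].  Let [z_i] be a real of [A] outside the first [i] coded sequences of
    reals.  The sequence of the sets [{z_i}] belongs to the model, because a coded sequence
    of reals meets only finitely many of them, but the sequence of the [z_i] does not. *)
From HB Require Import structures.
From Stdlib Require Import Ring.
From mathcomp Require Import all_boot all_order all_algebra boolp.
Require Import Defs.

Set Implicit Arguments.
Unset Strict Implicit.
Unset Printing Implicit Defensive.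

(** Induction in the base theory is quantifier-free and the numbers of a model may be nonstandard.
    Hence every object, and every predicate on which an induction or a bounded search runs, must be
    given by a functional of the model; [Def] and [Dec], with their tactics, establish this. It is
    also why (3) splits on (∃²): representing functions of the sets {x | f(x) >= n} must decide
    inequalities between reals, for which arithmetical comprehension, a statement about numbers
    only, is too weak. In the converse of (3), the choice axiom from functions to numbers selects
    for each real a level at which it has left the tree, and all the care goes into making the value
    independent of that selection. In (1), a functional S_k must decide truth in the model, that is,
    truth over A, which is not known while A is being generated. Therefore A is closed under
    operations that refer to truth over all functions on the numbers, and the Skolem functions among
    them make the two notions of truth agree. *)

Definition var_case s G (P : forall t, var (s :: G) t -> Prop)
  (hZ : P s (VZ G s)) (hS : forall t (y : var G t), P t (VS s y)) t
  (x : var (s :: G) t) : P t x :=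
  match x in var L t' return
    (match L return var L t' -> Prop with
     | [::] => fun _ => True
     | s' :: G' => fun x => forall P : (forall t, var (s' :: G') t -> Prop),
         P s' (VZ G' s') -> (forall t (y : var G' t), P t (VS s' y)) -> P t' x
     end) x
  with
  | VZ _ _ => fun P hZ _ => hZ
  | VS _ _ _ y => fun P _ hS => hS _ y
  end P hZ hS.

Lemma var_nil t (x : var [::] t) : False.
Proof. exact (match x in var L _ return match L with [::] => False | _ => True end
  with VZ _ _ => I | VS _ _ _ _ => I end). Qed.

(** * Algebra of substitutions, and derivations under substitution and weakening *)

Definition ids G : subst G G := fun t x => Var x.
Definition comp G D E (r : subst G D) (r' : subst D E) : subst G E :=
  fun t x => sub_tm r' (r t x).

Lemma subst_ext G D (r r' : subst G D) : (forall t x, r t x = r' t x) -> r = r'.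
Proof.
move=> h; apply: functional_extensionality_dep => t.
by apply: functional_extensionality_dep => x.
Qed.

Lemma subst_ext_cons s G D (r r' : subst (s :: G) D) :
  r s (VZ G s) = r' s (VZ G s) -> (forall t y, r t (VS s y) = r' t (VS s y)) -> r = r'.
Proof. by move=> hZ hS; apply: subst_ext; apply: var_case. Qed.

Lemma subst_nil_ext D (r r' : subst [::] D) : r = r'.
Proof. by apply: subst_ext => t x; case: (var_nil x). Qed.

Lemma sub_tm_comp G D E (r : subst G D) (r' : subst D E) t (a : tm G t) :
  sub_tm r' (sub_tm r a) = sub_tm (comp r r') a.
Proof. by elim: a => //= s t' f -> a ->. Qed.

Lemma sub_tm_ids G t (a : tm G t) : sub_tm (@ids G) a = a.
Proof. by elim: a => //= s t' f -> a ->. Qed.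

Lemma comp_up G D E s (r : subst G D) (r' : subst D E) :
  comp (up (s := s) r) (up r') = up (comp r r').
Proof.
apply: subst_ext_cons => //= t y.
by rewrite /comp /= /wk !sub_tm_comp; congr sub_tm; apply: subst_ext.
Qed.

Lemma up_ids G s : up (s := s) (@ids G) = @ids (s :: G).
Proof. exact: subst_ext_cons. Qed.

Lemma sub_fm_comp G (A : form G) : forall D E (r : subst G D) (r' : subst D E),
  sub_fm r' (sub_fm r A) = sub_fm (comp r r') A.
Proof.
elim: A => //= [G' a b|G' A hA B hB|G' s A hA] D E r r'.
- by rewrite !sub_tm_comp.
- by rewrite hA hB.
- by rewrite hA comp_up.
Qed.

Lemma sub_fm_ids G (A : form G) : sub_fm (@ids G) A = A.
Proof.
elim: A => //= [G' a b|G' A hA B hB|G' s A hA].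
- by rewrite !sub_tm_ids.
- by rewrite hA hB.
- by rewrite up_ids hA.
Qed.

Lemma up_scons G D s (r : subst G D) (a : tm D s) :
  comp (up r) (scons a (@ids D)) = scons a r.
Proof.
apply: subst_ext_cons => //= t y; rewrite /comp /= /wk sub_tm_comp -[RHS]sub_tm_ids.
by congr sub_tm; apply: subst_ext.
Qed.

Lemma inst_up G D s (r : subst G D) (A : form (s :: G)) (a : tm D s) :
  inst (sub_fm (up r) A) a = sub_fm (scons a r) A.
Proof. by rewrite /inst sub_fm_comp -/(@ids D) up_scons. Qed.

Lemma sub_inst G D s (r : subst G D) (A : form (s :: G)) (a : tm G s) :
  sub_fm r (inst A a) = inst (sub_fm (up r) A) (sub_tm r a).
Proof.
rewrite inst_up /inst sub_fm_comp; congr sub_fm.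
exact: subst_ext_cons.
Qed.

Lemma sub_wk_fm G D s (r : subst G D) (A : form G) :
  sub_fm (up (s := s) r) (wk_fm A) = wk_fm (sub_fm r A).
Proof. by rewrite /wk_fm !sub_fm_comp; congr sub_fm; apply: subst_ext. Qed.

Lemma sub_lift G D (r : subst G D) (A : sentence) : sub_fm r (lift A) = lift A.
Proof. by rewrite /lift sub_fm_comp; congr sub_fm; apply: subst_nil_ext. Qed.

Lemma lift_nil (A : sentence) : lift A = A.
Proof. by rewrite -[RHS]sub_fm_ids; congr sub_fm; apply: subst_nil_ext. Qed.

Section Derivations.
Variable T : theory.

(** The Henkin construction moves derivations along growing contexts, so closure under substitution
    takes the place of the usual lemma on fresh constants. *)
Lemma prv_sub G (H : list (form G)) A : prv T H A ->
  forall D (r : subst G D), prv T (List.map (sub_fm r) H) (sub_fm r A).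
Proof.
elim=> {G H A} /= [G H A TA|G H A HA|G H A B _ IH|G H A B _ IH1 _ IH2|G H A _ IH
  |G H s A _ IH|G H s A a _ IH] D r.
- by rewrite sub_lift; apply: prv_ax.
- by apply: prv_hyp; apply: List.in_map.
- exact: prv_impI (IH _ _).
- exact: prv_impE (IH1 _ _) (IH2 _ _).
- exact: prv_raa (IH _ _).
- apply: prv_allI; move: (IH _ (up r)); rewrite !List.map_map.
  by under List.map_ext => B do rewrite sub_wk_fm.
- rewrite sub_inst; exact: prv_allE (IH _ r).
Qed.

Lemma prv_weak G (H : list (form G)) A : prv T H A ->
  forall H', List.incl H H' -> prv T H' A.
Proof.
elim=> {G H A} /= [G H A TA|G H A HA|G H A B _ IH|G H A B _ IH1 _ IH2|G H A _ IH
  |G H s A _ IH|G H s A a _ IH] H' sub.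
- exact: prv_ax.
- exact/prv_hyp/sub.
- apply: prv_impI; apply: IH => B' /= [->|h]; [by left|by right; apply: sub].
- exact: prv_impE (IH1 _ sub) (IH2 _ sub).
- apply: prv_raa; apply: IH => B' /= [->|h]; [by left|by right; apply: sub].
- apply: prv_allI; apply: IH; exact: List.incl_map.
- exact: prv_allE (IH _ sub).
Qed.

Lemma prv_cons G (H : list (form G)) B A : prv T H A -> prv T (B :: H) A.
Proof. by move/prv_weak; apply=> C; right. Qed.

Lemma prv_hd G (H : list (form G)) A : prv T (A :: H) A.
Proof. by apply: prv_hyp; left. Qed.

Lemma prv_botE G (H : list (form G)) A : prv T H Bot -> prv T H A.
Proof. by move=> h; apply: prv_raa; apply: prv_cons. Qed.

End Derivations.

(** * Structures *)

Record structure := Str {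
  car : ty -> Type;
  app : forall s t, car (s ~> t) -> car s -> car t;
  eqN : car N -> car N -> Prop;
  cZ : car N;
  cS : car (N ~> N);
  cK : forall s t, car (s ~> t ~> s);
  cSS : forall r s t, car ((r ~> s ~> t) ~> (r ~> s) ~> r ~> t);
  cR : car ((N ~> N ~> N) ~> N ~> N ~> N) }.

Arguments app {M s t} _ _ : rename.
Arguments cZ {M} : rename.
Arguments cS {M} : rename.
Arguments cK {M s t} : rename.
Arguments cSS {M r s t} : rename.
Arguments cR {M} : rename.

Declare Scope mod_scope.
Delimit Scope mod_scope with M.
Notation "f @ x" := (app f x) (at level 11, left associativity) : mod_scope.
Open Scope mod_scope.

Section Semantics.
Variable M : structure.

Fixpoint env (G : ctx) : Type :=
  match G with [::] => unit | s :: G' => (car M s * env G')%type end.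

Fixpoint lk G t (x : var G t) : env G -> car M t :=
  match x in var G t return env G -> car M t with
  | VZ _ _ => fst
  | VS _ _ _ y => fun g => lk y g.2
  end.

Fixpoint ev G t (a : tm G t) (g : env G) : car M t :=
  match a in tm _ t return car M t with
  | Var _ x => lk x g
  | App _ _ f b => ev f g @ ev b g
  | Zero => cZ
  | Succ => cS
  | CK _ _ => cK
  | CS _ _ _ => cSS
  | Rec => cR
  end.

Fixpoint sat G (A : form G) : env G -> Prop :=
  match A in form G return env G -> Prop with
  | Eq0 _ a b => fun g => eqN (ev a g) (ev b g)
  | Bot _ => fun _ => False
  | Imp _ A B => fun g => sat A g -> sat B g
  | All _ s A => fun g => forall x, sat A (x, g)
  end.

Fixpoint envs G D : subst G D -> env D -> env G :=
  match G return subst G D -> env D -> env G with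
  | [::] => fun _ _ => tt
  | s :: G' => fun r d => (ev (r _ (VZ G' s)) d, envs (fun t y => r t (VS s y)) d)
  end.

Notation "x ;; g" := (@pair (car M _) (env _) x g) (at level 60, right associativity).

Lemma lk_envs G D (r : subst G D) (d : env D) t (x : var G t) :
  lk x (envs r d) = ev (r t x) d.
Proof. by elim: x r => //= G' s t' x IH r; rewrite IH. Qed.

Lemma env_ext G (g g' : env G) : (forall t (x : var G t), lk x g = lk x g') -> g = g'.
Proof.
elim: G g g' => [|s G IH] /=; first by case=> [] [].
move=> [a g] [a' g'] h; have /= -> := h _ (VZ G s); congr pair; apply: IH => t x; exact: (h _ (VS s x)).
Qed.

Lemma ev_sub G D (r : subst G D) t (a : tm G t) (d : env D) :
  ev (sub_tm r a) d = ev a (envs r d).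
Proof. by elim: a => //= [t' x|s t' f -> b ->] //; rewrite lk_envs. Qed.

Lemma envs_shift G s (x : car M s) (g : env G) : envs shift (x ;; g) = g.
Proof. by apply: env_ext => t y; rewrite lk_envs. Qed.

Lemma envs_ids G (g : env G) : envs (@ids G) g = g.
Proof. by apply: env_ext => t y; rewrite lk_envs. Qed.

Lemma ev_wk G s t (a : tm G t) (x : car M s) g : ev (wk a) (x ;; g) = ev a g.
Proof. by rewrite ev_sub envs_shift. Qed.

Lemma envs_up G D s (r : subst G D) (x : car M s) d :
  envs (up r) (x ;; d) = (x ;; envs r d).
Proof.
apply: env_ext => t y; rewrite lk_envs.
by elim/var_case: y => //= t' y; rewrite ev_wk lk_envs.
Qed.

Lemma envs_scons G D s (r : subst G D) (a : tm D s) d :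
  envs (scons a r) d = (ev a d ;; envs r d).
Proof. by []. Qed.

Lemma sat_sub G (A : form G) : forall D (r : subst G D) (d : env D),
  sat (sub_fm r A) d <-> sat A (envs r d).
Proof.
elim: A => [G' a b|G'|G' A hA B hB|G' s A hA] D r d.
- by rewrite /= !ev_sub.
- by [].
- by rewrite /= hA hB.
- split=> h x.
    by rewrite -envs_up; apply/(hA _ (up r) (x, d)); exact: h.
  by apply/(hA _ (up r) (x, d)); rewrite envs_up; apply: h.
Qed.

Lemma sat_inst G s (A : form (s :: G)) (a : tm G s) g :
  sat (inst A a) g <-> sat A (ev a g ;; g).
Proof. by rewrite /inst sat_sub envs_scons -/(@ids G) envs_ids. Qed.

Lemma sat_wk G s (A : form G) (x : car M s) g : sat (wk_fm A) (x ;; g) <-> sat A g.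
Proof. by rewrite /wk_fm sat_sub envs_shift. Qed.

Lemma sat_lift G (A : sentence) (g : env G) : sat (lift A) g <-> sat A tt.
Proof. by rewrite /lift sat_sub. Qed.

Lemma sat_closure G (A : form G) : sat (closure A) tt <-> forall g, sat A g.
Proof.
elim: G A => [|s G IH] A /=; first by split=> [h []|h].
rewrite IH /=; split=> [h [x g]|h g x]; exact: h.
Qed.

Lemma sat_imp G (A B : form G) g : sat (Imp A B) g <-> (sat A g -> sat B g).
Proof. by []. Qed.

Lemma sat_all G s (A : form (s :: G)) g : sat (All s A) g <-> forall x, sat A (x ;; g).
Proof. by []. Qed.

Lemma sat_eq0 G (a b : tm G N) g : sat (Eq0 a b) g <-> eqN (ev a g) (ev b g).
Proof. by []. Qed.

Lemma sat_neg G (A : form G) g : sat (Neg A) g <-> ~ sat A g.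
Proof. by []. Qed.

Lemma sat_and G (A B : form G) g : sat (And A B) g <-> sat A g /\ sat B g.
Proof.
rewrite /=; split=> [h|[a b] h]; last exact: h.
by split; apply: contrapT => n; apply: h.
Qed.

Lemma sat_ex G s (A : form (s :: G)) g : sat (Ex s A) g <-> exists x, sat A (x ;; g).
Proof.
rewrite /=; split=> [h|[x a] h]; last exact: (h x).
by apply: contrapT => n; apply: h => x a; apply: n; exists x.
Qed.

Lemma sat_iff G (A B : form G) g : sat (Iff A B) g <-> (sat A g <-> sat B g).
Proof. by rewrite /Iff sat_and. Qed.

Lemma soundness (T : theory) G (H : list (form G)) A : (forall B, T B -> sat B tt) ->
  prv T H A -> forall g, (forall B, List.In B H -> sat B g) -> sat A g.
Proof.
move=> hT; elim=> {G H A} /= [G H A TA|G H A HA|G H A B _ IH|G H A B _ IH1 _ IH2|G H A _ IH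
  |G H s A _ IH|G H s A a _ IH] g hg.
- exact/sat_lift/hT.
- exact: hg.
- by move=> a; apply: IH => C [<-|/hg].
- exact: IH1 (IH2 _ _).
- by apply: contrapT => n; apply: (IH g) => C [<-|/hg].
- by move=> x; apply: IH => C /List.in_map_iff [B [<- /hg]]; rewrite sat_wk.
- rewrite sat_inst; exact: IH.
Qed.

End Semantics.

(** * Completeness *)

Fixpoint tys n : list ty :=
  match n with
  | 0 => [::]
  | n.+1 => N :: List.flat_map (fun s => List.map (Arr s) (tys n)) (tys n)
  end.

Lemma tysP t : exists d, forall n, d <= n -> List.In t (tys n).
Proof.
elim: t => [|s [d1 h1] t [d2 h2]].
  by exists 1; case=> // n _; left.
exists (maxn d1 d2).+1 => -[//|n]; rewrite ltnS geq_max => /andP[l1 l2]; right.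
apply/List.in_flat_map; exists s; split; first exact: h1.
by apply: List.in_map; apply: h2.
Qed.

Fixpoint vars (G : ctx) : list {t & var G t} :=
  match G with
  | [::] => [::]
  | s :: G' => existT _ s (VZ G' s) ::
      List.map (fun p : {t & var G' t} => existT _ (projT1 p) (VS s (projT2 p))) (vars G')
  end.

Lemma varsP G t (x : var G t) : List.In (existT _ t x) (vars G).
Proof.
elim: x => {G t} [G s|G s t x IH] /=; [by left|right].
by apply/List.in_map_iff; exists (existT _ t x).
Qed.

Definition mkapp G (p q : {t & tm G t}) : list {t & tm G t} :=
  match projT1 p as T return tm G T -> list {t & tm G t} with
  | N => fun _ => [::]
  | s ~> t => fun f =>
      match pselect (projT1 q = s) with
      | left e => [:: existT _ t (App f (eq_rect _ (tm G) (projT2 q) _ e))]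
      | right _ => [::]
      end
  end (projT2 p).

Definition mkeq G (p q : {t & tm G t}) : list (form G) :=
  match pselect (projT1 p = N), pselect (projT1 q = N) with
  | left e, left e' =>
      [:: Eq0 (eq_rect _ (tm G) (projT2 p) _ e) (eq_rect _ (tm G) (projT2 q) _ e')]
  | _, _ => [::]
  end.

(** Together with [forms], these finite lists take the place of a numbering of the syntax: each
    stage of the Henkin construction treats one list, and every term and formula occurs in all late
    enough lists. *)
Fixpoint tms n (G : ctx) : list {t & tm G t} :=
  match n with
  | 0 => [::]
  | n.+1 =>
     (List.map (fun p : {t & var G t} => existT (tm G) (projT1 p) (Var (projT2 p))) (vars G)
      ++ [:: existT _ _ Zero; existT _ _ Succ; existT _ _ Rec]
      ++ List.flat_map (fun s => List.map (fun t => existT (tm G) _ (@CK _ s t)) (tys n)) (tys n)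
      ++ List.flat_map (fun r => List.flat_map (fun s =>
           List.map (fun t => existT (tm G) _ (@CS _ r s t)) (tys n)) (tys n)) (tys n)
      ++ List.flat_map (fun p => List.flat_map (mkapp p) (tms n G)) (tms n G))%list
  end.

Fixpoint forms n (G : ctx) : list (form G) :=
  match n with
  | 0 => [::]
  | n.+1 => (Bot
      :: List.flat_map (fun p => List.flat_map (mkeq p) (tms n G)) (tms n G)
      ++ List.flat_map (fun A => List.map (Imp A) (forms n G)) (forms n G)
      ++ List.flat_map (fun s => List.map (@All G s) (forms n (s :: G))) (tys n))%list
  end.

Definition ren (G D : ctx) := forall t, var G t -> var D t.
Definition rsub G D (r : ren G D) : subst G D := fun t x => Var (r t x).

Lemma tmsP G t (a : tm G t) : exists d, forall n, d <= n ->
  forall D (r : ren G D), List.In (existT _ t (sub_tm (rsub r) a)) (tms n D).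
Proof.
elim: a => {t} [t x|s t f [d1 h1] b [d2 h2]||  |s t|r s t|].
- exists 1 => -[//|n] _ D r; apply/List.in_app_iff; left.
  by apply/List.in_map_iff; exists (existT _ t (r t x)); split=> //; apply: varsP.
- exists (maxn d1 d2).+1 => -[//|n]; rewrite ltnS geq_max => /andP[l1 l2] D r.
  do 4![apply/List.in_app_iff; right].
  apply/List.in_flat_map; exists (existT _ _ (sub_tm (rsub r) f)); split; first exact: h1.
  apply/List.in_flat_map; exists (existT _ _ (sub_tm (rsub r) b)); split; first exact: h2.
  rewrite /mkapp /=; case: pselect => // e; left.
  by rewrite (Prop_irrelevance e erefl).
- exists 1 => -[//|n] _ D r; apply/List.in_app_iff; right; apply/List.in_app_iff; left.
  by left.
- exists 1 => -[//|n] _ D r; apply/List.in_app_iff; right; apply/List.in_app_iff; left.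
  by right; left.
- have [d1 h1] := tysP s; have [d2 h2] := tysP t.
  exists (maxn d1 d2).+1 => -[//|n]; rewrite ltnS geq_max => /andP[l1 l2] D r'.
  do 2![apply/List.in_app_iff; right]; apply/List.in_app_iff; left.
  apply/List.in_flat_map; exists s; split; first exact: h1.
  by apply/List.in_map_iff; exists t; split=> //; apply: h2.
- have [d0 h0] := tysP r; have [d1 h1] := tysP s; have [d2 h2] := tysP t.
  exists (maxn d0 (maxn d1 d2)).+1 => -[//|n].
  rewrite ltnS !geq_max => /and3P[l0 l1 l2] D r'.
  do 3![apply/List.in_app_iff; right]; apply/List.in_app_iff; left.
  apply/List.in_flat_map; exists r; split; first exact: h0.
  apply/List.in_flat_map; exists s; split; first exact: h1.
  by apply/List.in_map_iff; exists t; split=> //; apply: h2.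
- exists 1 => -[//|n] _ D r; apply/List.in_app_iff; right; apply/List.in_app_iff; left.
  by right; right; left.
Qed.

Definition upr G D s (r : ren G D) : ren (s :: G) (s :: D) :=
  fun t x => match x in var L t return
    match L with [::] => unit | s' :: G' => ren G' D -> var (s' :: D) t end with
  | VZ _ s' => fun _ => VZ D s'
  | VS _ _ t y => fun r => VS _ (r t y)
  end r.

Lemma up_rsub G D s (r : ren G D) : up (s := s) (rsub r) = rsub (@upr _ _ s r).
Proof. exact: subst_ext_cons. Qed.

(** The bound [d] serves all renamings of [A] at once, because a formula present at some stage is
    renamed at every later one and its copies must still be listed there. *)
Lemma formsP G (A : form G) : exists d, forall n, d <= n ->
  forall D (r : ren G D), List.In (sub_fm (rsub r) A) (forms n D).
Proof.
elim: A => {G} [G a b|G|G A [d1 h1] B [d2 h2]|G s A [d1 h1]].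
- have [d1 h1] := tmsP a; have [d2 h2] := tmsP b.
  exists (maxn d1 d2).+1 => -[//|n]; rewrite ltnS geq_max => /andP[l1 l2] D r.
  right; apply/List.in_app_iff; left.
  apply/List.in_flat_map; exists (existT _ _ (sub_tm (rsub r) a)); split; first exact: h1.
  apply/List.in_flat_map; exists (existT _ _ (sub_tm (rsub r) b)); split; first exact: h2.
  rewrite /mkeq /=; case: pselect => // e; left.
  by rewrite (Prop_irrelevance e erefl).
- by exists 1 => -[//|n] _ D r; left.
- exists (maxn d1 d2).+1 => -[//|n]; rewrite ltnS geq_max => /andP[l1 l2] D r.
  right; do 1![apply/List.in_app_iff; right]; apply/List.in_app_iff; left.
  apply/List.in_flat_map; exists (sub_fm (rsub r) A); split; first exact: h1.
  by apply/List.in_map_iff; exists (sub_fm (rsub r) B); split=> //; apply: h2.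
- have [d2 h2] := tysP s.
  exists (maxn d1 d2).+1 => -[//|n]; rewrite ltnS geq_max => /andP[l1 l2] D r.
  right; do 2![apply/List.in_app_iff; right].
  apply/List.in_flat_map; exists s; split; first exact: h2.
  rewrite [sub_fm _ _]/= up_rsub.
  by apply/List.in_map_iff; exists (sub_fm (rsub (@upr _ _ s r)) A); split=> //; apply: h1.
Qed.

(** * A Henkin chain of contexts with finite sets of assumptions *)

Section Henkin.
Variable T : theory.

Definition con G (H : list (form G)) := ~ prv T H Bot.

(** Witnesses are attached to refuted universal formulas, since the existential quantifier is an
    abbreviation. *)
Definition witnessed G (H : list (form G)) (B : form G) : Prop :=
  match B in form G return list (form G) -> Prop with
  | All G s C => fun H => exists a : tm G s, prv T H (Neg (inst C a))
  | _ => fun _ => True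
  end H.

Definition good G (H : list (form G)) (B : form G) :=
  prv T H B \/ (prv T H (Neg B) /\ witnessed H B).

Lemma prv_sub_incl G D (r : subst G D) (H : list (form G)) (H' : list (form D)) A :
  (forall B, List.In B H -> List.In (sub_fm r B) H') ->
  prv T H A -> prv T H' (sub_fm r A).
Proof.
by move=> sub /prv_sub/(_ _ r)/prv_weak; apply=> B /List.in_map_iff [C [<- /sub]].
Qed.

Lemma good_sub G D (r : subst G D) (H : list (form G)) (H' : list (form D)) A :
  (forall B, List.In B H -> List.In (sub_fm r B) H') ->
  good H A -> good H' (sub_fm r A).
Proof.
move=> sub [h|[h w]]; first by left; apply: prv_sub_incl h.
right; split; first exact: (prv_sub_incl sub h).
case: A r H {h} sub w => //= G' s C r H sub [a ha]; exists (sub_tm r a).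
by rewrite -sub_inst; apply: (prv_sub_incl sub ha).
Qed.

Definition extends G D (r : ren G D) (H : list (form G)) (H' : list (form D)) :=
  con H' /\ (forall B, List.In B H -> List.In (sub_fm (rsub r) B) H').

(** A Henkin constant is a new variable of the context. When [All s C] is refuted, [Neg C] is
    assumed of the new variable; a contradiction would prove [C] of a variable on which the old
    assumptions do not depend, hence [All s C]. *)
Lemma extends_good G (H : list (form G)) (B : form G) : con H ->
  exists D (r : ren G D) H', extends r H H' /\ good H' (sub_fm (rsub r) B).
Proof.
move=> cH; case: (EM (prv T (B :: H) Bot)) => [hB|cB]; last first.
  exists G, (fun t x => x), (B :: H); rewrite -/(@ids G) !sub_fm_ids; split.
    by split=> // C hC; rewrite sub_fm_ids; right.
  by left; apply: prv_hd.
have nB : prv T H (Neg B) by apply: prv_impI.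
have trivial_case : witnessed H B ->
    exists D (r : ren G D) H', extends r H H' /\ good H' (sub_fm (rsub r) B).
  move=> w; exists G, (fun t x => x), H; rewrite -/(@ids G) !sub_fm_ids; split.
    by split=> // C hC; rewrite sub_fm_ids.
  by right.
case: B {hB} H cH nB trivial_case => {G} [G ? ?|G|G ? ?|G s C] H cH nB triv;
  try by apply: triv.
exists (s :: G), (fun t x => VS s x), (Neg C :: List.map wk_fm H).
have sub : forall B, List.In B H -> List.In (sub_fm shift B) (Neg C :: List.map wk_fm H).
  by move=> B hB; right; apply: List.in_map.
split; first split=> //.
  move=> h; apply: cH; apply: prv_impE nB _; apply: prv_allI; exact: prv_raa.
right; split; first exact: (prv_sub_incl sub nB).
exists (Var (VZ G s)); rewrite inst_up.
have -> : scons (Var (VZ G s)) (rsub (fun t x => VS s x)) = @ids (s :: G).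
  exact: subst_ext_cons.
by rewrite sub_fm_ids; apply: prv_hd.
Qed.

Lemma extends_good_list G (H : list (form G)) (l : list (form G)) : con H ->
  exists D (r : ren G D) H', extends r H H' /\
    (forall B, List.In B l -> good H' (sub_fm (rsub r) B)).
Proof.
move=> cH; elim: l => [|B l [D [r [H' [[cH' sub] g]]]]].
  exists G, (fun t x => x), H; split=> //; split=> // C hC.
  by rewrite -/(@ids G) sub_fm_ids.
have [D' [r' [H'' [[cH'' sub'] g']]]] := extends_good (sub_fm (rsub r) B) cH'.
have e C : sub_fm (rsub (fun t x => r' t (r t x))) C = sub_fm (rsub r') (sub_fm (rsub r) C).
  by rewrite sub_fm_comp.
exists D', (fun t x => r' t (r t x)), H''; split.
  by split=> // C hC; rewrite e; apply/sub'/sub.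
move=> C /= [<-|hC]; rewrite e //.
exact: good_sub sub' (g _ hC).
Qed.

Record state := State { sG : ctx; sH : list (form sG); scon : con sH }.

Definition next_spec n (s : state) (p : {s' : state & ren (sG s) (sG s')}) :=
  extends (projT2 p) (sH s) (sH (projT1 p)) /\
  (forall B, List.In B (forms n (sG s)) ->
     good (sH (projT1 p)) (sub_fm (rsub (projT2 p)) B)).

Lemma next_ex n s : exists p, @next_spec n s p.
Proof.
have [D [r [H' [e g]]]] := extends_good_list (forms n (sG s)) (@scon s).
by exists (existT _ (State e.1) r).
Qed.

Variables (A0 : sentence) (nA0 : ~ (T ⊢ A0)).

Lemma con0 : con [:: Neg A0].
Proof. by move=> h; apply: nA0; apply: prv_raa. Qed.

Fixpoint chain n : state :=
  match n with
  | 0 => State con0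
  | n.+1 => projT1 (sval (cid (next_ex n (chain n))))
  end.

Definition Gc n := sG (chain n).
Definition Hc n : list (form (Gc n)) := sH (chain n).
Definition tr n : ren (Gc n) (Gc n.+1) := projT2 (sval (cid (next_ex n (chain n)))).
Definition trs n : subst (Gc n) (Gc n.+1) := rsub (@tr n).

Lemma chainP n : (forall B, List.In B (Hc n) -> List.In (sub_fm (@trs n) B) (Hc n.+1)) /\
  (forall B, List.In B (forms n (Gc n)) -> good (Hc n.+1) (sub_fm (@trs n) B)).
Proof. by have [[_ h] g] := svalP (cid (next_ex n (chain n))). Qed.

Lemma prv_step n A : prv T (Hc n) A -> prv T (Hc n.+1) (sub_fm (@trs n) A).
Proof. by apply: prv_sub_incl; apply: (chainP n).1. Qed.

Lemma con_chain n : con (Hc n).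
Proof. exact: scon. Qed.

(** The [junk] values below [n] only make the sequence total; what is asserted of it starts at
    [n]. *)
Lemma extend_from (X : nat -> Type) (f : forall p, X p -> X p.+1) (junk : forall p, X p) n
  (a : X n) : exists x : forall p, X p, x n = a /\ forall p, n <= p -> x p.+1 = f p (x p).
Proof.
elim: n X f junk a => [|n IH] X f junk a.
  by exists (nat_rect X a f).
have [x [h1 h2]] := IH (fun p => X p.+1) (fun p => f p.+1) (fun p => junk p.+1) a.
exists (fun p => match p with 0 => junk 0 | p.+1 => x p end); split=> //.
by case=> // p; rewrite ltnS => /h2.
Qed.

Fixpoint dflt G t : tm G t :=
  match t with N => Zero | s ~> t => CK · dflt G t end.

(** A thread is an element of the direct limit of the sets of terms, not yet divided by agreement at
    late stages; the quotient by extensional equality takes care of that. *)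
Definition coh t (x : forall p, tm (Gc p) t) :=
  exists n, forall p, n <= p -> x p.+1 = sub_tm (@trs p) (x p).
Definition thread t := {x : forall p, tm (Gc p) t | coh x}.

Lemma thread_from n t (a : tm (Gc n) t) :
  exists x : thread t, sval x n = a /\
    forall p, n <= p -> sval x p.+1 = sub_tm (@trs p) (sval x p).
Proof.
have [x [h1 h2]] := extend_from (fun p => @sub_tm _ _ (@trs p) t) (fun p => dflt _ t) a.
by exists (exist _ x (ex_intro _ n h2)).
Qed.

Definition cohF (A : forall p, form (Gc p)) :=
  exists n, forall p, n <= p -> A p.+1 = sub_fm (@trs p) (A p).
Definition Tr (A : forall p, form (Gc p)) := exists n, forall p, n <= p -> prv T (Hc p) (A p).

Lemma Tr_from A n m : (forall p, n <= p -> A p.+1 = sub_fm (@trs p) (A p)) -> n <= m ->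
  prv T (Hc m) (A m) -> Tr A.
Proof.
move=> cA nm h; exists m; elim=> [|p IH]; first by rewrite leqn0 => /eqP e; move: h; rewrite e.
rewrite leq_eqVlt => /predU1P[<- //|]; rewrite ltnS => mp.
by rewrite cA ?(leq_trans nm) //; apply/prv_step/IH.
Qed.

Lemma Tr_bot : ~ Tr (fun _ => Bot).
Proof. by case=> n /(_ n (leqnn n)); apply: con_chain. Qed.

Lemma cohF_ren A n : (forall p, n <= p -> A p.+1 = sub_fm (@trs p) (A p)) ->
  forall p, n <= p -> exists r : ren (Gc n) (Gc p), A p = sub_fm (rsub r) (A n).
Proof.
move=> cA; elim=> [|p IH].
  rewrite leqn0 => /eqP <-; exists (fun t x => x); by rewrite -/(@ids _) sub_fm_ids.
rewrite leq_eqVlt => /predU1P[<-|]; first by exists (fun t x => x); rewrite -/(@ids _) sub_fm_ids.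
rewrite ltnS => np; have [r e] := IH np; exists (fun t x => @tr p t (r t x)).
by rewrite cA // e sub_fm_comp.
Qed.

Lemma cohF_good A n m : (forall p, n <= p -> A p.+1 = sub_fm (@trs p) (A p)) ->
  exists k, m <= k /\ n <= k /\ good (Hc k) (A k).
Proof.
move=> cA; have [d h] := formsP (A n).
have lm : n <= maxn m (maxn n d) by rewrite !leq_max leqnn orbT.
exists (maxn m (maxn n d)).+1; split; first by rewrite ltnW // ltnS leq_maxl.
split; first exact: ltnW.
rewrite cA //; apply: (chainP _).2; have [r ->] := cohF_ren cA lm.
by apply: h; rewrite !leq_max leqnn !orbT.
Qed.

Lemma Tr_em A : cohF A -> Tr A \/ Tr (fun p => Neg (A p)).
Proof.
move=> [n cA]; have [m [_ [nm [h|[h _]]]]] := cohF_good 0 cA; [left|right];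
  apply: (Tr_from (n := n) (m := m)) => //.
by move=> p np; rewrite cA.
Qed.

Lemma Tr_mp A B : Tr (fun p => Imp (A p) (B p)) -> Tr A -> Tr B.
Proof.
move=> [n h] [m k]; exists (maxn n m) => p; rewrite geq_max => /andP[np mp].
exact: prv_impE (h p np) (k p mp).
Qed.

Lemma Tr_imp A B : cohF A -> cohF B ->
  Tr (fun p => Imp (A p) (B p)) <-> (Tr A -> Tr B).
Proof.
move=> cA cB; split=> [|h]; first exact: Tr_mp.
case: (Tr_em cA) => [/h [n k]|[n k]]; exists n => p np; apply: prv_impI.
  exact/prv_cons/k.
apply: prv_botE; apply: prv_impE (prv_hd _ _ _); exact/prv_cons/k.
Qed.

(** From right to left: a late stage either proves the universal formula or holds a counterexample,
    and a counterexample extends to a thread. *)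
Lemma Tr_all s (A : forall p, form (s :: Gc p)) :
  (exists n, forall p, n <= p -> A p.+1 = sub_fm (up (@trs p)) (A p)) ->
  Tr (fun p => All s (A p)) <-> forall x : thread s, Tr (fun p => inst (A p) (sval x p)).
Proof.
move=> cA; split=> [[n h] x|h].
  by exists n => p np; apply: prv_allE; apply: h.
have [n cAn] := cA.
have cA' p : n <= p -> All s (A p.+1) = sub_fm (@trs p) (All s (A p)).
  by move=> np /=; rewrite cAn.
have [m [_ [nm [k|[_ /= [a ka]]]]]] := cohF_good (A := fun p => All s (A p)) 0 cA'.
  exact: (Tr_from (A := fun p => All s (A p)) cA' nm).
have [x [xn cx]] := thread_from a.
have := h x; have : Tr (fun p => Neg (inst (A p) (sval x p))).
  apply: (Tr_from (n := m) (m := m)) => //; last by rewrite xn.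
  by move=> p np; rewrite /= cx // sub_inst cAn // (leq_trans nm).
move=> h1 h2; case: Tr_bot; exact: (Tr_mp (B := fun p => Bot) h1 h2).
Qed.

Lemma th_app_subproof s t (f : thread (s ~> t)) (a : thread s) :
  coh (fun p => sval f p · sval a p).
Proof.
case: f a => [f [n hf]] [a [m ha]]; exists (maxn n m) => p; rewrite geq_max => /andP[np mp] /=.
by rewrite hf ?ha.
Qed.

Lemma th_const_subproof t (c : forall G, tm G t) :
  (forall n, c (Gc n.+1) = sub_tm (@trs n) (c (Gc n))) -> coh (fun p => c (Gc p)).
Proof. by move=> h; exists 0. Qed.

Definition th_const t (c : forall G, tm G t) h : thread t :=
  exist _ _ (@th_const_subproof t c h).

Definition henkin : structure :=
  @Str thread (fun s t f a => exist _ _ (th_app_subproof f a))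
    (fun a b => Tr (fun p => Eq0 (sval a p) (sval b p)))
    (th_const (c := @Zero) (fun _ => erefl))
    (th_const (c := @Succ) (fun _ => erefl))
    (fun s t => th_const (c := fun G => @CK G s t) (fun _ => erefl))
    (fun r s t => th_const (c := fun G => @CS G r s t) (fun _ => erefl))
    (th_const (c := @Rec) (fun _ => erefl)).

Definition thsub D (g : env henkin D) p : subst D (Gc p) :=
  fun t x => sval (lk x g : thread t) p.

Lemma ev_henkin D t (a : tm D t) (g : env henkin D) p :
  sval (ev a g : thread t) p = sub_tm (thsub g p) a.
Proof. by elim: a => //= s t' f -> b ->. Qed.

Lemma thsub_coh D (g : env henkin D) :
  exists n, forall p, n <= p -> thsub g p.+1 = comp (thsub g p) (@trs p).
Proof.
elim: D g => [|s D IH] g; first by exists 0 => p _; apply: subst_nil_ext.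
case: g => [[x [n hx]] g]; have [m h] := IH g; exists (maxn n m) => p.
rewrite geq_max => /andP[np mp]; apply: subst_ext_cons; first exact: hx.
by move=> t y; have := congr1 (fun r : subst D _ => r t y) (h p mp).
Qed.

Lemma henkin_truth D (A : form D) (g : env henkin D) :
  sat A g <-> Tr (fun p => sub_fm (thsub g p) A).
Proof.
have cF G (B : form G) (h : env henkin G) : cohF (fun p => sub_fm (thsub h p) B).
  by have [n hn] := thsub_coh h; exists n => p np; rewrite hn // sub_fm_comp.
elim: A g => {D} [D a b|D|D A hA B hB|D s A hA] g.
- by split=> -[n h]; exists n => p /h; rewrite /= !ev_henkin.
- by split=> // /Tr_bot.
- by rewrite /= hA hB Tr_imp.
- rewrite [sat _ _]/= (Tr_all (A := fun p => sub_fm (up (thsub g p)) A)); last first.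
    by have [n hn] := thsub_coh g; exists n => p np; rewrite hn // sub_fm_comp comp_up.
  split=> h x; have := h x; rewrite hA => -[n k]; exists n => p /k.
    rewrite inst_up; congr (prv T _ (sub_fm _ _)); exact: subst_ext_cons.
  rewrite inst_up; congr (prv T _ (sub_fm _ _)); exact: subst_ext_cons.
Qed.

Lemma henkin_model : (forall B, T B -> sat (M := henkin) B tt) /\ ~ sat (M := henkin) A0 tt.
Proof.
split=> [B TB|]; rewrite henkin_truth.
  exists 0 => p _; suff -> : sub_fm (thsub (D := [::]) tt p) B = lift B by apply: prv_ax.
  by congr sub_fm; apply: subst_nil_ext.
move=> [n h]; apply: (con_chain (n := n)).
have e k : sub_fm (thsub (D := [::]) tt k) A0 = lift A0.
  by congr sub_fm; apply: subst_nil_ext.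
have := h n (leqnn n); rewrite e; apply: prv_impE => {e}.
elim: n {h} => [|n IH].
  by apply: prv_hyp; left; rewrite lift_nil.
by have := prv_step IH; rewrite /= sub_lift.
Qed.

End Henkin.

Lemma model_existence (T : theory) (A : sentence) : ~ (T ⊢ A) ->
  exists M : structure, (forall B, T B -> sat (M := M) B tt) /\ ~ sat (M := M) A tt.
Proof. by move=> nA; exists (henkin nA); apply: henkin_model. Qed.

(** * Extensional models *)

Notation "x ;; g" := (@pair (car _ _) (env _ _) x g) (at level 60, right associativity).

Definition extensional (M : structure) := (forall a b : car M N, eqN a b <-> a = b) /\
  (forall s t (f g : car M (s ~> t)), (forall x, f @ x = g @ x) -> f = g).

(** In an extensional structure the axioms become plain equations. Induction keeps its formulas,
    since the numbers may be nonstandard; choice is stated for predicates given by a functional, to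
    which [rca_sat] reduces the quantifier-free formulas. *)
Record rca (M : structure) : Prop := Rca {
  r_ext : extensional M;
  r_K : forall s t (x : car M s) (y : car M t), cK @ x @ y = x;
  r_S : forall r s t (x : car M (r ~> s ~> t)) (y : car M (r ~> s)) z,
    cSS @ x @ y @ z = x @ z @ (y @ z);
  r_R0 : forall h (a : car M N), cR @ h @ a @ cZ = a;
  r_RS : forall h (a n : car M N), cR @ h @ a @ (cS @ n) = h @ n @ (cR @ h @ a @ n);
  r_S0 : forall n : car M N, cS @ n <> cZ;
  r_Sinj : forall m n : car M N, cS @ m = cS @ n -> m = n;
  r_ind : forall G (A : form (N :: G)) (g : env M G), qf A -> sat A (cZ ;; g) ->
    (forall n, sat A (n ;; g) -> sat A (cS @ n ;; g)) -> forall n, sat A (n ;; g);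
  r_ac : forall P : car M (t1 ~> N ~> N), (forall f, exists n, P @ f @ n = cZ) ->
    exists F : car M t2, forall f, P @ f @ (F @ f) = cZ }.

Section Eqv.
Variable M : structure.

Fixpoint eqv t : car M t -> car M t -> Prop :=
  match t with
  | N => fun a b => eqN a b
  | s ~> t => fun f g => forall x, eqv (f @ x) (g @ x)
  end.

Lemma sat_Eq t : forall G (a b : tm G t) (g : env M G),
  sat (Eq a b) g <-> eqv (ev a g) (ev b g).
Proof.
elim: t => //= s hs t ht G a b g.
by split=> h x; have := h x; rewrite ht /= !ev_wk.
Qed.

Lemma eqv_eq : extensional M -> forall t (a b : car M t), eqv a b <-> a = b.
Proof.
move=> [eN ext]; elim=> [|s hs t ht] a b /=; first exact: eN.
by split=> [h|-> x]; [apply: ext => x; rewrite -ht|rewrite ht].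
Qed.

Lemma sat_choice_matrix G s t (A : form (t :: s :: G)) g (x : car M s)
    (F : car M (s ~> t)) :
  sat (choice_matrix A) (x, (F, g)) <-> sat A (F @ x, (x, g)).
Proof.
rewrite sat_sub; suff -> : envs (scons (Var (VS s (VZ G (s ~> t))) · Var (VZ _ s))
  (scons (Var (VZ _ s)) (fun r y => Var (VS s (VS (s ~> t) y))))) (x, (F, g)) = (F @ x, (x, g)) by [].
by rewrite !envs_scons /=; congr (_, (_, _)); apply: env_ext => r y; rewrite lk_envs.
Qed.

Lemma sat_succ G (A : form (N :: G)) g (n : car M N) :
  sat (sub_fm (scons (Succ · Var (VZ G N)) shift) A) (n ;; g) <-> sat A (cS @ n ;; g).
Proof. by rewrite sat_sub envs_scons envs_shift. Qed.

End Eqv.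

Section Quotient.
Variable M : structure.
Hypothesis hM : forall B, RCA0w B -> sat (M := M) B tt.

Lemma eqv_refl t (x : car M t) : eqv x x.
Proof.
elim: t x => [|s hs t ht] x /=; last by move=> y; apply: ht.
exact: (hM ax_refl x).
Qed.

Lemma eqv_sym t (x y : car M t) : eqv x y -> eqv y x.
Proof.
elim: t x y => [|s hs t ht] x y /=; last by move=> h z; apply: ht.
exact: (hM ax_sym x y).
Qed.

Lemma eqv_trans t (x y z : car M t) : eqv x y -> eqv y z -> eqv x z.
Proof.
elim: t x y z => [|s hs t ht] x y z /=; last by move=> h k w; apply: ht (h w) (k w).
exact: (hM ax_trans x y z).
Qed.

Lemma eqv_app s t (f g : car M (s ~> t)) x y : eqv f g -> eqv x y -> eqv (f @ x) (g @ y).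
Proof.
move=> fg xy; apply: eqv_trans (fg y).
have := hM (@ax_ext s t); rewrite sat_all => /(_ f); rewrite sat_all => /(_ x).
by rewrite sat_all => /(_ y); rewrite sat_imp !sat_Eq /=; apply.
Qed.

Definition pick t (P : car M t -> Prop) : car M t :=
  match pselect (exists x, P x) with
  | left h => sval (cid h)
  | right _ => ev (dflt [::] t) tt
  end.

(** Equivalent elements define equal predicates [eqv x], so the element picked depends on the class
    only; the quotient becomes the subtype of fixed points of [rep]. *)
Definition rep t (x : car M t) := pick (eqv x).

Lemma repP t (x : car M t) : eqv x (rep x).
Proof.
rewrite /rep /pick; case: pselect => [h|[]]; first exact: svalP.
by exists x; apply: eqv_refl.
Qed.

Lemma rep_eq t (x y : car M t) : eqv x y -> rep x = rep y.
Proof.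
move=> xy; rewrite /rep; congr pick; apply: funext => z; apply: propext.
by split; apply: eqv_trans => //; apply: eqv_sym.
Qed.

Definition qcar t := {x : car M t | rep x = x}.
Definition cl t (x : car M t) : qcar t := exist _ (rep x) (esym (rep_eq (repP x))).

Definition quotient : structure :=
  @Str qcar (fun s t f x => cl (sval f @ sval x)) eq (cl cZ) (cl cS)
    (fun s t => cl cK) (fun r s t => cl cSS) (cl cR).

Lemma cl_eqv t (x : car M t) (y : qcar t) : eqv x (sval y) <-> cl x = y.
Proof.
case: y => y hy; split=> [/= xy|<-]; last exact: repP.
by apply: eq_exist; rewrite /= -hy; apply: rep_eq.
Qed.

Fixpoint related G : env M G -> env quotient G -> Prop :=
  match G return env M G -> env quotient G -> Prop with
  | [::] => fun _ _ => True
  | s :: G' => fun g g' => eqv g.1 (sval (g'.1 : qcar s)) /\ related g.2 g'.2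
  end.

Lemma ev_related G t (a : tm G t) (g : env M G) (g' : env quotient G) :
  related g g' -> eqv (ev a g) (sval (ev a g' : qcar t)).
Proof.
move=> rg; elim: a => [t' x|s t' f hf b hb||  |s t'|r s t'|]; try exact: (repP _).
  by elim: x g g' rg => [G' s|G' s u x IH] [x1 g] [x2 g'] [h1 h2] //; apply: IH.
by apply: eqv_trans (repP _); apply: eqv_app.
Qed.

Lemma sat_related G (A : form G) : forall (g : env M G) (g' : env quotient G),
  related g g' -> sat A g <-> sat A g'.
Proof.
elim: A => {G} [G a b|G|G A hA B hB|G s A hA] g g' rg //.
- have ha := ev_related a rg; have hb := ev_related b rg.
  rewrite /=; split=> [h|h]; last first.
    by apply: (eqv_trans (t := N) ha); rewrite h; apply: eqv_sym.
  have e : eqv (sval (ev a g' : qcar N)) (sval (ev b g' : qcar N)).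
    exact: eqv_trans (eqv_sym ha) (eqv_trans (t := N) h hb).
  move/cl_eqv: e => <-; symmetry; apply/cl_eqv; exact: eqv_refl.
- by rewrite /= (hA _ _ rg) (hB _ _ rg).
- split=> h x.
    by apply/(hA (sval (x : qcar s) ;; g)) => //; split=> //; apply: eqv_refl.
  have rx : related (G := s :: G) (x ;; g) ((cl x : car quotient s) ;; g') by split=> //; apply: repP.
  by apply/(hA _ _ rx); apply: h.
Qed.

Lemma quotient_ext : extensional quotient.
Proof.
split=> // s t f g h.
have e : eqv (sval (f : qcar (s ~> t))) (sval (g : qcar (s ~> t))).
  move=> x; have e := h (cl x).
  apply: eqv_trans (eqv_app (eqv_refl _) (repP x)) _; apply: eqv_sym.
  apply: eqv_trans (eqv_app (eqv_refl _) (repP x)) _.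
  by have := e => /(congr1 (fun y : qcar t => sval y)) /= e'; apply: eqv_trans (repP _) _;
    rewrite -e'; apply: eqv_sym; apply: repP.
by move/cl_eqv: e => <-; symmetry; apply/cl_eqv; apply: eqv_refl.
Qed.

Lemma quotient_sat (A : sentence) : sat (M := M) A tt <-> sat (M := quotient) A tt.
Proof. exact: sat_related. Qed.

Lemma quotient_rca : rca quotient.
Proof.
have ext := quotient_ext.
have ax B : RCA0w B -> sat (M := quotient) B tt by move/hM; rewrite quotient_sat.
move: quotient ext ax => Q ext ax; have E t (a b : car Q t) := eqv_eq ext a b.
split=> //.
- by move=> s t x y; have /sat_all/(_ x)/sat_all/(_ y)/sat_Eq := ax _ (@ax_K s t); rewrite E.
- by move=> r s t x y z; have /sat_all/(_ x)/sat_all/(_ y)/sat_all/(_ z)/sat_Eq := ax _ (@ax_S r s t); rewrite E.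
- by move=> h a; have := ax _ ax_Rec_0 h a; rewrite /= ext.1.
- by move=> h a n; have := ax _ ax_Rec_S h a n; rewrite /= ext.1.
- by move=> n; have := ax _ ax_S_0 n; rewrite /= ext.1.
- by move=> m n; have := ax _ ax_S_inj m n; rewrite /= !ext.1.
- move=> G A g qA; have := ax _ (ax_qf_ind qA); rewrite sat_closure => /(_ g) /= h h0 hS.
  apply: h; first by rewrite sat_inst.
  by move=> n hn; rewrite sat_succ; apply: hS.
- move=> P hP; pose G : ctx := [:: t1 ~> N ~> N].
  pose A : form (N :: t1 :: G) :=
    Var (VS _ (VS _ (VZ _ _))) · Var (VS _ (VZ _ _)) · Var (VZ _ _) ≡ Zero.
  have := ax _ (@ax_qf_ac G A I); rewrite sat_closure => /(_ (P, tt)).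
  have h : sat (∀' t1, ∃' N, A) ((P, tt) : env Q G).
    by move=> f; rewrite sat_ex; have [n hn] := hP f; exists n; rewrite /= ext.1.
  move=> /sat_imp/(_ h)/sat_ex[F /sat_all hF]; exists F => f; have := hF f.
  by rewrite sat_choice_matrix /= ext.1.
Qed.

End Quotient.

Lemma completeness (T : theory) (A : sentence) : (forall B, RCA0w B -> T B) ->
  (forall M, rca M -> (forall B, T B -> sat (M := M) B tt) -> sat (M := M) A tt) -> T ⊢ A.
Proof.
move=> hT h; apply: contrapT => /model_existence [M [hM nA]].
have hM' B : RCA0w B -> sat (M := M) B tt by move/hT/hM.
apply: nA; rewrite (quotient_sat hM'); apply: h; first exact: quotient_rca.
by move=> B /hM; rewrite (quotient_sat hM').
Qed.

Record model := Model { mstr :> structure; mrca : rca mstr }.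

(* Hides the body of an operation from unification. *)
Lemma seal T (x : T) : {y | y = x}.
Proof. by exists x. Qed.

(** * Definable functions of a model *)

Section Definability.
Context {M : model}.
Notation hM := (mrca M).

Lemma car_ext s t (f g : car M (s ~> t)) : (forall x, f @ x = g @ x) -> f = g.
Proof. exact: (@r_ext _ hM).2. Qed.

(** Combinatory polynomials with elements of the model as constants, taken as functions of the host
    logic rather than as terms; [Def_lam_ex] is bracket abstraction for them. *)
Inductive Def (G : ctx) : forall t, (env M G -> car M t) -> Prop :=
| Def_var t (x : var G t) : Def (fun g => lk x g)
| Def_const t (c : car M t) : Def (fun _ => c)
| Def_app s t (f : env M G -> car M (s ~> t)) a :
    Def f -> Def a -> Def (fun g => f g @ a g).

Lemma Def_lam_ex s G t (f : env M (s :: G) -> car M t) : Def f ->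
  exists h : env M G -> car M (s ~> t), Def h /\ forall g x, h g @ x = f (x, g).
Proof.
elim=> {t f} [t x|t c|r t f a _ [h [dh eh]] _ [k [dk ek]]].
- elim/var_case: t / x => [|t x].
    exists (fun _ => cSS @ cK @ cK (t := s)); split; first exact: Def_const.
    by move=> g x; rewrite (@r_S _ hM) (@r_K _ hM).
  exists (fun g => cK @ lk x g); split; last by move=> g y; rewrite (@r_K _ hM).
  exact: Def_app (Def_const _ _) (Def_var x).
- by exists (fun g => cK @ c); split; [exact: Def_const|move=> g y; rewrite (@r_K _ hM)].
- exists (fun g => cSS @ h g @ k g); split; last by move=> g y; rewrite (@r_S _ hM) eh ek.
  exact: Def_app (Def_app (Def_const _ _) dh) dk.
Qed.

(** Defined by choice for arbitrary [f], so that it can be written without carrying a proof. It is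
    meaningful when [f] is definable, as [beta] demands, and then unique by extensionality. *)
Definition LAM s t (f : car M s -> car M t) : car M (s ~> t) :=
  pick (fun h => forall x, h @ x = f x).

Lemma LAM_eq s t (f : car M s -> car M t) (h : car M (s ~> t)) :
  (forall x, h @ x = f x) -> LAM f = h.
Proof.
move=> hf; rewrite /LAM /pick; case: pselect => [k|[]]; last by exists h.
by apply: car_ext => x; rewrite (svalP (cid k)) hf.
Qed.

Lemma beta s t (f : car M s -> car M t) : Def (G := [:: s]) (fun g => f g.1) ->
  forall x, LAM f @ x = f x.
Proof.
move=> /Def_lam_ex [h [_ e]]; rewrite (LAM_eq (h := h tt)) => [x|x]; exact: (e tt x).
Qed.

Lemma Def_LAM s G t (f : env M G -> car M s -> car M t) :
  Def (G := s :: G) (fun g => f g.2 g.1) -> Def (fun g => LAM (f g)).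
Proof.
move=> /Def_lam_ex [h [dh e]]; suff -> : (fun g => LAM (f g)) = h by [].
by apply: funext => g; apply: LAM_eq => x; rewrite e.
Qed.

(** The tactic [def] finds these instances and so treats an operation as primitive once it has been
    shown to belong to the model. *)
Class D1 s t (f : car M s -> car M t) := d1 : exists h, forall x, h @ x = f x.
Class D2 r s t (f : car M r -> car M s -> car M t) :=
  d2 : exists h, forall x y, h @ x @ y = f x y.
Class D3 q r s t (f : car M q -> car M r -> car M s -> car M t) :=
  d3 : exists h, forall x y z, h @ x @ y @ z = f x y z.

Lemma Def_op1 G s t f (H : D1 f) (a : env M G -> car M s) :
  Def a -> Def (fun g => f (a g) : car M t).
Proof.
case: H => h e da; under eq_fun do rewrite -e.
exact: Def_app (Def_const _ _) da.
Qed.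

Lemma Def_op2 G r s t f (H : D2 f) (a : env M G -> car M r) (b : env M G -> car M s) :
  Def a -> Def b -> Def (fun g => f (a g) (b g) : car M t).
Proof.
case: H => h e da db; under eq_fun do rewrite -e.
exact: Def_app (Def_app (Def_const _ _) da) db.
Qed.

Lemma Def_op3 G q r s t f (H : D3 f) (a : env M G -> car M q) (b : env M G -> car M r)
    (c : env M G -> car M s) :
  Def a -> Def b -> Def c -> Def (fun g => f (a g) (b g) (c g) : car M t).
Proof.
case: H => h e da db dc; under eq_fun do rewrite -e.
exact: Def_app (Def_app (Def_app (Def_const _ _) da) db) dc.
Qed.

Lemma D1_intro s t (f : car M s -> car M t) : Def (G := [:: s]) (fun g => f g.1) -> D1 f.
Proof. by move=> /beta e; exists (LAM f). Qed.

Lemma D2_intro r s t (f : car M r -> car M s -> car M t) :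
  Def (G := [:: s; r]) (fun g => f g.2.1 g.1) -> D2 f.
Proof.
move=> h; have [k [dk e]] := Def_lam_ex h; have [l [_ e']] := Def_lam_ex dk.
by exists (l tt) => x y; rewrite e' e.
Qed.

Lemma D3_intro q r s t (f : car M q -> car M r -> car M s -> car M t) :
  Def (G := [:: s; r; q]) (fun g => f g.2.2.1 g.2.1 g.1) -> D3 f.
Proof.
move=> h; have [k [dk e]] := Def_lam_ex h; have [l [dl e']] := Def_lam_ex dk.
by have [m [_ e'']] := Def_lam_ex dl; exists (m tt) => x y z; rewrite e'' e' e.
Qed.

Definition recf (h : car M N -> car M N -> car M N) (a n : car M N) : car M N :=
  cR @ LAM (fun i => LAM (h i)) @ a @ n.

Lemma recf0 h a : recf h a cZ = a.
Proof. exact: (@r_R0 _ hM). Qed.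

Lemma recfS h a n : Def (G := [:: N; N]) (fun g => h g.2.1 g.1) ->
  recf h a (cS @ n) = h n (recf h a n).
Proof.
move=> dh; rewrite /recf (@r_RS _ hM); rewrite beta.
  rewrite beta //; have [l e] : D2 h by apply: D2_intro.
  have -> : (fun g : env M [:: N] => h n g.1) = (fun g => l @ n @ g.1).
    by apply: funext => g; rewrite e.
  apply: Def_app (Def_const _ _) (Def_var (VZ _ _)).
exact: (Def_LAM (G := [:: N]) (f := fun g => h g.1)).
Qed.

Lemma Def_recf G (h : env M G -> car M N -> car M N -> car M N) a n :
  Def (G := [:: N, N & G]) (fun g => h g.2.2 g.2.1 g.1) -> Def a -> Def n ->
  Def (fun g => recf (h g) (a g) (n g)).
Proof.
move=> dh da dn; rewrite /recf.
apply: Def_app => //; apply: Def_app => //; apply: Def_app; first exact: Def_const.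
apply: (Def_LAM (f := fun g i => LAM (h g i))).
exact: (Def_LAM (G := N :: G) (f := fun g => h g.2 g.1)).
Qed.

End Definability.

Arguments D1 {M s t} f.
Arguments D2 {M r s t} f.
Arguments D3 {M q r s t} f.
Arguments LAM {M s t} f.
Arguments recf {M} h a n.

(** Redefined once conditionals and bounded search are available. *)
Ltac def_hook := fail.

Ltac def :=
  cbv beta;
  lazymatch goal with
  | |- Def (fun _ => ?c) => exact (Def_const _ c)
  | |- Def (fun g => app (@?f g) (@?a g)) => apply (@Def_app _ _ _ _ f a); def
  | |- Def (fun g => LAM (@?f g)) => apply (@Def_LAM _ _ _ _ f); def
  | |- Def (fun g => recf (@?h g) (@?a g) (@?n g)) =>
      apply (@Def_recf _ _ h a n); def
  | |- _ =>
      first [ exact (Def_var (VZ _ _))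
            | exact (Def_var (VS _ (VZ _ _)))
            | exact (Def_var (VS _ (VS _ (VZ _ _))))
            | exact (Def_var (VS _ (VS _ (VS _ (VZ _ _)))))
            | exact (Def_var (VS _ (VS _ (VS _ (VS _ (VZ _ _))))))
            | exact (Def_var (VS _ (VS _ (VS _ (VS _ (VS _ (VZ _ _)))))))
            | exact (Def_var (VS _ (VS _ (VS _ (VS _ (VS _ (VS _ (VZ _ _))))))))
            | def_op
            | def_hook ]
  end
with def_op :=
  first
  [ lazymatch goal with
    | |- Def (fun g => ?f (@?a g) (@?b g)) => apply (@Def_op2 _ _ _ _ _ f _ a b)
    end; [def | def]
  | lazymatch goal with
    | |- Def (fun g => ?f (@?a g) (@?b g) (@?c g)) => apply (@Def_op3 _ _ _ _ _ _ f _ a b c)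
    end; [def | def | def]
  | lazymatch goal with
    | |- Def (fun g => ?f (@?a g)) => apply (@Def_op1 _ _ _ _ f _ a)
    end; def ].

(** * Arithmetic from quantifier-free induction *)

Section Arithmetic.
Context {M : model}.
Notation hM := (mrca M).
Notation NN := (car M N).

Definition sc (n : NN) : NN := cS @ n.
#[global] Instance D1_sc : D1 sc. Proof. by exists cS. Qed.

Lemma eq_ind1 (f g : NN -> NN) : Def (G := [:: N]) (fun e => f e.1) ->
  Def (G := [:: N]) (fun e => g e.1) ->
  f cZ = g cZ -> (forall n, f n = g n -> f (sc n) = g (sc n)) -> forall n, f n = g n.
Proof.
move=> df dg h0 hS n; have eN := (@r_ext _ hM).1.
pose G : ctx := [:: N ~> N; N ~> N].
pose A : form (N :: G) := Var (VS _ (VZ _ _)) · Var (VZ _ _) ≡ Var (VS _ (VS _ (VZ _ _))) · Var (VZ _ _).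
have := @r_ind _ hM G A (LAM f, (LAM g, tt)) I; rewrite /= !eN !beta //.
move=> /(_ h0) h; have : forall n, LAM f @ n = LAM g @ n.
  by move=> m; rewrite -eN; apply: h => k; rewrite !eN !beta //; apply: hS.
by move=> /(_ n); rewrite !beta.
Qed.

Definition add := sval (seal (fun (x y : NN) => recf (fun _ r => sc r) x y)).
Definition add_unlock : add = _ := svalP (seal _).
Definition mul := sval (seal (fun (x y : NN) => recf (fun _ r => add r x) cZ y)).
Definition mul_unlock : mul = _ := svalP (seal _).
Definition prd := sval (seal (fun (n : NN) => recf (fun i _ => i) cZ n)).
Definition prd_unlock : prd = _ := svalP (seal _).
Definition sub := sval (seal (fun (x y : NN) => recf (fun _ r => prd r) x y)).
Definition sub_unlock : sub = _ := svalP (seal _).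
Definition o1 : NN := sc cZ.
#[global] Instance D2_add : D2 add. Proof. by apply: D2_intro; rewrite add_unlock; def. Qed.
#[global] Instance D2_mul : D2 mul. Proof. by apply: D2_intro; rewrite mul_unlock; def. Qed.
#[global] Instance D1_prd : D1 prd. Proof. by apply: D1_intro; rewrite prd_unlock; def. Qed.
#[global] Instance D2_sub : D2 sub. Proof. by apply: D2_intro; rewrite sub_unlock; def. Qed.

Lemma naddr0 x : add x cZ = x. Proof. by rewrite add_unlock recf0. Qed.
Lemma naddrS x y : add x (sc y) = sc (add x y). Proof. by rewrite add_unlock recfS //; def. Qed.
Lemma nmulr0 x : mul x cZ = cZ. Proof. by rewrite mul_unlock recf0. Qed.
Lemma nmulrS x y : mul x (sc y) = add (mul x y) x. Proof. by rewrite mul_unlock recfS //; def. Qed.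
Lemma prd0 : prd cZ = cZ. Proof. by rewrite prd_unlock recf0. Qed.
Lemma prdS n : prd (sc n) = n. Proof. by rewrite prd_unlock recfS //; def. Qed.
Lemma nsubr0 x : sub x cZ = x. Proof. by rewrite sub_unlock recf0. Qed.
Lemma nsubrS x y : sub x (sc y) = prd (sub x y). Proof. by rewrite sub_unlock recfS //; def. Qed.

Ltac eqind := apply: eq_ind1; [by def | by def | |].

Lemma nadd0r x : add cZ x = x.
Proof. by move: x; eqind => [|n]; rewrite ?naddr0 // naddrS => ->. Qed.

Lemma naddSr x y : add (sc x) y = sc (add x y).
Proof. by move: y; eqind => [|n]; rewrite ?naddr0 // !naddrS => ->. Qed.

Lemma naddrC x y : add x y = add y x.
Proof. by move: y; eqind => [|n]; rewrite ?naddr0 ?nadd0r // !naddrS naddSr => ->. Qed.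

Lemma naddrA x y z : add x (add y z) = add (add x y) z.
Proof. by move: z; eqind => [|n]; rewrite ?naddr0 // !naddrS => ->. Qed.

Lemma nmul0r x : mul cZ x = cZ.
Proof. by move: x; eqind => [|n]; rewrite ?nmulr0 // nmulrS => ->; rewrite naddr0. Qed.

Lemma nmulSr x y : mul (sc x) y = add (mul x y) y.
Proof.
move: y; eqind => [|n]; rewrite ?nmulr0 ?naddr0 // !nmulrS => ->.
by rewrite !naddrS -!naddrA (naddrC n).
Qed.

Lemma nmulrC x y : mul x y = mul y x.
Proof. by move: y; eqind => [|n]; rewrite ?nmulr0 ?nmul0r // nmulrS nmulSr => ->. Qed.

Lemma nmulrDr x y z : mul x (add y z) = add (mul x y) (mul x z).
Proof.
by move: z; eqind => [|n]; rewrite ?nmulr0 ?naddr0 // naddrS !nmulrS => ->; rewrite naddrA.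
Qed.

Lemma nmulrDl x y z : mul (add x y) z = add (mul x z) (mul y z).
Proof. by rewrite nmulrC nmulrDr !(nmulrC z). Qed.

Lemma nmulrA x y z : mul x (mul y z) = mul (mul x y) z.
Proof. by move: z; eqind => [|n]; rewrite ?nmulr0 // !nmulrS nmulrDr => ->. Qed.

Lemma nmul1r x : mul o1 x = x.
Proof. by rewrite /o1 nmulSr nmul0r nadd0r. Qed.

Lemma sc_add n : sc n = add n o1.
Proof. by rewrite /o1 naddrS naddr0. Qed.

(** The other instance of induction needed before the general one: an equation together with an
    equation under a disequation. It gives the case distinction between zero and successors and the
    totality of the order. *)
Lemma ind_cond (f0 g0 f1 f2 g2 : NN -> NN) : Def (G := [:: N]) (fun e => f0 e.1) ->
  Def (G := [:: N]) (fun e => g0 e.1) -> Def (G := [:: N]) (fun e => f1 e.1) ->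
  Def (G := [:: N]) (fun e => f2 e.1) -> Def (G := [:: N]) (fun e => g2 e.1) ->
  let P n := f0 n = g0 n /\ (f1 n <> cZ -> f2 n = g2 n) in
  P cZ -> (forall n, P n -> P (sc n)) -> forall n, P n.
Proof.
move=> d0 e0 d1 d2 e2 P h0 hS; have eN := (@r_ext _ hM).1.
pose F := N ~> N; pose G : ctx := [:: F; F; F; F; F].
pose x0 : var (N :: G) F := VS _ (VZ _ _).
pose x1 : var (N :: G) F := VS _ (VS _ (VZ _ _)).
pose x2 : var (N :: G) F := VS _ (VS _ (VS _ (VZ _ _))).
pose x3 : var (N :: G) F := VS _ (VS _ (VS _ (VS _ (VZ _ _)))).
pose x4 : var (N :: G) F := VS _ (VS _ (VS _ (VS _ (VS _ (VZ _ _))))).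
pose n0 : tm (N :: G) N := Var (VZ _ _).
pose A : form (N :: G) := And (Var x0 · n0 ≡ Var x1 · n0)
   (Imp (Neg (Var x2 · n0 ≡ Zero)) (Var x3 · n0 ≡ Var x4 · n0)).
pose g : env M G := (LAM f0, (LAM g0, (LAM f1, (LAM f2, (LAM g2, tt))))).
have E n : sat A (n, g) <-> P n.
  by rewrite sat_and !sat_imp !sat_eq0 !eN /= !beta.
have qA : qf A by [].
move=> n; apply/E; apply: (@r_ind _ hM G A g qA _ _ n) => [|k]; first exact/E.
by move/E/hS/E.
Qed.

Lemma nn_case n : n = cZ \/ exists m, n = sc m.
Proof.
suff [_ h] : n = n /\ (n <> cZ -> n = sc (prd n)).
  by case: (EM (n = cZ)) => [|/h ->]; [left|right; exists (prd n)].
move: n; apply: (@ind_cond (fun n => n) (fun n => n) (fun n => n) (fun n => n)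
  (fun n => sc (prd n))); try by def.
  by split.
by move=> k _; split=> // _; rewrite prdS.
Qed.

Lemma subSS x y : sub (sc x) (sc y) = sub x y.
Proof. by move: y; eqind => [|n]; rewrite ?nsubrS ?nsubr0 ?prdS // => ->. Qed.

Lemma nsub0r x : sub cZ x = cZ.
Proof. by move: x; eqind => [|n]; rewrite ?nsubr0 // nsubrS => ->; rewrite prd0. Qed.

Lemma naddKr x y : sub (add x y) x = y.
Proof. by move: x; eqind => [|n]; rewrite ?nadd0r ?nsubr0 // naddSr subSS => ->. Qed.

Lemma nsub_add x y : sub x (add x y) = cZ.
Proof. by move: x; eqind => [|n]; rewrite ?nadd0r ?nsub0r // naddSr subSS => ->. Qed.

(** Both sides of the equation are the maximum of [x] and [y]. The conditional part is proved along
    with it because the successor step splits on whether [sub x y] vanishes. *)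
Lemma nsub_total x y : add x (sub y x) = add y (sub x y) /\ (sub x y <> cZ -> sub y x = cZ).
Proof.
move: y; apply: (@ind_cond (fun y => add x (sub y x)) (fun y => add y (sub x y))
  (fun y => sub x y) (fun y => sub y x) (fun _ => cZ)); try by def.
  by split; rewrite nsub0r ?nsubr0 ?nadd0r ?naddr0.
move=> y [e h]; case: (nn_case (sub x y)) => [z|[k ek]].
  have ey : y = add x (sub y x) by rewrite e z naddr0.
  have e1 : sub (sc y) x = sc (sub y x) by rewrite {1}ey -naddrS naddKr.
  by rewrite e1 naddrS -ey nsubrS z prd0 naddr0; split.
have z : sub y x = cZ by apply: h; rewrite ek; apply: (r_S0 hM).
have ex : x = add (sc y) k by move: e; rewrite z ek naddr0 naddrS naddSr.
have z' : sub (sc y) x = cZ by rewrite {1}ex nsub_add.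
by rewrite z' nsubrS ek prdS naddr0.
Qed.
End Arithmetic.

(** * The order of the numbers, decidable predicates and bounded search *)

Section Order.
Context {M : model}.
Notation hM := (mrca M).
Notation NN := (car M N).

Lemma nadd_injl (x y z : NN) : add x y = add x z -> y = z.
Proof. by move=> h; rewrite -(naddKr x y) h naddKr. Qed.

Lemma nadd_eq0 (x y : NN) : add x y = cZ -> x = cZ /\ y = cZ.
Proof.
case: (nn_case y) => [->|[k ->]]; first by rewrite naddr0.
by rewrite naddrS => /(r_S0 hM).
Qed.

Definition le (x y : NN) := sub x y = cZ.
Definition lt (x y : NN) := le (sc x) y.

Lemma nleE x y : le x y <-> exists c, y = add x c.
Proof.
split=> [h|[c ->]]; last exact: nsub_add.
by exists (sub y x); rewrite (nsub_total x y).1 h naddr0.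
Qed.

Lemma nle_total x y : le x y \/ le y x.
Proof. by case: (EM (sub x y = cZ)) => [|/(nsub_total x y).2]; [left|right]. Qed.

Lemma nle_refl x : le x x.
Proof. by apply/nleE; exists cZ; rewrite naddr0. Qed.

Lemma nle_trans y x z : le x y -> le y z -> le x z.
Proof. by move=> /nleE[c ->] /nleE[d ->]; apply/nleE; exists (add c d); rewrite naddrA. Qed.

Lemma nle_anti x y : le x y -> le y x -> x = y.
Proof.
move=> /nleE[c ->] /nleE[d]; rewrite -naddrA -[LHS]naddr0 => /nadd_injl.
by move=> /esym/nadd_eq0[-> _]; rewrite naddr0.
Qed.

Lemma nle0 x : le cZ x.
Proof. by apply/nleE; exists x; rewrite nadd0r. Qed.

Lemma nleSS x y : le (sc x) (sc y) <-> le x y.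
Proof. by rewrite /le subSS. Qed.

Lemma nle_S x y : le x y -> le x (sc y).
Proof. by move=> /nleE[c ->]; apply/nleE; exists (sc c); rewrite naddrS. Qed.

Lemma nltn_S n : lt n (sc n).
Proof. exact: nle_refl. Qed.

Lemma nlt_irr x : ~ lt x x.
Proof.
move=> /nleE[c]; rewrite naddSr -naddrS -[LHS]naddr0 => /nadd_injl /esym.
exact: (r_S0 hM).
Qed.

Lemma nltW x y : lt x y -> le x y.
Proof. by apply: nle_trans; apply: nle_S; apply: nle_refl. Qed.

Lemma nlt_le_trans y x z : lt x y -> le y z -> lt x z.
Proof. exact: nle_trans. Qed.

Lemma nle_lt_trans y x z : le x y -> lt y z -> lt x z.
Proof. by move=> h; apply: nle_trans; rewrite nleSS. Qed.

Lemma nlt_neq x y : lt x y <-> le x y /\ x <> y.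
Proof.
split=> [h|[/nleE[c ->] ne]]; first by split; [exact: nltW|move=> e; move: h; rewrite e; apply: nlt_irr].
case: (nn_case c) ne => [->|[k ->] _]; first by rewrite naddr0.
by apply/nleE; exists k; rewrite naddrS naddSr.
Qed.

Lemma nle_lt x y : ~ le x y <-> lt y x.
Proof.
split=> [h|h k]; last exact: nlt_irr (nle_lt_trans k h).
by apply/nlt_neq; case: (nle_total x y) => // h'; split=> // e; apply: h; rewrite e; apply: nle_refl.
Qed.

Lemma nlt_le x y : ~ lt x y <-> le y x.
Proof.
split=> h; first by apply: contrapT => /nle_lt.
by move/nlt_le_trans/(_ h)/nlt_irr.
Qed.

Lemma nltS x y : lt x (sc y) <-> le x y.
Proof. exact: nleSS. Qed.

Lemma nleS_cases x y : le x (sc y) -> le x y \/ x = sc y.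
Proof.
case: (EM (x = sc y)) => [|ne h]; first by right.
by left; apply/nltS/nlt_neq.
Qed.

Lemma nlt0 x : ~ lt x cZ.
Proof. by move=> h; apply: nlt_irr (nlt_le_trans h (nle0 x)). Qed.

Lemma nle_n0 x : le x cZ -> x = cZ.
Proof. by move=> h; apply: nle_anti => //; apply: nle0. Qed.

Lemma nle_add x y : le x (add x y).
Proof. exact: nsub_add. Qed.

Lemma nle_addr x y : le x (add y x).
Proof. by rewrite naddrC; exact: nsub_add. Qed.

Lemma nleD x y z t : le x y -> le z t -> le (add x z) (add y t).
Proof.
move=> /nleE[c ->] /nleE[d ->]; apply/nleE; exists (add c d).
by rewrite -!naddrA; congr add; rewrite !naddrA (naddrC c).
Qed.

(** * Decidable predicates *)

Definition ite (c a b : NN) := recf (fun _ _ => b) a c.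
#[global] Instance D3_ite : D3 ite. Proof. by apply: D3_intro; rewrite /ite; def. Qed.
Lemma ite0 a b : ite cZ a b = a. Proof. exact: recf0. Qed.
Lemma iteS c a b : ite (sc c) a b = b. Proof. by rewrite /ite recfS //; def. Qed.

(** The recursor produces numbers only, so a case distinction at a higher type is pushed through the
    arguments down to type 0. *)
Lemma ite_ex t : exists h : car M (N ~> t ~> t ~> t), forall a b,
  h @ cZ @ a @ b = a /\ forall c, h @ (sc c) @ a @ b = b.
Proof.
elim: t => [|s _ t [h IH]].
  have [h e] := D3_ite; exists h => a b.
  by split=> [|c]; rewrite e ?ite0 ?iteS.
have [k e] : D3 (fun (c : NN) (a b : car M (s ~> t)) => LAM (fun x => h @ c @ (a @ x) @ (b @ x))).
  by apply: D3_intro; def.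
exists k => a b; split=> [|c]; apply: car_ext => x; rewrite e beta; try by def.
  exact: (IH _ _).1.
exact: (IH _ _).2.
Qed.

Definition Dec G (P : env M G -> Prop) :=
  exists f : env M G -> NN, Def f /\ forall g, P g <-> f g = cZ.

(** The distinction is made in the classical host logic; by [Def_cond] it is an operation of the
    model as soon as [P] is decidable. *)
Definition cond t (P : Prop) (a b : car M t) : car M t := if pselect P then a else b.

Lemma condT t (P : Prop) (a b : car M t) : P -> cond P a b = a.
Proof. by rewrite /cond; case: pselect. Qed.
Lemma condF t (P : Prop) (a b : car M t) : ~ P -> cond P a b = b.
Proof. by rewrite /cond; case: pselect. Qed.

Lemma Def_cond G t P (a b : env M G -> car M t) : Dec P -> Def a -> Def b ->
  Def (fun g => cond (P g) (a g) (b g)).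
Proof.
move=> [f [df e]] da db; have [h he] := ite_ex t.
have -> : (fun g => cond (P g) (a g) (b g)) = (fun g => h @ f g @ a g @ b g).
  apply: funext => g; case: (EM (P g)) => p.
    by rewrite condT // (e g).1 // (he _ _).1.
  rewrite condF //; case: (nn_case (f g)) => [/e //|[k ->]].
  by rewrite (he _ _).2.
exact: Def_app (Def_app (Def_app (Def_const _ _) df) da) db.
Qed.

Lemma Dec_const G P : @Dec G (fun _ => P).
Proof.
case: (EM P) => p; [exists (fun _ => cZ)|exists (fun _ => sc cZ)];
  (split; first exact: Def_const) => // _; split=> // /(r_S0 hM) //.
Qed.

Lemma Dec_eq G (a b : env M G -> NN) : Def a -> Def b -> Dec (fun g => a g = b g).
Proof.
move=> da db; exists (fun g => add (sub (a g) (b g)) (sub (b g) (a g))); split.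
  by apply: Def_op2; apply: Def_op2.
move=> g; split=> [->|/nadd_eq0[]]; last exact: nle_anti.
by rewrite [sub _ _]nle_refl naddr0.
Qed.

Lemma Dec_ext G (P Q : env M G -> Prop) : (forall g, P g <-> Q g) -> Dec P -> Dec Q.
Proof. by move=> e [f [df h]]; exists f; split=> // g; rewrite -e. Qed.

Lemma Dec_imp G (P Q : env M G -> Prop) : Dec P -> Dec Q -> Dec (fun g => P g -> Q g).
Proof.
move=> dP [q [dq eq]].
have d := Def_cond dP dq (Def_const G cZ).
exists (fun g => cond (P g) (q g) cZ); split=> // g; rewrite eq.
case: (EM (P g)) => p; [rewrite condT // | rewrite condF //]; split=> //; first by apply.
Qed.

Lemma Dec_not G (P : env M G -> Prop) : Dec P -> Dec (fun g => ~ P g).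
Proof. by move=> dP; apply: Dec_imp dP (Dec_const _ _). Qed.

Lemma Dec_and G (P Q : env M G -> Prop) : Dec P -> Dec Q -> Dec (fun g => P g /\ Q g).
Proof.
move=> dP dQ; apply: Dec_ext (Dec_not (Dec_imp dP (Dec_not dQ))) => g.
split=> [h|[p q] h]; last exact: h.
by split; apply: contrapT => n; apply: h.
Qed.

Lemma Dec_or G (P Q : env M G -> Prop) : Dec P -> Dec Q -> Dec (fun g => P g \/ Q g).
Proof.
move=> dP dQ; apply: Dec_ext (Dec_imp (Dec_not dP) dQ) => g.
split=> [h|[p|q] n] //; case: (EM (P g)) => [p|/h q]; [by left|by right].
Qed.

Lemma Dec_iff G (P Q : env M G -> Prop) : Dec P -> Dec Q -> Dec (fun g => P g <-> Q g).
Proof. by move=> dP dQ; apply: Dec_and; apply: Dec_imp. Qed.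

Lemma Def_ren G G' (r : env M G -> env M G') t (f : env M G' -> car M t) :
  (forall u (x : var G' u), Def (fun g => lk x (r g))) -> Def f -> Def (fun g => f (r g)).
Proof.
move=> hr; elim=> {t f} [t x|t c|s t f a _ hf _ ha]; first exact: hr.
  exact: Def_const.
exact: Def_app.
Qed.

Lemma Dec_ren G G' (r : env M G -> env M G') (P : env M G' -> Prop) :
  (forall u (x : var G' u), Def (fun g => lk x (r g))) -> Dec P -> Dec (fun g => P (r g)).
Proof.
by move=> hr [f [df e]]; exists (fun g => f (r g)); split; [exact: Def_ren|move=> g; apply: e].
Qed.

(** A decidable predicate is an equation [f n = cZ], so the atomic case of induction suffices. This
    is the form used from here on. *)
Lemma nn_ind (P : NN -> Prop) : Dec (G := [:: N]) (fun e => P e.1) ->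
  P cZ -> (forall n, P n -> P (sc n)) -> forall n, P n.
Proof.
move=> [f [df e]] h0 hS n; apply/(e (n, tt)).
move: n; apply: eq_ind1; [|by def| |].
- by apply: (Def_ren (r := fun x : env M [:: N] => (x.1, tt) : env M [:: N])) df => u;
    elim/var_case=> [|? /var_nil //]; def.
- by rewrite -e.
- by move=> n; rewrite -!e; apply: hS.
Qed.

(** Invariant of the recursion: the value at [k] is [k] as long as no witness below [k] has been
    met, and afterwards the least witness. Thus the result [b] signals failure. *)
Definition bmin (b : NN) (P : NN -> Prop) :=
  recf (fun k r => cond (r = k) (cond (P k) k (sc k)) r) cZ b.

Lemma Def_bmin_step G (P : env M G -> NN -> Prop) :
  Dec (G := N :: G) (fun g => P g.2 g.1) ->
  Def (G := [:: N, N & G]) (fun g => cond (g.1 = g.2.1) (cond (P g.2.2 g.2.1) g.2.1 (sc g.2.1)) g.1).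
Proof.
move=> dP; have d1 : Def (G := [:: N, N & G]) (fun g => g.1) := Def_var (VZ _ _).
have d2 : Def (G := [:: N, N & G]) (fun g => g.2.1) := Def_var (VS _ (VZ _ _)).
apply: (@Def_cond [:: N, N & G] N (fun g => g.1 = g.2.1) _ (fun g => g.1)) => //; first exact: Dec_eq.
apply: (@Def_cond [:: N, N & G] N (fun g => P g.2.2 g.2.1) (fun g => g.2.1) (fun g => sc g.2.1)) => //;
  last exact: Def_op1.
by apply: (Dec_ren (r := fun g : env M [:: N, N & G] => g.2 : env M (N :: G))) dP => u x;
  exact: (Def_var (VS N x)).
Qed.

Lemma Def_bmin G (P : env M G -> NN -> Prop) b : Dec (G := N :: G) (fun g => P g.2 g.1) ->
  Def b -> Def (fun g => bmin (b g) (P g)).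
Proof.
move=> dP db; apply: Def_recf => //; last exact: Def_const.
exact: (Def_bmin_step dP).
Qed.

Section Bmin.
Variable P : NN -> Prop.
Hypothesis dP : Dec (G := [:: N]) (fun e => P e.1).

Lemma bminS b : bmin b P = b /\ P b /\ bmin (sc b) P = b \/
  bmin b P = b /\ ~ P b /\ bmin (sc b) P = sc b \/
  bmin b P <> b /\ bmin (sc b) P = bmin b P.
Proof.
have e : bmin (sc b) P = cond (bmin b P = b) (cond (P b) b (sc b)) (bmin b P).
  rewrite /bmin recfS //; have := Def_bmin_step (G := [::]) (P := fun _ => P) dP.
  by [].
case: (EM (bmin b P = b)) => h; rewrite e; [rewrite condT //|by right; right; rewrite condF].
by case: (EM (P b)) => p; [left; rewrite condT|right; left; rewrite condF].
Qed.

Lemma bmin_Def : Def (G := [:: N]) (fun g => bmin g.1 P).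
Proof.
apply: (Def_bmin (G := [:: N]) (P := fun _ => P)); last by def.
by apply: (Dec_ren (r := fun g : env M [:: N; N] => (g.1, tt) : env M [:: N])) dP => u;
  elim/var_case=> [|? /var_nil //]; def.
Qed.

Lemma bmin_le b : le (bmin b P) b.
Proof.
move: b; apply: nn_ind; first by apply: Dec_eq; [apply: Def_op2; [exact: bmin_Def|def]|def].
  by rewrite /bmin recf0; apply: nle_refl.
by move=> b h; case: (bminS b) => [[_ [_ ->]]|[[_ [_ ->]]|[_ ->]]];
  [exact/nle_S/nle_refl|exact: nle_refl|exact: nle_S].
Qed.

Lemma Dec_at G (a : env M G -> NN) : Def a -> Dec (fun g => P (a g)).
Proof.
move=> da; apply: (Dec_ren (r := fun g : env M G => (a g, tt) : env M [:: N])) dP => u.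
by elim/var_case=> [|? /var_nil //]; apply: da.
Qed.

Lemma Dec_lt G (a b : env M G -> NN) : Def a -> Def b -> Dec (fun g => lt (a g) (b g)).
Proof.
by move=> da db; apply: Dec_eq; [apply: Def_op2 => //; apply: Def_op1|exact: Def_const].
Qed.

Lemma bmin_true b : lt (bmin b P) b -> P (bmin b P).
Proof.
move: b; apply: nn_ind; [|by move/nlt0|].
  apply: Dec_imp; last exact/Dec_at/bmin_Def.
  by apply: Dec_lt; [apply: bmin_Def|def].
move=> b h; case: (bminS b) => [[e [p ->]] //|[[_ [_ ->]] /nlt_irr //|[ne ->] _]].
by apply: h; apply/nlt_neq; split=> //; apply: bmin_le.
Qed.

Lemma bmin_min b i : lt i (bmin b P) -> ~ P i.
Proof.
move: b; apply: nn_ind.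
- by apply: Dec_imp; [apply: Dec_lt; [def|apply: bmin_Def]|apply: Dec_const].
- by rewrite /bmin recf0 => /nlt0.
- move=> b h; case: (bminS b) => [[e [p ->]]|[[e [p ->]]|[ne ->]]] //.
    by rewrite -{1}e.
  by move/nltS=> k; case: (EM (i = b)) => [-> //|ne]; apply: h; rewrite e; apply/nlt_neq.
Qed.

Lemma bmin_ex b i : lt i b -> P i -> lt (bmin b P) b /\ P (bmin b P) /\ le (bmin b P) i.
Proof.
move=> ib p; have h : le (bmin b P) i by apply/nlt_le => /bmin_min.
have h' := nle_lt_trans h ib; split=> //; split=> //; exact: bmin_true.
Qed.

Lemma bmin_lt b : lt (bmin b P) b <-> exists i, lt i b /\ P i.
Proof.
split=> [h|[i [ib p]]]; last exact: (bmin_ex ib p).1.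
by exists (bmin b P); split=> //; apply: bmin_true.
Qed.

End Bmin.

Lemma Dec_fst G (P : env M G -> NN -> Prop) (g : env M G) :
  Dec (G := N :: G) (fun g => P g.2 g.1) -> Dec (G := [:: N]) (fun e => P g e.1).
Proof.
apply: (Dec_ren (r := fun e : env M [:: N] => (e.1, g) : env M (N :: G))) => u.
by elim/var_case=> [|v x]; [exact: (Def_var (VZ _ _))|exact (Def_const _ (lk x g))].
Qed.

Lemma Dec_exb G (P : env M G -> NN -> Prop) b : Dec (G := N :: G) (fun g => P g.2 g.1) ->
  Def b -> Dec (fun g => exists i, lt i (b g) /\ P g i).
Proof.
move=> dP db; apply: (Dec_ext (P := fun g => lt (bmin (b g) (P g)) (b g))).
  by move=> g; apply: bmin_lt; apply: Dec_fst.
by apply: Dec_lt => //; apply: Def_bmin.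
Qed.

Lemma Dec_allb G (P : env M G -> NN -> Prop) b : Dec (G := N :: G) (fun g => P g.2 g.1) ->
  Def b -> Dec (fun g => forall i, lt i (b g) -> P g i).
Proof.
move=> dP db; have dn := Dec_not dP.
apply: Dec_ext (Dec_not (Dec_exb (P := fun g i => ~ P g i) dn db)) => g; split=> [h i ib|h [i [ib n]]].
  by apply: contrapT => n; apply: h; exists i.
exact/n/h.
Qed.

Class P1 s (R : car M s -> Prop) := p1 : exists f, forall x, R x <-> f @ x = cZ.
Class P2 r s (R : car M r -> car M s -> Prop) := p2 : exists f, forall x y, R x y <-> f @ x @ y = cZ.
Class P3 q r s (R : car M q -> car M r -> car M s -> Prop) :=
  p3 : exists f, forall x y z, R x y z <-> f @ x @ y @ z = cZ.

Lemma Dec_op1 G s R (H : P1 R) (a : env M G -> car M s) : Def a -> Dec (fun g => R (a g)).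
Proof. by case: H => f e da; exists (fun g => f @ a g); split=> [|g];
  [exact: Def_app (Def_const _ _) da|exact: e]. Qed.

Lemma Dec_op2 G r s R (H : P2 R) (a : env M G -> car M r) (b : env M G -> car M s) :
  Def a -> Def b -> Dec (fun g => R (a g) (b g)).
Proof.
case: H => f e da db; exists (fun g => f @ a g @ b g); split=> [|g]; last exact: e.
exact: Def_app (Def_app (Def_const _ _) da) db.
Qed.

Lemma Dec_op3 G q r s R (H : P3 R) (a : env M G -> car M q) (b : env M G -> car M r)
    (c : env M G -> car M s) : Def a -> Def b -> Def c -> Dec (fun g => R (a g) (b g) (c g)).
Proof.
case: H => f e da db dc; exists (fun g => f @ a g @ b g @ c g); split=> [|g]; last exact: e.
exact: Def_app (Def_app (Def_app (Def_const _ _) da) db) dc.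
Qed.

Lemma P1_intro s (R : car M s -> Prop) : Dec (G := [:: s]) (fun g => R g.1) -> P1 R.
Proof.
move=> [f [df e]]; have [h eh] : D1 (fun x => f (x, tt)).
  apply: D1_intro; apply: (Def_ren (r := fun g : env M [:: s] => (g.1, tt) : env M [:: s])) df => u.
  by elim/var_case=> [|? /var_nil //]; def.
by exists h => x; rewrite eh -e.
Qed.

Lemma P2_intro r s (R : car M r -> car M s -> Prop) :
  Dec (G := [:: s; r]) (fun g => R g.2.1 g.1) -> P2 R.
Proof.
move=> [f [df e]]; have [h eh] : D2 (fun x y => f (y, (x, tt))).
  apply: D2_intro; apply: (Def_ren (r := fun g : env M [:: s; r] => (g.1, (g.2.1, tt)) : env M [:: s; r])) df => u.
  by elim/var_case=> [|? ]; [def|elim/var_case=> [|? /var_nil //]; def].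
by exists h => x y; rewrite eh -e.
Qed.

Lemma P3_intro q r s (R : car M q -> car M r -> car M s -> Prop) :
  Dec (G := [:: s; r; q]) (fun g => R g.2.2.1 g.2.1 g.1) -> P3 R.
Proof.
move=> [f [df e]]; have [h eh] : D3 (fun x y z => f (z, (y, (x, tt)))).
  apply: D3_intro; apply: (Def_ren (r := fun g : env M [:: s; r; q] =>
    (g.1, (g.2.1, (g.2.2.1, tt))) : env M [:: s; r; q])) df => u.
  elim/var_case=> [|? ]; first by def.
  by elim/var_case=> [|? ]; [def|elim/var_case=> [|? /var_nil //]; def].
by exists h => x y z; rewrite eh -e.
Qed.

End Order.

Ltac dec_hook := fail.
Ltac dec :=
  cbv beta;
  lazymatch goal with
  | |- Dec (fun _ => ?P) => apply Dec_const
  | |- Dec (fun g => forall i, lt i (@?b g) -> @?P g i) =>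
      apply (@Dec_allb _ _ P b); [dec | def]
  | |- Dec (fun g => exists i, lt i (@?b g) /\ @?P g i) =>
      apply (@Dec_exb _ _ P b); [dec | def]
  | |- Dec (fun g => @?P g /\ @?Q g) => apply (@Dec_and _ _ P Q); [dec | dec]
  | |- Dec (fun g => @?P g \/ @?Q g) => apply (@Dec_or _ _ P Q); [dec | dec]
  | |- Dec (fun g => ~ @?P g) => apply (@Dec_not _ _ P); dec
  | |- Dec (fun g => @?P g <-> @?Q g) => apply (@Dec_iff _ _ P Q); [dec | dec]
  | |- Dec (fun g => @?P g -> @?Q g) => apply (@Dec_imp _ _ P Q); [dec | dec]
  | |- Dec (fun g => @?a g = @?b g) => apply (@Dec_eq _ _ a b); [def | def]
  | |- Dec (fun g => le (@?a g) (@?b g)) => unfold le; dec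
  | |- Dec (fun g => lt (@?a g) (@?b g)) => unfold lt; dec
  | |- _ => first [dec_op | dec_hook]
  end
with dec_op :=
  first
  [ lazymatch goal with
    | |- Dec (fun g => ?f (@?a g) (@?b g)) => apply (@Dec_op2 _ _ _ _ f _ a b)
    end; [def | def]
  | lazymatch goal with
    | |- Dec (fun g => ?f (@?a g) (@?b g) (@?c g)) => apply (@Dec_op3 _ _ _ _ _ f _ a b c)
    end; [def | def | def]
  | lazymatch goal with
    | |- Dec (fun g => ?f (@?a g)) => apply (@Dec_op1 _ _ _ f _ a)
    end; def ].

Ltac def_cond :=
  lazymatch goal with
  | |- Def (fun g => cond (@?P g) (@?a g) (@?b g)) =>
      apply (@Def_cond _ _ _ P a b); [dec | def | def]
  | |- Def (fun g => bmin (@?b g) (@?P g)) => apply (@Def_bmin _ _ P b); [dec | def]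
  end.
Ltac def_hook ::= def_cond.

Import Order.TTheory GRing.Theory Num.Theory.

(** * The ordered field of rationals of a model *)

Section RationalCodes.
Context {M : model}.
Notation hM := (mrca M).
Notation NN := (car M N).

Lemma nn_semiring : semi_ring_theory (cZ : NN) o1 add mul eq.
Proof.
split; [exact: nadd0r|exact: naddrC|exact: naddrA|exact: nmul1r|exact: nmul0r|exact: nmulrC
  |exact: nmulrA|exact: nmulrDl].
Qed.
Add Ring nn_ring : nn_semiring.

Lemma nmul_eq0 (d x : NN) : mul (sc d) x = cZ -> x = cZ.
Proof.
case: (nn_case x) => [//|[k ->]]; rewrite nmulrS naddrS => /(r_S0 hM) [].
Qed.

Lemma nmul_injl (d x y : NN) : mul (sc d) x = mul (sc d) y -> x = y.
Proof.
wlog: x y / le x y => [hw h|].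
  by case: (nle_total x y) => k; [exact: hw|symmetry; apply: hw].
move=> /nleE[c ->]; rewrite nmulrDr -[LHS]naddr0 => /nadd_injl /esym /nmul_eq0 ->.
by rewrite naddr0.
Qed.

(** Stands for [(fp - fn) / (fd + 1)]. Separate positive and negative parts keep truncated
    subtraction out of the ring operations. *)
Record frac := Frac { fp : NN; fn : NN; fd : NN }.
Notation dn c := (sc (fd c)).

Definition feq (a b : frac) :=
  add (mul (fp a) (dn b)) (mul (fn b) (dn a)) = add (mul (fp b) (dn a)) (mul (fn a) (dn b)).

Lemma feq_trans a b c : feq a b -> feq b c -> feq a c.
Proof.
(* In place of a subtraction, both sides are multiplied by the denominator of [b] and increased by a
   multiple of its negative part; then the two hypotheses can be rewritten. *)
rewrite /feq => h k; apply: (@nmul_injl (fd b)).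
apply: (nadd_injl (x := mul (mul (fn b) (dn a)) (dn c))).
transitivity (add (mul (add (mul (fp a) (dn b)) (mul (fn b) (dn a))) (dn c))
  (mul (mul (fn c) (dn b)) (dn a))); first by ring.
rewrite h; transitivity (add (mul (add (mul (fp b) (dn c)) (mul (fn c) (dn b))) (dn a))
  (mul (mul (fn a) (dn b)) (dn c))); first by ring.
by rewrite k; ring.
Qed.

Lemma feq_sym a b : feq a b -> feq b a. Proof. by rewrite /feq. Qed.

Definition fchoose (P : frac -> Prop) : frac :=
  match pselect (exists c, P c) with left h => sval (cid h) | right _ => Frac cZ cZ cZ end.
Definition frep a := fchoose (feq a).

Lemma frepP a : feq a (frep a).
Proof.
rewrite /frep /fchoose; case: pselect => [h|[]]; first exact: svalP.
by exists a.
Qed.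

Lemma frep_eq a b : feq a b -> frep a = frep b.
Proof.
move=> ab; rewrite /frep; congr fchoose; apply: funext => z; apply: propext.
by split; apply: feq_trans => //; apply: feq_sym.
Qed.

Definition fadd a b := Frac (add (mul (fp a) (dn b)) (mul (fp b) (dn a)))
  (add (mul (fn a) (dn b)) (mul (fn b) (dn a))) (add (mul (fd a) (dn b)) (fd b)).
Definition fmul a b := Frac (add (mul (fp a) (fp b)) (mul (fn a) (fn b)))
  (add (mul (fp a) (fn b)) (mul (fn a) (fp b))) (add (mul (fd a) (dn b)) (fd b)).
Definition fopp a := Frac (fn a) (fp a) (fd a).

Definition finv a :=
  if pselect (fn a = fp a) then Frac cZ cZ cZ else
  if pselect (le (fn a) (fp a)) then Frac (dn a) cZ (prd (sub (fp a) (fn a)))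
  else Frac cZ (dn a) (prd (sub (fn a) (fp a))).

Lemma dn_mul (x y : NN) : sc (add (mul x (sc y)) y) = mul (sc x) (sc y).
Proof. by rewrite nmulSr naddrS. Qed.

Lemma fadd_eq a b a' b' : feq a a' -> feq b b' -> feq (fadd a b) (fadd a' b').
Proof.
rewrite /feq /fadd /= !dn_mul => h k.
transitivity (add (mul (add (mul (fp a) (dn a')) (mul (fn a') (dn a))) (mul (dn b) (dn b')))
   (mul (add (mul (fp b) (dn b')) (mul (fn b') (dn b))) (mul (dn a) (dn a')))); first by ring.
by rewrite h k; ring.
Qed.

Lemma fmul_eql a b a' : feq a a' -> feq (fmul a b) (fmul a' b).
Proof.
rewrite /feq /fmul /= !dn_mul => h.
transitivity (add (mul (add (mul (fp a) (dn a')) (mul (fn a') (dn a))) (mul (fp b) (dn b)))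
   (mul (add (mul (fp a') (dn a)) (mul (fn a) (dn a'))) (mul (fn b) (dn b)))); first by ring.
transitivity (add (mul (add (mul (fp a') (dn a)) (mul (fn a) (dn a'))) (mul (fp b) (dn b)))
   (mul (add (mul (fp a) (dn a')) (mul (fn a') (dn a))) (mul (fn b) (dn b)))); last by ring.
by rewrite h.
Qed.

Lemma fmulC a b : feq (fmul a b) (fmul b a).
Proof. by rewrite /feq /fmul /= !dn_mul; ring. Qed.

Lemma fmul_eq a b a' b' : feq a a' -> feq b b' -> feq (fmul a b) (fmul a' b').
Proof.
move=> h k; apply: feq_trans (fmul_eql b h) _.
apply: feq_trans (fmulC _ _) _; apply: feq_trans (fmul_eql a' k) _; exact: fmulC.
Qed.

Lemma fopp_eq a a' : feq a a' -> feq (fopp a) (fopp a').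
Proof.
rewrite /feq /fopp /= => h; rewrite (naddrC (mul (fn a) _)) (naddrC (mul (fn a') _)).
by symmetry.
Qed.

Definition fpos a := le (fn a) (fp a).

Lemma fpos_eq a b : feq a b -> fpos a -> fpos b.
Proof.
rewrite /feq /fpos => h /nleE[c e]; apply: contrapT => /nle_lt/nleE[d e'].
move: h; rewrite e e' => h.
have : add (add (mul (fp b) (dn a)) (mul (fn a) (dn b))) (add (mul c (dn b)) (mul (dn a) (sc d)))
  = add (add (mul (fp b) (dn a)) (mul (fn a) (dn b))) cZ.
  by rewrite [RHS]naddr0 -[RHS]h !(sc_add d) !(sc_add (fp b)); ring.
by move/nadd_injl/nadd_eq0 => [_ /nmul_eq0/(r_S0 hM)].
Qed.

Lemma fpos_total a : fpos a \/ fpos (fopp a).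
Proof. exact: nle_total. Qed.

Lemma fpos_anti a : fpos a -> fpos (fopp a) -> feq a (Frac cZ cZ cZ).
Proof. by move=> h k; rewrite /feq /= (nle_anti h k); ring. Qed.

Lemma fpos_add a b : fpos a -> fpos b -> fpos (fadd a b).
Proof.
move=> /nleE[c e] /nleE[d e']; apply/nleE; exists (add (mul c (dn b)) (mul d (dn a))).
by rewrite /= e e'; ring.
Qed.

Lemma fpos_mul a b : fpos a -> fpos b -> fpos (fmul a b).
Proof.
move=> /nleE[c e] /nleE[d e']; apply/nleE; exists (mul c d).
by rewrite /= e e'; ring.
Qed.

Lemma finv_mul a : ~ feq a (Frac cZ cZ cZ) -> feq (fmul (finv a) a) (Frac o1 cZ cZ).
Proof.
move=> nz; have ne : fn a <> fp a by move=> e; apply: nz; rewrite /feq /= e; ring.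
have nsub (p n : NN) : n <> p -> le n p -> exists k, p = add n (sc k).
  move=> np h; have [c e] := (nleE _ _).1 h; case: (nn_case c) => [ec|[k ek]]; last by exists k; rewrite -ek.
  by case: np; rewrite e ec naddr0.
rewrite /finv; case: (pselect (fn a = fp a)) => [/ne //|ne'] /=; case: (pselect _) => h /=.
  have [k e] := nsub _ _ ne h; rewrite /feq /fmul /= e naddKr prdS !dn_mul -/o1; ring.
have [k e] := nsub _ _ (fun e => ne (esym e)) (nltW ((nle_lt _ _).1 h)).
rewrite /feq /fmul /= e naddKr prdS !dn_mul -/o1; ring.
Qed.

Definition preK := {c : frac | frep c = c}.
Definition kpi (c : frac) : preK := exist _ (frep c) (esym (frep_eq (frepP c))).

Lemma kpi_eq a b : kpi a = kpi b <-> feq a b.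
Proof.
split=> [/(congr1 sval) /= e|h]; last by apply: eq_exist; rewrite /= (frep_eq h).
by apply: feq_trans (frepP a) _; rewrite e; apply/feq_sym/frepP.
Qed.

Lemma kpi_sval (x : preK) : kpi (sval x) = x.
Proof. by case: x => c e; apply: eq_exist. Qed.

Lemma kpiW (P : preK -> Prop) : (forall c, P (kpi c)) -> forall x, P x.
Proof. by move=> h x; rewrite -(kpi_sval x). Qed.

Definition kzero := kpi (Frac cZ cZ cZ).
Definition kone := kpi (Frac o1 cZ cZ).
Definition kadd (x y : preK) := kpi (fadd (sval x) (sval y)).
Definition kmul (x y : preK) := kpi (fmul (sval x) (sval y)).
Definition kopp (x : preK) := kpi (fopp (sval x)).
Definition kinv (x : preK) := kpi (finv (sval x)).

Lemma feq_sval c : feq (sval (kpi c)) c.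
Proof. exact/feq_sym/frepP. Qed.

Lemma kaddE a b : kadd (kpi a) (kpi b) = kpi (fadd a b).
Proof. by apply/kpi_eq/fadd_eq; apply: feq_sval. Qed.
Lemma kmulE a b : kmul (kpi a) (kpi b) = kpi (fmul a b).
Proof. by apply/kpi_eq/fmul_eq; apply: feq_sval. Qed.
Lemma koppE a : kopp (kpi a) = kpi (fopp a).
Proof. by apply/kpi_eq/fopp_eq; apply: feq_sval. Qed.

Ltac kring := repeat (elim/kpiW => ?);
  rewrite /kzero /kone ?(kaddE, kmulE, koppE); apply/kpi_eq;
  rewrite /feq /fadd /fmul /fopp /=; rewrite ?sc_add ?nadd0r; ring.

Fact kaddA : associative kadd.
Proof. kring. Qed.
Fact kaddC : commutative kadd.
Proof. kring. Qed.
Fact kadd0 : left_id kzero kadd.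
Proof. kring. Qed.
Fact kaddN : left_inverse kzero kopp kadd.
Proof. kring. Qed.
Fact kmulA : associative kmul.
Proof. kring. Qed.
Fact kmulC : commutative kmul.
Proof. kring. Qed.
Fact kmul1 : left_id kone kmul.
Proof. kring. Qed.
Fact kmulD : left_distributive kmul kadd.
Proof. kring. Qed.
Fact kone_neq0 : kone <> kzero.
Proof.
rewrite /kone /kzero kpi_eq /feq /= /o1 => h; apply: (r_S0 hM (n := cZ)).
by move: h; rewrite !nmul0r !nmulrS !nmulr0 !naddr0 !nadd0r.
Qed.
End RationalCodes.
Arguments preK : clear implicits.

Section RationalField.
Context {M : model}.
Notation hM := (mrca M).
Notation NN := (car M N).
Local Open Scope ring_scope.

HB.instance Definition _ := gen_eqMixin (preK M).
HB.instance Definition _ := gen_choiceMixin (preK M).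
HB.instance Definition _ := GRing.isZmodule.Build (preK M) (@kaddA M) (@kaddC M)
  (@kadd0 M) (@kaddN M).

Fact kone_neq0' : kone != 0 :> preK M.
Proof. by apply/eqP; apply: kone_neq0. Qed.

HB.instance Definition _ := GRing.Zmodule_isComNzRing.Build (preK M) (@kmulA M)
  (@kmulC M) (@kmul1 M) (@kmulD M) kone_neq0'.

Fact kmulV (x : preK M) : x != 0 -> kinv x * x = 1.
Proof.
rewrite -(kpi_sval x); move: (sval x) => c /eqP nz; rewrite -[in RHS]/(kone : preK M) /kinv -{2}(kpi_sval (kpi c)).
apply: etrans (kmulE _ _) _; apply/kpi_eq/finv_mul => h; apply: nz; apply/kpi_eq.
by apply: feq_trans h; apply/feq_sym/feq_sval.
Qed.

Fact kinv0 : kinv (0 : preK M) = 0.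
Proof.
rewrite /kinv; have : feq (sval (0 : preK M)) (Frac cZ cZ cZ) by apply: feq_sval.
set c := sval _; rewrite /feq /= nmul0r nadd0r naddr0.
rewrite !nmulrS !nmulr0 !nadd0r => e.
by rewrite /finv; case: pselect => h //; case: h; rewrite -e.
Qed.

HB.instance Definition _ := GRing.ComNzRing_isField.Build (preK M) kmulV kinv0.

Definition kpos (x : preK M) := fpos (sval x).
Lemma kposE c : kpos (kpi c) <-> fpos c.
Proof. by split; apply: fpos_eq; [exact: feq_sval|exact/feq_sym/feq_sval]. Qed.

Definition kle (x y : preK M) : bool := `[< kpos (y - x) >].
Definition knorm (x : preK M) : preK M := if `[< kpos x >] then x else - x.

Fact kle0_add x y : kle 0 x -> kle 0 y -> kle 0 (x + y).
Proof.
rewrite /kle !subr0 => /asboolP h /asboolP k; apply/asboolP.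
by apply/kposE; apply: fpos_add.
Qed.
Fact kle0_mul x y : kle 0 x -> kle 0 y -> kle 0 (x * y).
Proof.
rewrite /kle !subr0 => /asboolP h /asboolP k; apply/asboolP.
by apply/kposE; apply: fpos_mul.
Qed.
Fact kpos_anti (x : preK M) : kpos x -> kpos (- x) -> x = 0.
Proof.
rewrite -(kpi_sval x); move: (sval x) => c /kposE h; rewrite [- kpi c]koppE => /kposE k.
by apply/kpi_eq/fpos_anti.
Qed.
Fact kle0_anti x : kle 0 x -> kle x 0 -> x = 0.
Proof. by rewrite /kle subr0 sub0r => /asboolP h /asboolP k; apply: kpos_anti. Qed.
Fact ksub_ge0 x y : kle 0 (y - x) = kle x y.
Proof. by rewrite /kle subr0. Qed.
Fact kpos_total (x : preK M) : kpos x \/ kpos (- x).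
Proof.
rewrite -(kpi_sval x); move: (sval x) => c; rewrite [- kpi c]koppE !kposE; exact: fpos_total.
Qed.
Fact kle0_total x : kle 0 x || kle x 0.
Proof.
by rewrite /kle subr0 sub0r; case: (kpos_total x) => /asboolT ->; rewrite ?orbT.
Qed.
Fact knormN x : knorm (- x) = knorm x.
Proof.
rewrite /knorm; case: asboolP => h; case: asboolP => k; rewrite ?opprK //.
  by rewrite (kpos_anti k h) oppr0.
by case: (kpos_total x).
Qed.
Fact kge0_norm x : kle 0 x -> knorm x = x.
Proof. by rewrite /kle subr0 /knorm => ->. Qed.

HB.instance Definition _ := Num.IntegralDomain_isLeReal.Build (preK M)
  kle0_add kle0_mul kle0_anti ksub_ge0 kle0_total knormN kge0_norm (fun x y => erefl).

Definition kin (n : NN) : preK M := kpi (Frac n cZ cZ).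

Add Ring nn_ring' : (@nn_semiring M).

Lemma kinD m n : kin (add m n) = kin m + kin n.
Proof.
rewrite [RHS]kaddE; apply/kpi_eq; rewrite /feq /=.
by rewrite ?sc_add ?nadd0r; ring.
Qed.
Lemma kinM m n : kin (mul m n) = kin m * kin n.
Proof.
rewrite [RHS]kmulE; apply/kpi_eq; rewrite /feq /=.
by rewrite ?sc_add ?nadd0r; ring.
Qed.

Lemma kin_le m n : kin m <= kin n <-> le m n.
Proof.
rewrite -[_ <= _]/(kle _ _) /kle; split.
  move=> /asboolP; rewrite [- kin m]koppE [_ + _]kaddE kposE /fpos /= /fopp /=.
  by rewrite !nmulrS !nmulr0 !nadd0r naddr0.
move=> h; apply/asboolP; rewrite [- kin m]koppE [_ + _]kaddE kposE /fpos /= /fopp /=.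
by rewrite !nmulrS !nmulr0 !nadd0r naddr0.
Qed.

Lemma kin_ge c : kpi c <= kin (fp c).
Proof.
rewrite -[_ <= _]/(kle _ _) /kle; apply/asboolP.
rewrite [- kpi c]koppE [_ + _]kaddE kposE /fpos /= /fopp /=; apply/nleE.
exists (add (mul (fp c) (fd c)) (fn c)); rewrite !sc_add nadd0r; ring.
Qed.

End RationalField.

Section AbstractField.
Context {M : model}.
Notation hM := (mrca M).
Notation NN := (car M N).
Local Open Scope ring_scope.

(* Only the properties of the embedding are used below, so it is hidden behind an
   opaque existence proof; this also keeps the reflexive tactics from computing in it. *)
Lemma rational_field_exists : exists (F : realFieldType) (f : NN -> F),
  [/\ f cZ = 0, f o1 = 1, forall m n, f (add m n) = f m + f n,
      forall m n, f (mul m n) = f m * f n & (forall m n, f m <= f n <-> le m n) /\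
      forall x, exists n, x <= f n].
Proof.
exists (preK M : realFieldType), (@kin M); split=> //.
- exact: kinD.
- exact: kinM.
- split; first exact: kin_le.
  move=> x; exists (fp (sval x)); rewrite -[X in X <= _](kpi_sval x).
  exact: kin_ge.
Qed.

Definition K : realFieldType := sval (cid rational_field_exists).
Definition inN : NN -> K := sval (cid (svalP (cid rational_field_exists))).

Fact inN_spec : [/\ inN cZ = 0, inN o1 = 1, forall m n, inN (add m n) = inN m + inN n,
  forall m n, inN (mul m n) = inN m * inN n & (forall m n, inN m <= inN n <-> le m n) /\
  forall x, exists n, x <= inN n].
Proof. exact: svalP (cid (svalP (cid rational_field_exists))). Qed.

Lemma inN0 : inN cZ = 0. Proof. by case: inN_spec. Qed.
Lemma inN1 : inN o1 = 1. Proof. by case: inN_spec. Qed.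
Lemma inND m n : inN (add m n) = inN m + inN n. Proof. by case: inN_spec. Qed.
Lemma inNM m n : inN (mul m n) = inN m * inN n. Proof. by case: inN_spec. Qed.
Lemma inN_le m n : inN m <= inN n <-> le m n. Proof. by case: inN_spec => _ _ _ _ []. Qed.
Lemma K_archi x : exists n, x <= inN n. Proof. by case: inN_spec => _ _ _ _ []. Qed.
Lemma inNS n : inN (sc n) = inN n + 1.
Proof. by rewrite sc_add inND inN1. Qed.
Lemma inN_inj m n : inN m = inN n -> m = n.
Proof. by move=> e; apply: nle_anti; apply/inN_le; rewrite e. Qed.

Lemma inN_lt m n : inN m < inN n <-> lt m n.
Proof.
rewrite -nle_lt -inN_le; split=> [h k|/negP]; last by rewrite -ltNge.
by move: (lt_le_trans h k); rewrite ltxx.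
Qed.

Lemma inN_ge0 n : 0 <= inN n.
Proof. by rewrite -inN0; apply/inN_le/nle0. Qed.

End AbstractField.
Arguments K : clear implicits.

From mathcomp Require Import ring lra.

(** * Primitive recursive functions and reals of a model *)

Section Coding.
Context {M : model}.
Notation hM := (mrca M).
Notation NN := (car M N).
Local Open Scope ring_scope.
Notation "n %:K" := (inN n) (at level 2, format "n %:K").

Lemma inNB (m n : NN) : le n m -> (sub m n)%:K = m%:K - n%:K.
Proof. by move=> /nleE[c ->]; rewrite naddKr inND addrC addKr. Qed.

Lemma nlt_leS (m n : NN) : lt m n <-> m%:K + 1 <= n%:K.
Proof. by rewrite -inNS inN_le. Qed.

Lemma nn_eq (m n : NN) : m%:K = n%:K <-> m = n.
Proof. by split=> [|-> //]; apply: inN_inj. Qed.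

Definition pow2 := sval (seal (fun (n : NN) => recf (fun _ r => add r r) o1 n)).
Definition pow2_unlock : pow2 = _ := svalP (seal _).
#[global] Instance D1_pow2 : D1 pow2. Proof. by apply: D1_intro; rewrite pow2_unlock; def. Qed.
Lemma pow2_0 : pow2 cZ = o1. Proof. by rewrite pow2_unlock recf0. Qed.
Lemma pow2S n : pow2 (sc n) = add (pow2 n) (pow2 n).
Proof. by rewrite pow2_unlock recfS //; def. Qed.

Lemma pow2_gt n : lt n (pow2 n).
Proof.
move: n; apply: nn_ind; first by dec.
  by rewrite pow2_0; apply: nle_refl.
move=> n /nlt_leS h; apply/nlt_leS; rewrite pow2S inND inNS.
have := inN_ge0 n; lra.
Qed.

Lemma pow2_pos n : 0 < (pow2 n)%:K.
Proof. by have /nlt_leS := pow2_gt n; have := inN_ge0 n; lra. Qed.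

Lemma pow2D m n : pow2 (add m n) = mul (pow2 m) (pow2 n).
Proof.
move: n; apply: nn_ind; first by dec.
  by rewrite naddr0 pow2_0 nmulrC nmul1r.
by move=> n h; rewrite naddrS !pow2S h nmulrDr.
Qed.

Definition eps := sval (seal (fun (n : NN) => (pow2 n)%:K^-1)).
Definition eps_unlock : eps = _ := svalP (seal _).

Lemma epsE n : eps n = (pow2 n)%:K^-1.
Proof. by rewrite eps_unlock. Qed.
Lemma eps_gt0 n : 0 < eps n.
Proof. by rewrite epsE invr_gt0 pow2_pos. Qed.
Lemma eps0 : eps cZ = 1.
Proof. by rewrite !epsE pow2_0 inN1 invr1. Qed.
Lemma epsS n : eps (sc n) = eps n / 2.
Proof.
rewrite !epsE pow2S inND; have -> : (pow2 n)%:K + (pow2 n)%:K = (pow2 n)%:K * 2 by lra.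
exact: invfM.
Qed.
Lemma epsD m n : eps (add m n) = eps m * eps n.
Proof. by rewrite !epsE pow2D inNM invfM. Qed.
Lemma pow2_eps n : (pow2 n)%:K * eps n = 1.
Proof. by rewrite !epsE mulfV // gt_eqF // pow2_pos. Qed.
Lemma eps_le1 n : eps n <= 1.
Proof.
rewrite epsE invf_le1 ?pow2_pos //; have /nlt_leS := pow2_gt n; have := inN_ge0 n; lra.
Qed.
Lemma eps_le m n : le m n -> eps n <= eps m.
Proof.
move=> /nleE[c ->]; rewrite epsD; have := eps_gt0 m; have := eps_le1 c; nra.
Qed.
Lemma eps_mul_le n : n%:K * eps n <= 1.
Proof.
rewrite -(pow2_eps n); have := eps_gt0 n; have /nlt_leS := pow2_gt n; nra.
Qed.

Definition tri := sval (seal (fun (n : NN) => recf (fun i r => add r (sc i)) cZ n)).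
Definition tri_unlock : tri = _ := svalP (seal _).
#[global] Instance D1_tri : D1 tri. Proof. by apply: D1_intro; rewrite tri_unlock; def. Qed.
Lemma triS n : tri (sc n) = add (tri n) (sc n).
Proof. by rewrite tri_unlock recfS //; def. Qed.

Definition pairn := sval (seal (fun (x y : NN) => add (tri (add x y)) y)).
Definition pairn_unlock : pairn = _ := svalP (seal _).
#[global] Instance D2_pairn : D2 pairn. Proof. by apply: D2_intro; rewrite pairn_unlock; def. Qed.
Definition diag := sval (seal (fun (c : NN) =>
  recf (fun i r => add r (sub o1 (sub (tri (sc r)) (sc i)))) cZ c)).
Definition diag_unlock : diag = _ := svalP (seal _).
#[global] Instance D1_diag : D1 diag. Proof. by apply: D1_intro; rewrite diag_unlock; def. Qed.
Definition sndn := sval (seal (fun (c : NN) => sub c (tri (diag c)))).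
Definition sndn_unlock : sndn = _ := svalP (seal _).
#[global] Instance D1_sndn : D1 sndn. Proof. by apply: D1_intro; rewrite sndn_unlock; def. Qed.
Definition fstn := sval (seal (fun (c : NN) => sub (diag c) (sndn c))).
Definition fstn_unlock : fstn = _ := svalP (seal _).
#[global] Instance D1_fstn : D1 fstn. Proof. by apply: D1_intro; rewrite fstn_unlock; def. Qed.

Lemma diagS c : diag (sc c) = add (diag c) (sub o1 (sub (tri (sc (diag c))) (sc c))).
Proof. by rewrite diag_unlock recfS //; def. Qed.

Lemma diag_spec c : le (tri (diag c)) c /\ lt c (tri (sc (diag c))).
Proof.
move: c; apply: nn_ind; first by dec.
  rewrite {1}diag_unlock recf0 {1}tri_unlock recf0; split; first exact: nle_refl.
  by rewrite diag_unlock recf0 triS; apply/nlt_leS; rewrite inND inNS; have := inN_ge0 (tri cZ); lra.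
move=> c [h1 h2]; rewrite diagS; case: (EM (le (tri (sc (diag c))) (sc c))) => h.
  rewrite [sub (tri _) _]h nsubr0 /o1 naddrS naddr0; split=> //.
  apply/nlt_leS; rewrite triS inND !inNS; have /nlt_leS := h2; have := inN_ge0 (diag c).
  lra.
case: (nn_case (sub (tri (sc (diag c))) (sc c))) => [//|[k ->]].
rewrite /o1 subSS nsub0r naddr0; split; first exact: nle_S.
exact/nle_lt.
Qed.

Lemma tri_le m n : le m n -> le (tri m) (tri n).
Proof.
move=> /nleE[c ->]; move: c; apply: nn_ind; first by dec.
  by rewrite naddr0; apply: nle_refl.
by move=> c h; rewrite naddrS triS; apply: nle_trans h (nle_add _ _).
Qed.

Lemma diag_uniq w c : le (tri w) c -> lt c (tri (sc w)) -> diag c = w.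
Proof.
move=> h1 h2; have [k1 k2] := diag_spec c; apply: nle_anti; apply/nlt_le => /tri_le h.
  exact: nlt_irr (nlt_le_trans (nlt_le_trans h2 h) k1).
exact: nlt_irr (nlt_le_trans (nlt_le_trans k2 h) h1).
Qed.

Lemma diag_pair x y : diag (pairn x y) = add x y.
Proof.
rewrite pairn_unlock; apply: diag_uniq; first exact: nle_add.
apply/nlt_leS; rewrite triS !inND inNS inND; have := inN_ge0 x; lra.
Qed.

Lemma sndn_pair x y : sndn (pairn x y) = y.
Proof. by rewrite sndn_unlock diag_pair pairn_unlock naddKr. Qed.

Lemma fstn_pair x y : fstn (pairn x y) = x.
Proof. by rewrite fstn_unlock sndn_pair diag_pair naddrC naddKr. Qed.

Lemma pairn_eta c : pairn (fstn c) (sndn c) = c.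
Proof.
have [h1 h2] := diag_spec c; have [k e] := (nleE _ _).1 h1.
have es : sndn c = k by rewrite sndn_unlock {1}e naddKr.
have kd : le k (diag c).
  apply/inN_le; move/nlt_leS: h2; rewrite triS {1}e !inND inNS; lra.
rewrite pairn_unlock; have -> : add (fstn c) (sndn c) = diag c.
  by apply/nn_eq; rewrite fstn_unlock es inND inNB //; lra.
by rewrite es.
Qed.

Lemma fstn_le c : le (fstn c) c.
Proof.
have h : le (fstn c) (tri (add (fstn c) (sndn c))).
  move: (fstn c) (sndn c) => x y; case: (nn_case x) => [->|[k ->]]; first exact: nle0.
  apply: nle_trans (nle_add _ y) _; rewrite naddSr triS; exact: nle_addr.
apply: nle_trans h _; rewrite -[X in le _ X](pairn_eta c) pairn_unlock; exact: nle_add.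
Qed.

Definition snoc := sval (seal (fun (s x : NN) => sc (pairn s x))).
Definition snoc_unlock : snoc = _ := svalP (seal _).
#[global] Instance D2_snoc : D2 snoc. Proof. by apply: D2_intro; rewrite snoc_unlock; def. Qed.

Definition bar := sval (seal (fun (g : car M t1) (n : NN) => recf (fun i r => snoc r (g @ i)) cZ n)).
Definition bar_unlock : bar = _ := svalP (seal _).
#[global] Instance D2_bar : D2 bar. Proof. by apply: D2_intro; rewrite bar_unlock; def. Qed.
Lemma bar0 g : bar g cZ = cZ. Proof. by rewrite bar_unlock recf0. Qed.
Lemma barS g n : bar g (sc n) = snoc (bar g n) (g @ n).
Proof. by rewrite bar_unlock recfS //; def. Qed.

End Coding.

Lemma frac_addE (F : fieldType) (a b u v w z : F) : u != 0%R -> z != 0%R ->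
  ((a * z + v * u - (b * z + w * u)) / (u * z) = (a - b) / u + (v - w) / z)%R.
Proof. by move=> nu nz; field; rewrite nu nz. Qed.

Section Codes.
Context {M : model}.
Notation hM := (mrca M).
Notation NN := (car M N).
Local Open Scope ring_scope.
Notation "n %:K" := (inN n) (at level 2, format "n %:K").

Definition posq := sval (seal (fun (c : NN) => fstn (fstn c))).
Definition posq_unlock : posq = _ := svalP (seal _).
Definition negq := sval (seal (fun (c : NN) => sndn (fstn c))).
Definition negq_unlock : negq = _ := svalP (seal _).
Definition denq := sval (seal (fun (c : NN) => sc (sndn c))).
Definition denq_unlock : denq = _ := svalP (seal _).
Definition frq := sval (seal (fun (p n d : NN) => pairn (pairn p n) (prd d))).
Definition frq_unlock : frq = _ := svalP (seal _).
#[global] Instance D1_posq : D1 posq. Proof. by apply: D1_intro; rewrite posq_unlock; def. Qed.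
#[global] Instance D1_negq : D1 negq. Proof. by apply: D1_intro; rewrite negq_unlock; def. Qed.
#[global] Instance D1_denq : D1 denq. Proof. by apply: D1_intro; rewrite denq_unlock; def. Qed.
#[global] Instance D3_frq : D3 frq. Proof. by apply: D3_intro; rewrite frq_unlock; def. Qed.

Definition addq := sval (seal (fun (c e : NN) => frq (add (mul (posq c) (denq e)) (mul (posq e) (denq c)))
  (add (mul (negq c) (denq e)) (mul (negq e) (denq c))) (mul (denq c) (denq e)))).
Definition addq_unlock : addq = _ := svalP (seal _).
Definition oppq := sval (seal (fun (c : NN) => frq (negq c) (posq c) (denq c))).
Definition oppq_unlock : oppq = _ := svalP (seal _).
Definition subq := sval (seal (fun (c e : NN) => addq c (oppq e))).
Definition subq_unlock : subq = _ := svalP (seal _).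
Definition absq := sval (seal (fun (c : NN) => frq (add (sub (posq c) (negq c)) (sub (negq c) (posq c))) cZ (denq c))).
Definition absq_unlock : absq = _ := svalP (seal _).
Definition ltq := sval (seal (fun (c e : NN) => lt (add (mul (posq c) (denq e)) (mul (negq e) (denq c)))
  (add (mul (posq e) (denq c)) (mul (negq c) (denq e))))).
Definition ltq_unlock : ltq = _ := svalP (seal _).
Definition natq := sval (seal (fun (n : NN) => frq n cZ o1)).
Definition natq_unlock : natq = _ := svalP (seal _).
Definition ipow2q := sval (seal (fun (n : NN) => frq o1 cZ (pow2 n))).
Definition ipow2q_unlock : ipow2q = _ := svalP (seal _).
#[global] Instance D2_addq : D2 addq. Proof. by apply: D2_intro; rewrite addq_unlock; def. Qed.
#[global] Instance D1_oppq : D1 oppq. Proof. by apply: D1_intro; rewrite oppq_unlock; def. Qed.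
#[global] Instance D2_subq : D2 subq. Proof. by apply: D2_intro; rewrite subq_unlock; def. Qed.
#[global] Instance D1_absq : D1 absq. Proof. by apply: D1_intro; rewrite absq_unlock; def. Qed.
#[global] Instance P2_ltq : P2 ltq. Proof. by apply: P2_intro; rewrite ltq_unlock; dec. Qed.
#[global] Instance D1_natq : D1 natq. Proof. by apply: D1_intro; rewrite natq_unlock; def. Qed.
#[global] Instance D1_ipow2q : D1 ipow2q. Proof. by apply: D1_intro; rewrite ipow2q_unlock; def. Qed.

Definition toK := sval (seal (fun (c : NN) => ((posq c)%:K - (negq c)%:K) / (denq c)%:K)).
Definition toK_unlock : toK = _ := svalP (seal _).

Lemma toKE c : toK c = ((posq c)%:K - (negq c)%:K) / (denq c)%:K.
Proof. by rewrite toK_unlock. Qed.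

Lemma den_gt0 c : 0 < (denq c)%:K.
Proof. by rewrite denq_unlock inNS; have := inN_ge0 (sndn c); lra. Qed.

Lemma toK_frq p n d : d <> cZ -> toK (frq p n d) = (p%:K - n%:K) / d%:K.
Proof.
case: (nn_case d) => [-> //|[k ->] _].
by rewrite toKE posq_unlock negq_unlock denq_unlock frq_unlock !(fstn_pair, sndn_pair) prdS.
Qed.

Lemma mul_sc_neq0 (m n : NN) : mul (sc m) (sc n) <> cZ.
Proof. by rewrite nmulrS naddrS => /(r_S0 hM). Qed.

Lemma denq_neq0 c : denq c <> cZ :> NN.
Proof. by rewrite denq_unlock; apply: (r_S0 hM). Qed.

Lemma denNZ c : (denq c)%:K != 0.
Proof. by rewrite gt_eqF // den_gt0. Qed.

Lemma toK_add c e : toK (addq c e) = toK c + toK e.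
Proof.
rewrite addq_unlock toK_frq; last by rewrite denq_unlock; apply: mul_sc_neq0.
rewrite !toKE !(inND, inNM).
by apply: frac_addE; apply: denNZ.
Qed.

Lemma toK_opp c : toK (oppq c) = - toK c.
Proof. by rewrite oppq_unlock toK_frq; [rewrite toKE -mulNr opprB|exact: denq_neq0]. Qed.

Lemma toK_sub c e : toK (subq c e) = toK c - toK e.
Proof. by rewrite subq_unlock toK_add toK_opp. Qed.

Lemma toK_abs c : toK (absq c) = `|toK c|.
Proof.
rewrite absq_unlock toK_frq; last exact: denq_neq0.
rewrite !toKE normrM [`|_^-1|]gtr0_norm ?invr_gt0 ?den_gt0 // inN0 subr0; congr (_ / _).
case: (nle_total (posq c) (negq c)) => h.
  rewrite [sub (posq c) _]h nadd0r inNB //; move/inN_le: h => h; rewrite ler0_norm; lra.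
rewrite [sub (negq c) _]h naddr0 inNB //; move/inN_le: h => h; rewrite ger0_norm; lra.
Qed.

Lemma ltqE c e : ltq c e <-> toK c < toK e.
Proof.
rewrite ltq_unlock -inN_lt !(inND, inNM) !toKE ltr_pdivrMr ?den_gt0 // mulrAC ltr_pdivlMr ?den_gt0 //.
by split; lra.
Qed.

Lemma toK_nat n : toK (natq n) = n%:K.
Proof. by rewrite natq_unlock toK_frq; [rewrite inN1 inN0 subr0 divr1|exact: (r_S0 hM)]. Qed.

Lemma pow2_neq0 (n : NN) : pow2 n <> cZ.
Proof. by move=> e; have := pow2_pos n; rewrite e inN0 ltxx. Qed.

Lemma toK_ipow2 n : toK (ipow2q n) = eps n.
Proof. by rewrite ipow2q_unlock toK_frq; [rewrite inN1 inN0 subr0 mul1r epsE|exact: pow2_neq0]. Qed.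

(** * Evaluation of the terms and formulas of the statement *)

Lemma str_varP s G t (x : var (s :: G) t) (v : car M s) (g : env M G) u :
  str_var x = Some u -> lk x (v ;; g) = ev u g.
Proof. by elim/var_case: t / x u => //= t y u [<-]. Qed.

(** The context is a variable [G0] with an equation, because induction on a term does not keep track
    of an index of the form [s :: G]. *)
Lemma strP G0 t (a : tm G0 t) : forall s G (e : G0 = s :: G) u (v : car M s) (g : env M G),
  str (eq_rect _ (fun L => tm L t) a _ e) = Some u ->
  ev (eq_rect _ (fun L => tm L t) a _ e) (v ;; g) = ev u g.
Proof.
elim: a => {t} [t x|r t f hf b hb||  |r t|q r t|] s G e; subst G0 => u v g /=; try by case=> <-.
  exact: str_varP.
have := hf _ _ erefl; have := hb _ _ erefl; rewrite /=.
case: (str f) => // f' hb' hf'; case eb: (str b) => [b'|] // [<-] /=.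
by rewrite (hf' f') // (hb' b').
Qed.

Lemma ev_lam_gen G0 t (a : tm G0 t) : forall s G (e : G0 = s :: G) (v : car M s) (g : env M G),
  ev (lam (eq_rect _ (fun L => tm L t) a _ e)) g @ v =
  ev (eq_rect _ (fun L => tm L t) a _ e) (v ;; g).
Proof.
elim: a => {t} [t x|r t f hf b hb||  |r t|q r t|] s G e; subst G0 => v g /=; rewrite ?(r_K hM) //.
  case ex: (str_var x) => [u|] /=; first by rewrite (r_K hM) (str_varP _ _ ex).
  elim/var_case: t / x ex => [|t y] //= _; by rewrite (r_S hM) (r_K hM).
have IHf := hf _ _ erefl v g; have IHb := hb _ _ erefl v g; rewrite /= in IHf IHb.
case ef: (str f) => [f'|]; case eb: (str b) => [b'|] /=;
  rewrite ?(r_S hM) ?IHf ?IHb //.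
by rewrite (r_K hM) -(strP (e := erefl) v g ef) -(strP (e := erefl) v g eb).
Qed.

Lemma ev_lam G s t (a : tm (s :: G) t) (g : env M G) (v : car M s) :
  ev (lam a) g @ v = ev a (v ;; g).
Proof. exact: (ev_lam_gen a erefl). Qed.

End Codes.

Section EvalTerms.
Context {M : model}.
Notation hM := (mrca M).
Notation NN := (car M N).

Lemma rec_ev (h : car M (N ~> N ~> N)) k (a n : NN) : (forall i r, h @ i @ r = k i r) ->
  cR @ h @ a @ n = recf k a n.
Proof.
move=> e; rewrite /recf; congr (_ @ _ @ _ @ _); symmetry; apply: LAM_eq => i.
symmetry; exact: LAM_eq.
Qed.

Ltac evl := intros; rewrite ?ev_lam; cbn [ev lk fst snd].
Ltac evr := evl; apply: rec_ev; evl.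

Lemma ev_addN G (g : env M G) x y : ev addN g @ x @ y = add x y.
Proof. by rewrite /addN add_unlock; evr. Qed.
Lemma ev_mulN G (g : env M G) x y : ev mulN g @ x @ y = mul x y.
Proof. by rewrite /mulN mul_unlock; evr; rewrite ev_addN. Qed.
Lemma ev_predN G (g : env M G) x : ev predN g @ x = prd x.
Proof. by rewrite /predN prd_unlock; evr. Qed.
Lemma ev_subN G (g : env M G) x y : ev subN g @ x @ y = sub x y.
Proof. by rewrite /subN sub_unlock; evr; rewrite ev_predN. Qed.
Lemma ev_pow2N G (g : env M G) x : ev pow2N g @ x = pow2 x.
Proof. by rewrite /pow2N pow2_unlock; evr; rewrite ev_addN. Qed.
Lemma ev_triN G (g : env M G) x : ev triN g @ x = tri x.
Proof. by rewrite /triN tri_unlock; evr; rewrite ev_addN. Qed.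
Lemma ev_pairN G (g : env M G) x y : ev pairN g @ x @ y = pairn x y.
Proof. by rewrite /pairN pairn_unlock; evl; rewrite !ev_addN ev_triN. Qed.
Lemma ev_diagN G (g : env M G) x : ev diagN g @ x = diag x.
Proof. by rewrite /diagN diag_unlock; evr; rewrite ev_addN !ev_subN ev_triN. Qed.
Lemma ev_sndN G (g : env M G) x : ev sndN g @ x = sndn x.
Proof. by rewrite /sndN sndn_unlock; evl; rewrite ev_subN ev_triN ev_diagN. Qed.
Lemma ev_fstN G (g : env M G) x : ev fstN g @ x = fstn x.
Proof. by rewrite /fstN fstn_unlock; evl; rewrite ev_subN ev_diagN ev_sndN. Qed.
Lemma ev_snocN G (g : env M G) x y : ev snocN g @ x @ y = snoc x y.
Proof. by rewrite /snocN snoc_unlock; evl; rewrite ev_pairN. Qed.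
Lemma ev_barN G (g : env M G) f n : ev barN g @ f @ n = bar f n.
Proof. by rewrite /barN bar_unlock; evr; rewrite ev_snocN. Qed.

Definition evN := (ev_addN, ev_mulN, ev_predN, ev_subN, ev_pow2N, ev_pairN, ev_sndN, ev_fstN,
  ev_snocN, ev_barN).

Lemma ev_posQ G (g : env M G) c : ev (posQ c) g = posq (ev c g).
Proof. by rewrite /posQ posq_unlock; evl; rewrite !evN. Qed.
Lemma ev_negQ G (g : env M G) c : ev (negQ c) g = negq (ev c g).
Proof. by rewrite /negQ negq_unlock; evl; rewrite !evN. Qed.
Lemma ev_denQ G (g : env M G) c : ev (denQ c) g = denq (ev c g).
Proof. by rewrite /denQ denq_unlock; evl; rewrite !evN. Qed.
Lemma ev_fracQ G (g : env M G) p q d : ev (fracQ p q d) g = frq (ev p g) (ev q g) (ev d g).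
Proof. by rewrite /fracQ frq_unlock; evl; rewrite !evN. Qed.

Definition evQ := (ev_posQ, ev_negQ, ev_denQ, ev_fracQ).

Lemma ev_addQ G (g : env M G) c e : ev (addQ c e) g = addq (ev c g) (ev e g).
Proof. by rewrite /addQ addq_unlock ev_fracQ; evl; rewrite !evN !evQ. Qed.
Lemma ev_oppQ G (g : env M G) c : ev (oppQ c) g = oppq (ev c g).
Proof. by rewrite /oppQ oppq_unlock ev_fracQ !evQ. Qed.
Lemma ev_subQ G (g : env M G) c e : ev (subQ c e) g = subq (ev c g) (ev e g).
Proof. by rewrite /subQ subq_unlock ev_addQ ev_oppQ. Qed.
Lemma ev_absQ G (g : env M G) c : ev (absQ c) g = absq (ev c g).
Proof. by rewrite /absQ absq_unlock ev_fracQ; evl; rewrite !evN !evQ. Qed.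
Lemma ev_natQ G (g : env M G) n : ev (natQ n) g = natq (ev n g).
Proof. by rewrite /natQ natq_unlock ev_fracQ. Qed.
Lemma ev_ipow2Q G (g : env M G) n : ev (ipow2Q n) g = ipow2q (ev n g).
Proof. by rewrite /ipow2Q ipow2q_unlock ev_fracQ; evl; rewrite !evN. Qed.

Lemma sat_eqN G (a b : tm G N) (g : env M G) : sat (a ≡ b) g <-> ev a g = ev b g.
Proof. exact: (r_ext hM).1. Qed.

Lemma sat_leN G (a b : tm G N) (g : env M G) : sat (leN a b) g <-> le (ev a g) (ev b g).
Proof. by rewrite /leN sat_eqN; evl; rewrite !evN. Qed.

Lemma sat_ltQ G (c e : tm G N) (g : env M G) : sat (ltQ c e) g <-> ltq (ev c g) (ev e g).
Proof. by rewrite /ltQ ltq_unlock /ltN sat_leN; evl; rewrite !evN !evQ. Qed.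

(** * Reals of a model *)

Definition constr := sval (seal (T := NN -> car M t1) (fun (c : NN) => LAM (fun _ => c))).
Definition constr_unlock : constr = _ := svalP (seal _).
Definition addr := sval (seal (T := car M t1 -> car M t1 -> car M t1) (fun (x y : car M t1) => LAM (fun n => addq (x @ sc n) (y @ sc n)))).
Definition addr_unlock : addr = _ := svalP (seal _).
Definition subr := sval (seal (T := car M t1 -> car M t1 -> car M t1) (fun (x y : car M t1) => LAM (fun n => subq (x @ sc n) (y @ sc n)))).
Definition subr_unlock : subr = _ := svalP (seal _).
Definition absr := sval (seal (T := car M t1 -> car M t1) (fun (x : car M t1) => LAM (fun n => absq (x @ n)))).
Definition absr_unlock : absr = _ := svalP (seal _).
Lemma constrE c n : constr c @ n = c. Proof. by rewrite constr_unlock beta //; def. Qed.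
Lemma addrE x y n : addr x y @ n = addq (x @ sc n) (y @ sc n). Proof. by rewrite addr_unlock beta //; def. Qed.
Lemma subrE x y n : subr x y @ n = subq (x @ sc n) (y @ sc n). Proof. by rewrite subr_unlock beta //; def. Qed.
Lemma absrE x n : absr x @ n = absq (x @ n). Proof. by rewrite absr_unlock beta //; def. Qed.

Lemma ev_constR G (g : env M G) c : ev (constR c) g = constr (ev c g).
Proof. by apply: car_ext => n; rewrite constrE /constR ev_lam ev_wk. Qed.
Lemma ev_addR G (g : env M G) x y : ev (addR x y) g = addr (ev x g) (ev y g).
Proof. by apply: car_ext => n; rewrite addrE /addR ev_lam ev_addQ /= !ev_wk. Qed.
Lemma ev_subR G (g : env M G) x y : ev (subR x y) g = subr (ev x g) (ev y g).
Proof. by apply: car_ext => n; rewrite subrE /subR ev_lam ev_subQ /= !ev_wk. Qed.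
Lemma ev_absR G (g : env M G) x : ev (absR x) g = absr (ev x g).
Proof. by apply: car_ext => n; rewrite absrE /absR ev_lam ev_absQ /= !ev_wk. Qed.

Definition zeror : car M t1 := constr (natq cZ).
Definition oner : car M t1 := constr (natq o1).
Definition ipow2r n : car M t1 := constr (ipow2q n).
Lemma ev_zeroR G (g : env M G) : ev zeroR g = zeror.
Proof. by rewrite /zeroR ev_constR ev_natQ. Qed.
Lemma ev_oneR G (g : env M G) : ev oneR g = oner.
Proof. by rewrite /oneR ev_constR ev_natQ. Qed.
Lemma ev_ipow2R G (g : env M G) n : ev (ipow2R n) g = ipow2r (ev n g).
Proof. by rewrite /ipow2R ev_constR ev_ipow2Q. Qed.

Definition isr (x : car M t1) :=
  forall n i, ltq (absq (subq (x @ n) (x @ add n i))) (ipow2q n).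
Definition ltr (x y : car M t1) :=
  exists n, ltq (addq (x @ n) (addq (ipow2q n) (ipow2q n))) (y @ n).
Definition ler x y := ~ ltr y x.
Definition eqr x y := ler x y /\ ler y x.
Definition in01r x := ler zeror x /\ ler x oner.
Definition ballr x n y := ltr (absr (subr y x)) (ipow2r n).

Lemma sat_isR G (g : env M G) x : sat (isR x) g <-> isr (ev x g).
Proof.
rewrite /isR sat_all; split=> h n; [move=> i; have := h n; rewrite sat_all => /(_ i)
  |rewrite sat_all => i; have := h n i];
  rewrite sat_ltQ ev_absQ ev_subQ ev_ipow2Q; cbn [ev lk fst snd]; by rewrite !ev_wk ev_addN.
Qed.
Lemma sat_ltR G (g : env M G) x y : sat (ltR x y) g <-> ltr (ev x g) (ev y g).
Proof.
rewrite /ltR sat_ex; split=> -[n h]; exists n; move: h;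
  rewrite sat_ltQ !ev_addQ ev_ipow2Q; cbn [ev lk fst snd]; by rewrite !ev_wk.
Qed.
Lemma sat_leR G (g : env M G) x y : sat (leR x y) g <-> ler (ev x g) (ev y g).
Proof. by rewrite /leR sat_neg sat_ltR. Qed.
Lemma sat_eqR G (g : env M G) x y : sat (eqR x y) g <-> eqr (ev x g) (ev y g).
Proof. by rewrite /eqR sat_and !sat_leR. Qed.
Lemma sat_in01 G (g : env M G) x : sat (in01 x) g <-> in01r (ev x g).
Proof. by rewrite /in01 sat_and !sat_leR ev_zeroR ev_oneR. Qed.
Lemma sat_in_ball G (g : env M G) x n y :
  sat (in_ball x n y) g <-> ballr (ev x g) (ev n g) (ev y g).
Proof. by rewrite /in_ball sat_ltR ev_absR ev_subR ev_ipow2R. Qed.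
Lemma sat_mem G (g : env M G) x h : sat (mem x h) g <-> ltr zeror (ev h g @ ev x g).
Proof. by rewrite /mem sat_ltR ev_zeroR. Qed.

Lemma sat_allR G (g : env M G) (A : form (t1 :: G)) :
  sat (∀R, A) g <-> forall x, isr x -> sat A (x ;; g).
Proof.
rewrite /allR sat_all; split=> h x; have := h x; by rewrite sat_imp sat_isR.
Qed.
Lemma sat_exR G (g : env M G) (A : form (t1 :: G)) :
  sat (∃R, A) g <-> exists x, isr x /\ sat A (x ;; g).
Proof.
rewrite /exR sat_ex; split=> -[x h]; exists x; move: h; by rewrite sat_and sat_isR.
Qed.

End EvalTerms.

Lemma iff_all T (P Q : T -> Prop) : (forall x, P x <-> Q x) -> (forall x, P x) <-> (forall x, Q x).
Proof. by move=> h; split=> k x; apply/h. Qed.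
Lemma iff_ex T (P Q : T -> Prop) : (forall x, P x <-> Q x) -> (exists x, P x) <-> (exists x, Q x).
Proof. by move=> h; split=> -[x k]; exists x; apply/h. Qed.
Lemma iff_imp (P P' Q Q' : Prop) : (P <-> P') -> (Q <-> Q') -> (P -> Q) <-> (P' -> Q').
Proof. tauto. Qed.
Lemma iff_and (P P' Q Q' : Prop) : (P <-> P') -> (Q <-> Q') -> (P /\ Q) <-> (P' /\ Q').
Proof. tauto. Qed.

(** * The principles as statements about a model *)

Section Principles.
Context {M : model}.
Notation NN := (car M N).

Definition isRRm (h : car M (t1 ~> t1)) := (forall x, isr x -> isr (h @ x)) /\ (forall x, isr x -> forall y, isr y -> eqr x y -> eqr (h @ x) (h @ y)).
Definition memr x (h : car M (t1 ~> t1)) := ltr zeror (h @ x).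
Definition closedm (h : car M (t1 ~> t1)) := isRRm h /\ (forall x, isr x -> ~ memr x h -> exists n, forall y, isr y -> ballr x n y -> ~ memr y h).
Definition ClCm := forall H : car M (N ~> t1 ~> t1),
  (forall n, closedm (H @ n) /\ (forall x, isr x -> memr x (H @ n) -> in01r x) /\ exists x, isr x /\ memr x (H @ n)) ->
  exists X : car M (N ~> t1), forall n, isr (X @ n) /\ memr (X @ n) (H @ n).
Definition treem (T : car M t1) :=
  (forall s x, T @ snoc s x = cZ -> T @ s = cZ /\ le x o1) /\ (forall n, exists s, le n s /\ T @ s = cZ).
Definition WKLm := forall T, treem T -> exists b, forall n, T @ bar b n = cZ.
Definition is01m (f : car M (t1 ~> t1)) := (forall x, isr x -> in01r x -> isr (f @ x)) /\ (forall x, isr x -> forall y, isr y -> in01r x -> in01r y -> eqr x y -> eqr (f @ x) (f @ y)).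
Definition uscom (f : car M (t1 ~> t1)) := forall x, isr x -> in01r x -> forall k, exists n,
  forall y, isr y -> in01r y -> ballr x n y -> ltr (f @ y) (addr (f @ x) (ipow2r k)).
Definition boundm (f : car M (t1 ~> t1)) :=
  exists B, isr B /\ forall x, isr x -> in01r x -> ler (f @ x) B.
Definition UBm := forall f, is01m f -> uscom f -> boundm f.
Definition QFAC01m := forall Y : car M (t1 ~> N ~> N),
  (forall n, exists f, Y @ f @ n = cZ) ->
  exists F : car M (N ~> t1), forall n, Y @ (F @ n) @ n = cZ.
Definition E3m := exists E : car M t3, forall Y : car M t2,
  (exists f, Y @ f = cZ) <-> E @ Y = cZ.

Ltac sats :=
  cbn beta;
  lazymatch goal with
  | |- sat (All _ _) _ <-> _ => rewrite sat_all; apply: iff_all => ?; sats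
  | |- sat (Ex _ _) _ <-> _ => rewrite sat_ex; apply: iff_ex => ?; sats
  | |- sat (∀R, _) _ <-> _ => rewrite sat_allR; apply: iff_all => ?; apply: iff_imp => //; sats
  | |- sat (∃R, _) _ <-> _ => rewrite sat_exR; apply: iff_ex => ?; apply: iff_and => //; sats
  | |- sat (And _ _) _ <-> _ => rewrite sat_and; apply: iff_and; sats
  | |- sat (Iff _ _) _ <-> _ => rewrite /Iff sat_and; apply: iff_and; sats
  | |- sat (Neg _) _ <-> _ => rewrite sat_neg; apply: iff_imp => //; sats
  | |- sat (Imp _ _) _ <-> _ => rewrite sat_imp; apply: iff_imp; sats
  | |- sat (isR _) _ <-> _ => rewrite sat_isR; evs
  | |- sat (ltR _ _) _ <-> _ => rewrite sat_ltR; evs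
  | |- sat (leR _ _) _ <-> _ => rewrite sat_leR; evs
  | |- sat (eqR _ _) _ <-> _ => rewrite sat_eqR; evs
  | |- sat (in01 _) _ <-> _ => rewrite sat_in01; evs
  | |- sat (in_ball _ _ _) _ <-> _ => rewrite sat_in_ball; evs
  | |- sat (mem _ _) _ <-> _ => rewrite sat_mem; evs
  | |- sat (leN _ _) _ <-> _ => rewrite sat_leN; evs
  | |- sat (Eq0 _ _) _ <-> _ => rewrite sat_eqN; evs
  | |- _ => idtac
  end
with evs :=
  do 2 (cbn [ev lk fst snd];
  repeat match goal with
  | |- context [ev (wk _)] => rewrite ev_wk
  | |- context [ev snocN] => rewrite ev_snocN
  | |- context [ev barN] => rewrite ev_barN
  | |- context [ev (addR _ _)] => rewrite ev_addR
  | |- context [ev (ipow2R _)] => rewrite ev_ipow2R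
  end); cbn [ev lk fst snd]; try exact: iff_refl.

Lemma sat_isRR G (g : env M G) h : sat (isRR h) g <-> isRRm (ev h g).
Proof. rewrite /isRR /isRRm; sats. Qed.
Lemma sat_closed G (g : env M G) h : sat (closed_set h) g <-> closedm (ev h g).
Proof. rewrite /closed_set /closedm /memr; sats; exact: sat_isRR. Qed.
Lemma sat_ClC : sat (M := M) ClC tt <-> ClCm.
Proof. rewrite /ClC /ClCm /memr; sats; exact: sat_closed. Qed.
Lemma sat_tree G (g : env M G) T : sat (infinite_binary_tree T) g <-> treem (ev T g).
Proof. rewrite /infinite_binary_tree /treem; sats. Qed.
Lemma sat_WKL : sat (M := M) WKL tt <-> WKLm.
Proof. rewrite /WKL /WKLm; sats; exact: sat_tree. Qed.
Lemma sat_is01R G (g : env M G) f : sat (is01R f) g <-> is01m (ev f g).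
Proof. rewrite /is01R /is01m; sats. Qed.
Lemma sat_usco G (g : env M G) f : sat (usco f) g <-> uscom (ev f g).
Proof. rewrite /usco /uscom; sats. Qed.
Lemma sat_bounded G (g : env M G) f : sat (bounded_above f) g <-> boundm (ev f g).
Proof. rewrite /bounded_above /boundm; sats. Qed.
Lemma sat_usco_bounded : sat (M := M) usco_bounded tt <-> UBm.
Proof.
rewrite /usco_bounded /UBm; sats; [exact: sat_is01R|exact: sat_usco|exact: sat_bounded].
Qed.
Lemma sat_QFAC01 : sat (M := M) QFAC01 tt <-> QFAC01m.
Proof. rewrite /QFAC01 /QFAC01m; sats. Qed.
Lemma sat_E3 : sat (M := M) Kleene_E3 tt <-> E3m.
Proof. rewrite /Kleene_E3 /E3m; sats. Qed.
End Principles.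

Lemma completeness_model (T : theory) (A : sentence) : (forall B, RCA0w B -> T B) ->
  (forall M : model, (forall B, T B -> sat (M := M) B tt) -> sat (M := M) A tt) -> T ⊢ A.
Proof. by move=> hT h; apply: completeness => // M hM; apply: (h (Model hM)). Qed.

Lemma reduction : (forall M : model, @E3m M -> @ClCm M) ->
  (forall M : model, @QFAC01m M -> @ClCm M) ->
  (forall M : model, @ClCm M -> (@WKLm M <-> @UBm M)) ->
  ((Z2Omega ⊢ ClC) /\ (RCA0w ⊕ QFAC01 ⊢ ClC)) /\ (RCA0w ⊕ ClC ⊢ WKL ⇔ usco_bounded).
Proof.
have inT B0 B : RCA0w B -> (RCA0w ⊕ B0) B by left.
move=> h1 h2 h3; split; [split|]; apply: completeness_model; try by move=> B; left.
all: move=> M hM.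
- by apply/sat_ClC/h1/sat_E3/hM; right.
- by apply/sat_ClC/h2/sat_QFAC01/hM; right.
- by rewrite sat_iff sat_WKL sat_usco_bounded; apply/h3/sat_ClC/hM; right.
Qed.

(** * Reals as sequences in the field of rationals *)

Section Reals.
Context {M : model}.
Notation hM := (mrca M).
Notation NN := (car M N).
Notation RR := (car M t1).
Local Open Scope ring_scope.
Notation "n %:K" := (inN n) (at level 2, format "n %:K").

Definition q (x : RR) (n : NN) : K M := toK (x @ n).

Lemma eps_small (d : K M) : 0 < d -> exists n : NN, eps n < d.
Proof.
move=> d0; have [n hn] := K_archi d^-1; exists n.
rewrite epsE -(invrK d) ltf_pV2 ?posrE ?invr_gt0 ?pow2_pos //.
apply: le_lt_trans hn _; have /nlt_leS := pow2_gt n; lra.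
Qed.

Lemma le_eps (a b : K M) : (forall k, a <= b + eps k) -> a <= b.
Proof.
move=> h; rewrite leNgt; apply/negP => ba.
have [|k hk] := @eps_small (a - b); first by lra.
by have := h k; lra.
Qed.

Lemma isrE x : isr x <-> forall n i, `|q x n - q x (add n i)| < eps n.
Proof.
have e n i : ltq (absq (subq (x @ n) (x @ add n i))) (ipow2q n) <-> `|q x n - q x (add n i)| < eps n.
  by rewrite ltqE toK_abs toK_sub toK_ipow2.
by split=> h n i; apply/e; apply: h.
Qed.

Lemma real_le x m n : isr x -> le m n -> `|q x m - q x n| < eps m.
Proof. by move=> /isrE h /nleE[c ->]. Qed.

Lemma abs_lt (a b : K M) : `|a| < b <-> - b < a /\ a < b.
Proof. by rewrite ltr_norml; split=> [/andP|[-> ->]]. Qed.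

Lemma real_le2 x m n : isr x -> le m n -> q x m < q x n + eps m /\ q x n < q x m + eps m.
Proof. by move=> rx /(real_le rx)/abs_lt[]; split; lra. Qed.

Lemma rltE (x y : RR) : ltr x y <-> exists n, q x n + 2 * eps n < q y n.
Proof.
have e n : ltq (addq (x @ n) (addq (ipow2q n) (ipow2q n))) (y @ n) <-> q x n + 2 * eps n < q y n.
  rewrite ltqE toK_add toK_add toK_ipow2 -/(q x n) -/(q y n).
  by move: (q x n) (q y n) (eps n) => a b c; split; lra.
by split=> -[n /e h]; exists n.
Qed.

Lemma rleE (x y : RR) : ler x y <-> forall n, q x n <= q y n + 2 * eps n.
Proof.
rewrite /ler rltE; split=> [h n|h [n k]].
  by rewrite leNgt; apply/negP => k; apply: h; exists n.
by have := h n; lra.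
Qed.

(** The definition inspects a single index with a margin of twice the error. For reals this amounts
    to a gap that persists at all later indices, a form in which inequalities can be chained. *)
Lemma rltP (x y : RR) : isr x -> isr y ->
  ltr x y <-> exists k n, forall m, le n m -> q x m + eps k <= q y m.
Proof.
move=> rx ry; rewrite rltE; split=> [[n h]|[k [n h]]].
  have [k hk] := @eps_small (q y n - q x n - 2 * eps n) ltac:(lra).
  exists k, n => m nm; have [] := real_le2 rx nm; have [] := real_le2 ry nm; lra.
exists (add n (sc (sc k))); set m := add n _.
have := h m (nle_add _ _); have : eps m <= eps (sc (sc k)) by apply/eps_le/nle_addr.
rewrite !epsS; have := eps_gt0 k; lra.
Qed.

Lemma rleP (x y : RR) : isr x -> isr y ->
  ler x y <-> forall k, exists n, forall m, le n m -> q x m <= q y m + eps k.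
Proof.
move=> rx ry; split=> [/rleE h k|h].
  exists (sc k) => m /eps_le; rewrite epsS; have := h m; lra.
move=> /rltP-/(_ ry rx) [k [n hn]].
have [n' hn'] := h (sc k); pose m := add n n'.
have := hn m (nle_add _ _); have := hn' m (nle_addr _ _).
rewrite epsS; have := eps_gt0 k; lra.
Qed.

Lemma ltr_ler (x y : RR) : isr x -> isr y -> ltr x y -> ler x y.
Proof.
move=> rx ry /(rltP rx ry) [k [n h]]; apply/(rleP rx ry) => j; exists n => m /h.
have := eps_gt0 k; have := eps_gt0 j; lra.
Qed.

Lemma ler_refl (x : RR) : ler x x.
Proof. by apply/rleE => n; have := eps_gt0 n; lra. Qed.

Lemma ler_tr (y x z : RR) : isr x -> isr y -> isr z -> ler x y -> ler y z -> ler x z.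
Proof.
move=> rx ry rz /(rleP rx ry) h /(rleP ry rz) h'; apply/(rleP rx rz) => k.
have [n hn] := h (sc k); have [n' hn'] := h' (sc k); exists (add n n') => m nm.
have := hn m (nle_trans (nle_add _ _) nm); have := hn' m (nle_trans (nle_addr _ _) nm).
rewrite epsS; lra.
Qed.

Lemma ltr_ler_tr (y x z : RR) : isr x -> isr y -> isr z -> ltr x y -> ler y z -> ltr x z.
Proof.
move=> rx ry rz /(rltP rx ry) [k [n hn]] /(rleP ry rz) h'; apply/(rltP rx rz).
have [n' hn'] := h' (sc k); exists (sc k), (add n n') => m nm.
have := hn m (nle_trans (nle_add _ _) nm); have := hn' m (nle_trans (nle_addr _ _) nm).
rewrite epsS; lra.
Qed.

Lemma ler_ltr_tr (y x z : RR) : isr x -> isr y -> isr z -> ler x y -> ltr y z -> ltr x z.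
Proof.
move=> rx ry rz /(rleP rx ry) h' /(rltP ry rz) [k [n hn]]; apply/(rltP rx rz).
have [n' hn'] := h' (sc k); exists (sc k), (add n n') => m nm.
have := hn m (nle_trans (nle_add _ _) nm); have := hn' m (nle_trans (nle_addr _ _) nm).
rewrite epsS; lra.
Qed.

Lemma eqr_refl (x : RR) : eqr x x.
Proof. by split; apply: ler_refl. Qed.
Lemma eqr_sym (x y : RR) : eqr x y -> eqr y x.
Proof. by case. Qed.
Lemma eqr_tr (y x z : RR) : isr x -> isr y -> isr z -> eqr x y -> eqr y z -> eqr x z.
Proof. by move=> rx ry rz [? ?] [? ?]; split; apply: (@ler_tr y). Qed.

Lemma q_constr c n : q (constr c) n = toK c.
Proof. by rewrite /q constrE. Qed.
Lemma real_constr (c : NN) : isr (constr c).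
Proof. by apply/isrE => n i; rewrite !q_constr subrr normr0 eps_gt0. Qed.
Lemma q_zeror n : q zeror n = 0.
Proof. by rewrite q_constr toK_nat inN0. Qed.
Lemma q_oner n : q oner n = 1.
Proof. by rewrite q_constr toK_nat inN1. Qed.
Lemma q_ipow2r k n : q (ipow2r k) n = eps k.
Proof. by rewrite q_constr toK_ipow2. Qed.
Lemma real_zeror : isr (zeror : RR). Proof. exact: real_constr. Qed.
Lemma real_oner : isr (oner : RR). Proof. exact: real_constr. Qed.
Lemma q_addr x y n : q (addr x y) n = q x (sc n) + q y (sc n).
Proof. by rewrite /q addrE toK_add. Qed.
Lemma q_subr x y n : q (subr x y) n = q x (sc n) - q y (sc n).
Proof. by rewrite /q subrE toK_sub. Qed.
Lemma q_absr x n : q (absr x) n = `|q x n|.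
Proof. by rewrite /q absrE toK_abs. Qed.

Lemma real_addr (x y : RR) : isr x -> isr y -> isr (addr x y).
Proof.
move=> /isrE rx /isrE ry; apply/isrE => n i; rewrite !q_addr -naddSr.
have /abs_lt[] := rx (sc n) i; have /abs_lt[] := ry (sc n) i; rewrite epsS => *.
by apply/abs_lt; split; lra.
Qed.

Lemma ballrE (x : RR) n y : isr x -> isr y -> ballr x n y <->
  exists k j, forall m, le j m -> `|q y m - q x m| + eps k <= eps n.
Proof.
move=> rx ry; have rd : isr (absr (subr y x)).
  apply/isrE => m i. rewrite !q_absr. rewrite !q_subr. rewrite -naddSr.
  have /abs_lt[] := (isrE _).1 rx (sc m) i; have /abs_lt[] := (isrE _).1 ry (sc m) i.
  rewrite epsS => ????; apply: le_lt_trans (ler_dist_dist _ _) _; apply/abs_lt; split; lra.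
rewrite /ballr (rltP rd (real_constr _)); split=> -[k [j h]].
  exists k, (sc j) => m; case: (nn_case m) => [->|[l ->]]; first by move/nlt0.
  by move=> /nleSS/h; rewrite q_absr q_subr q_ipow2r.
by exists k, j => m jm; rewrite q_absr q_subr q_ipow2r; apply: h; apply: nle_S.
Qed.

Lemma ballr_intro (x : RR) n y m : isr x -> isr y -> `|q y m - q x m| + 2 * eps m < eps n -> ballr x n y.
Proof.
move=> rx ry h; apply/(ballrE _ rx ry).
have [k hk] := @eps_small (eps n - `|q y m - q x m| - 2 * eps m) ltac:(lra).
exists k, m => j mj; have [] := real_le2 rx mj; have [] := real_le2 ry mj => ????.
have /abs_lt[??] : `|q y m - q x m| < eps n - 2 * eps m - eps k by lra.
suff : `|q y j - q x j| <= eps n - eps k by lra.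
by rewrite ler_norml; apply/andP; split; lra.
Qed.

Lemma ballr_elim (x : RR) n y m : isr x -> isr y -> ballr x n y -> `|q y m - q x m| < eps n + 2 * eps m.
Proof.
move=> rx ry /(ballrE _ rx ry) [k [j h]].
have := h _ (nle_add j m); have [] := real_le2 rx (nle_addr m j).
have [] := real_le2 ry (nle_addr m j) => ???? hk.
have /abs_lt[??] : `|q y (add j m) - q x (add j m)| < eps n by have := eps_gt0 k; lra.
by apply/abs_lt; split; lra.
Qed.

(** * Every function is replaced by a real *)

Definition hatstep (f : RR) (n : NN) := forall m, lt m n -> ltq (absq (subq (f @ m) (f @ n))) (ipow2q m).
#[global] Instance P2_hatstep : P2 hatstep. Proof. by apply: P2_intro; rewrite /hatstep; dec. Qed.
(** The index advances while each new value is close enough to all earlier ones, and is frozen at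
    the first failure. Hence [hat f] is always a real and is [f] itself when [f] is one, so that
    functionals on reals can be required on all functions without deciding the predicate [isr]. *)
Definition hatidx := sval (seal (fun (f : RR) (n : NN) =>
  recf (fun i r => cond (r = i /\ hatstep f (sc i)) (sc i) r) cZ n)).
Definition hatidx_unlock : hatidx = _ := svalP (seal _).
#[global] Instance D2_hatidx : D2 hatidx. Proof. by apply: D2_intro; rewrite hatidx_unlock; def. Qed.
Definition hat := sval (seal (T := RR -> RR) (fun (f : RR) => LAM (fun n => f @ hatidx f n))).
Definition hat_unlock : hat = _ := svalP (seal _).
#[global] Instance D1_hat : D1 hat. Proof. by apply: D1_intro; rewrite hat_unlock; def. Qed.

Lemma hatE (f : RR) n : hat f @ n = f @ hatidx f n.
Proof. by rewrite hat_unlock beta //; def. Qed.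

Lemma hatidxS (f : RR) n : hatidx f (sc n) =
  cond (hatidx f n = n /\ hatstep f (sc n)) (sc n) (hatidx f n).
Proof. by rewrite hatidx_unlock recfS //; def. Qed.

Lemma hatidx_le (f : RR) n : le (hatidx f n) n.
Proof.
move: n; apply: nn_ind; first by dec.
  by rewrite hatidx_unlock recf0; apply: nle_refl.
move=> n h; rewrite hatidxS; case: (EM (hatidx f n = n /\ hatstep f (sc n))) => p.
  by rewrite condT //; apply: nle_refl.
by rewrite condF //; apply: nle_S.
Qed.

Lemma hatidx_add (f : RR) n i :
  (hatidx f n = n /\ (hatidx f (add n i) = n \/ (lt n (hatidx f (add n i)) /\
     hatstep f (hatidx f (add n i))))) \/ (hatidx f n <> n /\ hatidx f (add n i) = hatidx f n).
Proof.
move: i; apply: nn_ind; first by dec.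
  by rewrite naddr0; case: (EM (hatidx f n = n)) => h; [left|right]; split=> //; left.
move=> i IH; rewrite naddrS hatidxS; set s := add n i.
case: (EM (hatidx f s = s /\ hatstep f (sc s))) => p; last by rewrite condF.
rewrite condT //; case: IH => [[h _]|[h e]].
  by left; split=> //; right; split; [apply/nltS/nle_add|case: p].
case: h; apply: nle_anti; first exact: hatidx_le.
by rewrite -e p.1; apply: nle_add.
Qed.

Lemma real_hat (f : RR) : isr (hat f).
Proof.
apply/isrE => n i; rewrite /q !hatE; have e0 := eps_gt0 n.
case: (hatidx_add f n i) => [[-> [->|[h1 h2]]]|[_ ->]]; rewrite ?subrr ?normr0 //.
by have := h2 n h1; rewrite ltqE toK_abs toK_sub toK_ipow2.
Qed.

Lemma hat_real (x : RR) : isr x -> hat x = x.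
Proof.
move=> rx; apply: car_ext => n; rewrite hatE; congr (_ @ _).
move: n; apply: nn_ind; first by dec.
  by rewrite hatidx_unlock recf0.
move=> n h; rewrite hatidxS condT //; split=> // m /nltW mn.
by rewrite ltqE toK_abs toK_sub toK_ipow2; apply: real_le.
Qed.

End Reals.

(** * QF-AC^{0,1} implies ClC *)

Section ChoiceImpliesClC.
Context {M : model}.
Notation hM := (mrca M).
Notation NN := (car M N).
Notation RR := (car M t1).
Local Open Scope ring_scope.

Definition ftail (f : RR) : RR := LAM (fun n => f @ sc n).
#[global] Instance D1_ftail : D1 ftail. Proof. by apply: D1_intro; rewrite /ftail; def. Qed.
(** Puts the witness of an existential number quantifier in front of a real, so that membership in a
    set becomes a decidable statement about one function. *)
Definition fcons (k : NN) (f : RR) : RR := LAM (fun n => cond (n = cZ) k (f @ prd n)).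
#[global] Instance D2_fcons : D2 fcons. Proof. by apply: D2_intro; rewrite /fcons; def. Qed.
Lemma ftailE f n : ftail f @ n = f @ sc n. Proof. by rewrite beta //; def. Qed.
Lemma fconsE k f n : fcons k f @ n = cond (n = cZ) k (f @ prd n).
Proof. by rewrite beta //; def. Qed.
Lemma fcons0 k f : fcons k f @ cZ = k. Proof. by rewrite fconsE condT. Qed.
Lemma ftail_fcons k f : ftail (fcons k f) = f.
Proof.
by apply: car_ext => n; rewrite ftailE fconsE prdS condF //; apply: (r_S0 hM).
Qed.

Definition ltrw (n : NN) (x y : RR) := ltq (addq (x @ n) (addq (ipow2q n) (ipow2q n))) (y @ n).
#[global] Instance P3_ltrw : P3 ltrw. Proof. by apply: P3_intro; rewrite /ltrw; dec. Qed.

Lemma QFAC01_ClC : @QFAC01m M -> @ClCm M.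
Proof.
move=> ac H hH.
pose P (f : RR) (n : NN) := ltrw (f @ cZ) zeror (H @ n @ hat (ftail f)).
have [Y hY] : P2 P by apply: P2_intro; rewrite /P; dec.
have [n|F hF] := ac Y.
  have [_ [_ [x [rx [k hk]]]]] := hH n; exists (fcons k x); apply/hY.
  by rewrite /P fcons0 ftail_fcons hat_real.
exists (LAM (fun n => hat (ftail (F @ n)))) => n; rewrite beta; last by def.
by split; [exact: real_hat|exists (F @ n @ cZ); exact/hY].
Qed.

End ChoiceImpliesClC.

(** * Leftmost points by dyadic bisection *)

Section Dyadic.
Context {M : model}.
Notation hM := (mrca M).
Notation NN := (car M N).
Notation RR := (car M t1).
Local Open Scope ring_scope.
Notation "n %:K" := (inN n) (at level 2, format "n %:K").

Definition dy (i k : NN) : NN := frq i cZ (pow2 k).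
#[global] Instance D2_dy : D2 dy. Proof. by apply: D2_intro; rewrite /dy; def. Qed.
Lemma toK_dy i k : toK (dy i k) = i%:K * eps k.
Proof. by rewrite toK_frq; [rewrite inN0 subr0 epsE|exact: pow2_neq0]. Qed.

#[global] Instance D1_constr : D1 (@constr M).
Proof. by apply: D1_intro; rewrite constr_unlock; def. Qed.

Lemma ltr_dyE (x : RR) i k : isr x ->
  (ltr x (constr (dy i k)) -> forall m, q x m <= i%:K * eps k + 2 * eps m) /\
  (~ ltr x (constr (dy i k)) -> forall m, i%:K * eps k <= q x m + 2 * eps m).
Proof.
move=> rx; have rd := real_constr (dy i k); split=> [/(ltr_ler rx rd)|] /rleE h m;
  by have := h m; rewrite q_constr toK_dy.
Qed.

Lemma ler_constr c d : toK c <= toK d -> ler (constr c) (constr d : RR).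
Proof. by move=> h; apply/rleE => n; rewrite !q_constr; have := eps_gt0 n; lra. Qed.
Lemma ltr_constr c d : toK c < toK d -> ltr (constr c) (constr d : RR).
Proof.
move=> h; have [n hn] := @eps_small _ (toK d - toK c) ltac:(lra).
apply/rltE; exists (sc n); rewrite !q_constr epsS; lra.
Qed.

Section Leftmost.
Variable P : NN -> NN -> NN -> Prop.
Hypothesis dP : P3 P.
Hypothesis P_mono : forall c k i k' i', i%:K * eps k <= i'%:K * eps k' -> P c k i -> P c k' i'.
Hypothesis P_zero : forall c k, ~ P c k cZ.
Hypothesis P_last : forall c k, P c k (sc (pow2 k)).

(** The reading of [P c k i] is that the [c]-th set has a point left of [i / 2^k] or, for a
    sequence, that its terms return there again and again. The index is that of the last point of
    the grid with [P] false; if the search below [2^k] fails, the default [2^k] is still right by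
    [P_last]. *)
Definition lidx (c k : NN) := bmin (pow2 k) (fun i => P c k (sc i)).

Lemma lidx_dec c k : Dec (G := [:: N]) (fun e => P c k (sc e.1)).
Proof. by dec. Qed.

Lemma lidxP c k : P c k (sc (lidx c k)) /\ ~ P c k (lidx c k).
Proof.
have d := lidx_dec c k; split.
  case: (EM (lidx c k = pow2 k)) => [->|ne]; first exact: P_last.
  apply: (@bmin_true M (fun i => P c k (sc i)) d (pow2 k)); apply/nlt_neq; split=> //.
  exact: (@bmin_le M (fun i => P c k (sc i)) d).
case: (nn_case (lidx c k)) => [->|[j e]]; first exact: P_zero.
rewrite e; apply: (@bmin_min M (fun i => P c k (sc i)) d (pow2 k)); rewrite -/(lidx c k) e; exact: nltn_S.
Qed.

Lemma leftmost : exists X : car M (N ~> t1), forall c, isr (X @ c) /\ in01r (X @ c) /\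
  forall k, exists i, q (X @ c) k = i%:K * eps k /\ P c k (sc i) /\ ~ P c k i.
Proof.
have dl : D2 lidx by apply: D2_intro; rewrite /lidx; def.
exists (LAM (fun c => LAM (fun k => dy (lidx c k) k))) => c.
have e : LAM (fun c => LAM (fun k => dy (lidx c k) k)) @ c = LAM (fun k => dy (lidx c k) k).
  by rewrite beta //; def.
have qE k : q (LAM (fun c => LAM (fun k => dy (lidx c k) k)) @ c) k = (lidx c k)%:K * eps k.
  by rewrite e /q beta ?toK_dy //; def.
split; last split.
- apply/isrE => n i; rewrite !qE; have [h1 h2] := lidxP c n.
  have [h3 h4] := lidxP c (add n i); move: (lidx c n) (lidx c (add n i)) h1 h2 h3 h4 => a b h1 h2 h3 h4.
  have l1 : b%:K * eps (add n i) < (sc a)%:K * eps n.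
    by rewrite ltNge; apply/negP => /P_mono; move=> /(_ c h1).
  have l2 : a%:K * eps n < (sc b)%:K * eps (add n i).
    by rewrite ltNge; apply/negP => /P_mono; move=> /(_ c h3).
  (* A point of level [n] is also a multiple of the finer unit, so the strict bound [l2] improves by
     one unit. *)
  have l3 : a%:K * eps n <= b%:K * eps (add n i).
    have pe := pow2_eps i; have p0 := pow2_pos i; have e0 := eps_gt0 n; have e1 := eps_gt0 i.
    have : lt (mul a (pow2 i)) (sc b).
      have l4 : a%:K * eps n < (sc b)%:K * eps i * eps n.
        by rewrite -mulrA (mulrC (eps i)) -epsD.
      apply/inN_lt; rewrite inNM -(ltr_pM2r e1) -mulrA pe mulr1; by rewrite ltr_pM2r in l4.
    move=> /nltS/inN_le; rewrite inNM => l5.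
    rewrite epsD (mulrC (eps n)) mulrA ler_pM2r //.
    by rewrite -(ler_pM2r p0) -mulrA (mulrC (eps i)) pe mulr1.
  by apply/abs_lt; move: l1; rewrite inNS => l1; have := eps_gt0 n; split; lra.
- split; apply/rleE => n; rewrite ?q_zeror ?q_oner !qE; have e0 := eps_gt0 n; have i0 := inN_ge0 (lidx c n).
    have : 0 <= (lidx c n)%:K * eps n by apply: mulr_ge0 => //; apply: ltW.
    lra.
  have : (lidx c n)%:K * eps n <= (pow2 n)%:K * eps n.
    by rewrite ler_pM2r //; apply/inN_le; apply: (@bmin_le M (fun i => P c n (sc i)) (lidx_dec c n)).
  by rewrite pow2_eps; lra.
- by move=> k; exists (lidx c k); split=> //; apply: lidxP.
Qed.
End Leftmost.

Lemma E3_ClC : @E3m M -> @ClCm M.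
Proof.
move=> [E hE] H hH.
(* The function [f] holds a witness of membership at index 0, a witness of [x < i / 2^k] at index 1,
   and then the real [x]. *)
pose Q (c k i : NN) (f : RR) := ltrw (f @ cZ) zeror (H @ c @ hat (ftail (ftail f))) /\
  ltrw (f @ o1) (hat (ftail (ftail f))) (constr (dy i k)).
pose P c k i := exists x, isr x /\ memr x (H @ c) /\ ltr x (constr (dy i k)).
have PE c k i : P c k i <-> E @ LAM (fun f => cond (Q c k i f) cZ o1) = cZ.
  rewrite -hE; split=> [[x [rx [[m hm] [n hn]]]]|[f]].
    exists (fcons m (fcons n x)); rewrite beta; last by rewrite /Q; def.
    have e : fcons m (fcons n x) @ o1 = n by rewrite /o1 -ftailE ftail_fcons fcons0.
    by rewrite condT // /Q !ftail_fcons hat_real // fcons0 e.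
  rewrite beta; last by rewrite /Q; def.
  case: (EM (Q c k i f)) => [[h1 h2] _|n]; last by rewrite condF // => /(r_S0 hM).
  exists (hat (ftail (ftail f))); split; first exact: real_hat.
  by split; [exists (f @ cZ)|exists (f @ o1)].
have dP : P3 P.
  have [F hF] : D3 (fun c k i => E @ LAM (fun f => cond (Q c k i f) cZ o1)).
    by apply: D3_intro; rewrite /Q; def.
  by exists F => c k i; rewrite hF PE.
have [||| X hX] := leftmost dP.
- move=> c k i k' i' le [x [rx [mx lx]]]; exists x; split=> //; split=> //.
  apply: ltr_ler_tr lx _ => //; try exact: real_constr.
  by apply: ler_constr; rewrite !toK_dy.
- move=> c k [x [rx [mx lx]]]; have [/rleE h0 _] := (hH c).2.1 x rx mx.
  apply: (_ : ~ ltr x (constr (dy cZ k))) => //; apply/rleE => m.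
  by have := h0 m; rewrite q_zeror q_constr toK_dy inN0 mul0r.
- move=> c k; have [_ [h01 [x [rx mx]]]] := hH c; exists x; split=> //; split=> //.
  apply: ler_ltr_tr (proj2 (h01 x rx mx)) _ => //; try exact: real_constr.
  apply: ltr_constr; rewrite toK_nat inN1 toK_dy inNS mulrDl pow2_eps; have := eps_gt0 k; lra.
exists X => c; have [rX [iX hk]] := hX c; split=> //.
apply: contrapT => nm; have [[_ cl] [h01 _]] := hH c.
(* At index [k] the point found and some element of the set differ by at most [3 * eps k], and
   [ballr_intro] adds [2 * eps k]; three further levels make [eps n = 8 * eps k] large enough. *)
have [n hn] := cl _ rX nm; pose k := sc (sc (sc n)).
have [i [qi [[x [rx [mx lx]]] nP]]] := hk k.
have nlx : ~ ltr x (constr (dy i k)) by move=> l; apply: nP; exists x.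
apply: (hn x) => //; apply: (ballr_intro (m := k)) => //.
have := (ltr_dyE (sc i) k rx).1 lx k; have := (ltr_dyE i k rx).2 nlx k.
rewrite qi inNS mulrDl mul1r => l1 l2.
have e8 : eps n = 8 * eps k by rewrite /k !epsS; lra.
have e0 := eps_gt0 k; suff /abs_lt : - (5 * eps k) < q x k - i%:K * eps k /\ q x k - i%:K * eps k < 5 * eps k.
  by rewrite e8; lra.
by split; lra.
Qed.

End Dyadic.

(** * Arithmetical comprehension and sequences on which an usco function is unbounded *)

Section ArithmeticalComprehension.
Context {M : model}.
Notation hM := (mrca M).
Notation NN := (car M N).
Notation RR := (car M t1).
Local Open Scope ring_scope.
Notation "n %:K" := (inN n) (at level 2, format "n %:K").

Definition ACAm := forall h : car M (N ~> N ~> N), exists p : RR, forall c,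
  p @ c = cZ <-> exists n, h @ c @ n = cZ.
Definition E2m := exists E : car M t2, forall g : RR, E @ g = cZ <-> exists n, g @ n = cZ.

Lemma E2_ACA : E2m -> ACAm.
Proof. by move=> [E hE] h; exists (LAM (fun c => E @ (h @ c))) => c; rewrite beta ?hE //; def. Qed.

Lemma ACA_P1 (R : NN -> NN -> Prop) : ACAm -> P2 R -> P1 (fun c => exists n, R c n).
Proof.
move=> aca [h hR]; have [p hp] := aca h; exists p => c; rewrite hp.
by split=> -[n k]; exists n; apply/hR.
Qed.

Definition natr (n : NN) : RR := constr (natq n).
Lemma q_natr n m : q (natr n) m = n%:K.
Proof. by rewrite q_constr toK_nat. Qed.
Lemma real_natr n : isr (natr n). Proof. exact: real_constr. Qed.

(* The points [Y n] have a greatest lower bound in the limit, at which [f] would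
   have to exceed every natural number. *)
Lemma unbounded_sequence_contra (f : car M (t1 ~> t1)) (Y : car M (N ~> t1)) : ACAm ->
  is01m f -> uscom f ->
  (forall n, isr (Y @ n) /\ in01r (Y @ n) /\ ler (natr n) (f @ (Y @ n))) -> False.
Proof.
move=> aca [rf _] uf hY.
(* Here [c] codes [m], [i] and [k], and [n] codes an index of the sequence with a witness of an
   inequality. That beyond every [m] some term lies below [i / 2^k] has two quantifiers, so
   comprehension is applied twice. *)
pose R1 (c n : NN) := le (fstn c) (fstn n) /\
  ltrw (sndn n) (Y @ fstn n) (constr (dy (fstn (sndn c)) (sndn (sndn c)))).
have d1 : P2 R1 by apply: P2_intro; rewrite /R1; dec.
pose S1 c := exists w, R1 c w; have d2 : P1 S1 := ACA_P1 aca d1.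
pose R2 c n := ~ S1 (pairn n c).
have d3 : P2 R2 by apply: P2_intro; rewrite /R2; dec.
pose S2 c := exists n, R2 c n; have d4 : P1 S2 := ACA_P1 aca d3.
pose P (c k i : NN) := ~ S2 (pairn i k).
have d5 : P3 P by apply: P3_intro; rewrite /P; dec.
have PE c k i : P c k i <-> forall m, exists n, le m n /\ ltr (Y @ n) (constr (dy i k)).
  split=> [h m|h [m]].
    have [w] : exists w, R1 (pairn m (pairn i k)) w.
      by apply: contrapT => n; apply: h; exists m.
    rewrite /R1 !(fstn_pair, sndn_pair) => -[l hw]; exists (fstn w); split=> //.
    by exists (sndn w).
  apply; have [n [l [w hw]]] := h m; exists (pairn n w).
  by rewrite /R1 !(fstn_pair, sndn_pair).
have [||| X hX] := leftmost d5.
- move=> c k i k' i' l /PE h; apply/PE => m; have [n [mn ln]] := h m; exists n; split=> //.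
  have [ry _] := hY n; apply: ltr_ler_tr ln _ => //; try exact: real_constr.
  by apply: ler_constr; rewrite !toK_dy.
- move=> c k /PE h; have [n [_ ln]] := h cZ; have [ry [[/rleE h0 _] _]] := hY n.
  apply: (_ : ~ ltr (Y @ n) (constr (dy cZ k))) => //; apply/rleE => m.
  by have := h0 m; rewrite q_zeror q_constr toK_dy inN0 mul0r.
- move=> c k; apply/PE => m; exists m; split; first exact: nle_refl.
  have [ry [[_ h1] _]] := hY m; apply: ler_ltr_tr h1 _ => //; try exact: real_constr.
  apply: ltr_constr; rewrite toK_nat inN1 toK_dy inNS mulrDl pow2_eps; have := eps_gt0 k; lra.
have [rx [ix hk]] := hX cZ; set x := X @ cZ in rx ix hk.
have [j hj] := uf x rx ix cZ; pose k := sc (sc (sc j)).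
have [i [qi [/PE Pi /PE nPi]]] := hk k.
have [m0 hm0] : exists m0, forall n, le m0 n -> ~ ltr (Y @ n) (constr (dy i k)).
  apply: contrapT => h; apply: nPi => m; apply: contrapT => h'; apply: h; exists m => n mn ln.
  by apply: h'; exists n.
(* At index 0 two comparisons cost 2 each, the change of index costs 1, and upper semi-continuity
   allows an increase of 1; 8 exceeds the total. *)
have [b hb] := K_archi (q (f @ x) cZ + 8); have [n [bn ln]] := Pi (add m0 b).
have nln := hm0 n (nle_trans (nle_add _ _) bn).
have [ry [iy hn]] := hY n.
have ball : ballr x j (Y @ n).
  apply: (ballr_intro (m := k)) => //.
  have := (ltr_dyE (sc i) k ry).1 ln k; have := (ltr_dyE i k ry).2 nln k.
  rewrite qi inNS mulrDl mul1r => l1 l2.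
  have e8 : eps j = 8 * eps k by rewrite /k !epsS; lra.
  have e0 := eps_gt0 k; suff /abs_lt : - (5 * eps k) < q (Y @ n) k - i%:K * eps k /\
    q (Y @ n) k - i%:K * eps k < 5 * eps k by rewrite e8; lra.
  by split; lra.
have rfx := rf _ rx ix; have rfy := rf _ ry iy.
have lf := hj _ ry iy ball.
have /rleE/(_ cZ) := ltr_ler rfy (real_addr rfx (real_constr _)) lf.
rewrite q_addr q_constr toK_ipow2; have /rleE/(_ cZ) := hn.
rewrite q_natr eps0; have [_] := real_le2 rfx (nle0 (sc cZ)).
rewrite eps0; have /inN_le : le b n by apply: nle_trans (nle_addr _ _) bn.
lra.
Qed.

End ArithmeticalComprehension.

(** * Codes of finite sequences, and separation from weak König's lemma *)

Section SequenceCodes.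
Context {M : model}.
Notation hM := (mrca M).
Notation NN := (car M N).
Notation RR := (car M t1).
Local Open Scope ring_scope.
Notation "n %:K" := (inN n) (at level 2, format "n %:K").

Definition par (s : NN) := fstn (prd s).
#[global] Instance D1_par : D1 par. Proof. by apply: D1_intro; rewrite /par; def. Qed.
Definition lst (s : NN) := sndn (prd s).
#[global] Instance D1_lst : D1 lst. Proof. by apply: D1_intro; rewrite /lst; def. Qed.

Lemma par_snoc s x : par (snoc s x) = s.
Proof. by rewrite /par snoc_unlock prdS fstn_pair. Qed.
Lemma lst_snoc s x : lst (snoc s x) = x.
Proof. by rewrite /lst snoc_unlock prdS sndn_pair. Qed.
Lemma snoc_eta s : s <> cZ -> snoc (par s) (lst s) = s.
Proof.
case: (nn_case s) => [-> //|[k ->] _].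
by rewrite snoc_unlock /par /lst !prdS pairn_eta.
Qed.
Lemma snoc_neq0 (s x : NN) : snoc s x <> cZ.
Proof. by rewrite snoc_unlock; apply: (r_S0 hM). Qed.
Lemma lt_snoc (s x : NN) : lt s (snoc s x).
Proof. by rewrite snoc_unlock; apply/nltS; rewrite -{1}(fstn_pair s x); apply: fstn_le. Qed.

Lemma le_bar (g : RR) n : le n (bar g n).
Proof.
move: n; apply: nn_ind; first by dec.
  exact: nle0.
by move=> n h; rewrite barS; apply: nle_trans (lt_snoc _ _); rewrite nleSS.
Qed.

Definition iterp := sval (seal (T := NN -> NN -> NN) (fun k s => recf (fun _ r => par r) s k)).
Definition iterp_unlock : iterp = _ := svalP (seal _).
#[global] Instance D2_iterp : D2 iterp. Proof. by apply: D2_intro; rewrite iterp_unlock; def. Qed.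

Lemma iterp0 s : iterp cZ s = s. Proof. by rewrite iterp_unlock recf0. Qed.
Lemma iterpS k s : iterp (sc k) s = par (iterp k s).
Proof. by rewrite iterp_unlock recfS //; def. Qed.
Lemma iterpSr k s : iterp (sc k) s = iterp k (par s).
Proof.
move: k; apply: nn_ind; first by dec.
  by rewrite iterpS !iterp0.
by move=> k h; rewrite iterpS h iterpS.
Qed.

Lemma iterp_le k s : le (add (iterp k s) k) s \/ iterp k s = cZ.
Proof.
move: k; apply: nn_ind; first by dec.
  by left; rewrite iterp0 naddr0; apply: nle_refl.
move=> k; rewrite iterpS; case: (EM (iterp k s = cZ)) => [-> _|nz].
  by right; apply: nle_n0; rewrite -[X in le _ X]prd0; apply: fstn_le.
case=> // h; left; apply: nle_trans h; rewrite naddrS -naddSr.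
apply: nleD (nle_refl _); rewrite -[X in le _ X](snoc_eta nz); exact: lt_snoc.
Qed.

Lemma iterp_self s : iterp s s = cZ.
Proof.
case: (iterp_le s s) => // h; apply: nle_n0; apply/inN_le.
by move/inN_le: h; rewrite inND inN0; lra.
Qed.

(** The code itself bounds the search: passing to the parent lowers a nonzero code, so by
    [iterp_self] the root is reached within [s] steps. *)
Definition len := sval (seal (T := NN -> NN) (fun s => bmin s (fun k => iterp k s = cZ))).
Definition len_unlock : len = _ := svalP (seal _).
#[global] Instance D1_len : D1 len. Proof. by apply: D1_intro; rewrite len_unlock; def. Qed.

Lemma len_spec s : iterp (len s) s = cZ /\ forall i, lt i (len s) -> iterp i s <> cZ.
Proof.
have d : Dec (G := [:: N]) (fun e : env M [:: N] => iterp e.1 s = cZ) by dec.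
rewrite len_unlock; split=> [|i]; last exact: (@bmin_min M (fun k => iterp k s = cZ) d).
case: (EM (bmin s (fun k => iterp k s = cZ) = s)) => [->|ne]; first exact: iterp_self.
apply: (@bmin_true M (fun k => iterp k s = cZ) d); apply/nlt_neq; split=> //.
exact: (@bmin_le M (fun k => iterp k s = cZ) d).
Qed.

Lemma len_uniq s k : iterp k s = cZ -> (forall i, lt i k -> iterp i s <> cZ) -> len s = k.
Proof.
move=> h1 h2; have [k1 k2] := len_spec s; apply: nle_anti; apply/nlt_le => l.
  exact: k2 l h1.
exact: h2 l k1.
Qed.

Lemma len0 : len cZ = cZ.
Proof. by apply: len_uniq => [|i /nlt0 //]; rewrite iterp0. Qed.

Lemma len_snoc s x : len (snoc s x) = sc (len s).
Proof.
have [k1 k2] := len_spec s; apply: len_uniq; first by rewrite iterpSr par_snoc.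
move=> i; case: (nn_case i) => [->|[j ->]]; first by rewrite iterp0 => _; apply: snoc_neq0.
by rewrite iterpSr par_snoc => /nleSS /k2.
Qed.

(** Entries are counted from the root: dropping the last [len s - 1 - u] of them leaves entry [u] at
    the end. *)
Definition dig := sval (seal (T := NN -> NN -> NN) (fun s u => lst (iterp (sub (prd (len s)) u) s))).
Definition dig_unlock : dig = _ := svalP (seal _).
#[global] Instance D2_dig : D2 dig. Proof. by apply: D2_intro; rewrite dig_unlock; def. Qed.

Lemma dig_last s x : dig (snoc s x) (len s) = x.
Proof.
by rewrite dig_unlock len_snoc prdS (nle_refl (len s) : sub _ _ = cZ) iterp0 lst_snoc.
Qed.

Lemma dig_snoc s x u : lt u (len s) -> dig (snoc s x) u = dig s u.
Proof.
move=> /nleE [c e]; rewrite !dig_unlock len_snoc prdS e !naddSr prdS naddKr.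
by rewrite -naddrS naddKr iterpSr par_snoc.
Qed.

Lemma len_bar (g : RR) n : len (bar g n) = n.
Proof.
move: n; apply: nn_ind; first by dec.
  by rewrite bar0 len0.
by move=> n h; rewrite barS len_snoc h.
Qed.

Lemma dig_bar (g : RR) n u : lt u n -> dig (bar g n) u = g @ u.
Proof.
move: n; apply: nn_ind; first by dec.
  by move/nlt0.
move=> n h /nltS un; rewrite barS; case: (EM (u = n)) => [->|ne].
  by have := dig_last (bar g n) (g @ n); rewrite len_bar.
have l : lt u n by apply/nlt_neq.
by rewrite dig_snoc ?len_bar ?h.
Qed.

Definition digs (s : NN) : RR := LAM (fun u => dig s u).
Lemma digsE s u : digs s @ u = dig s u. Proof. by rewrite beta //; def. Qed.

Lemma bar_digs s n : le n (len s) -> bar (digs s) n = iterp (sub (len s) n) s.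
Proof.
move: n; apply: nn_ind; first by dec.
  by rewrite bar0 nsubr0 (len_spec s).1.
move=> n h nl; have [c e] := (nleE _ _).1 nl.
have e1 : sub (len s) (sc n) = c by rewrite e naddKr.
have e2 : sub (len s) n = sc c by rewrite e naddSr -naddrS naddKr.
rewrite barS h ?e2 ?e1; last exact: nltW.
have nz : iterp c s <> cZ.
  by apply: (len_spec s).2; rewrite e naddSr; apply/nltS/nle_addr.
by rewrite digsE dig_unlock e naddSr prdS naddKr iterpS snoc_eta.
Qed.

Lemma bar_len s : bar (digs s) (len s) = s.
Proof.
rewrite bar_digs; last exact: nle_refl.
by rewrite (nle_refl (len s) : sub _ _ = cZ) iterp0.
Qed.

(** * Separation *)

(** The tree consists of the binary sequences that respect all witnesses below their own length. At
    length [n], marking the [u] with a witness for [Q1] below [n] gives a node, and a path respects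
    every witness. *)
Lemma WKL_separation (Q1 Q0 : NN -> NN -> Prop) : @WKLm M -> P2 Q1 -> P2 Q0 ->
  (forall u t t', Q1 u t -> Q0 u t' -> False) ->
  exists b : RR, forall u, le (b @ u) o1 /\
    forall t, (Q1 u t -> b @ u = o1) /\ (Q0 u t -> b @ u = cZ).
Proof.
move=> wkl d1 d0 dis.
pose P (s : NN) := forall u, lt u (len s) -> le (dig s u) o1 /\
  forall t, lt t (len s) -> (Q1 u t -> dig s u = o1) /\ (Q0 u t -> dig s u = cZ).
have [T hT] : P1 P by apply: P1_intro; rewrite /P; dec.
have [|b hb] := wkl T.
  split=> [s x /hT h|n].
    split; last first.
      have [] := h (len s); first by rewrite len_snoc; apply: nltn_S.
      by rewrite dig_last.
    apply/hT => u us; have [|h1 h2] := h u; first by rewrite len_snoc; apply: nle_S.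
    rewrite dig_snoc // in h1 h2; split=> // t ts.
    by apply: h2; rewrite len_snoc; apply: nle_S.
  pose g : RR := LAM (fun u => cond (exists t, lt t n /\ Q1 u t) o1 cZ).
  have gE u : g @ u = cond (exists t, lt t n /\ Q1 u t) o1 cZ by rewrite beta //; def.
  exists (bar g n); split; first exact: le_bar.
  apply/hT => u; rewrite len_bar => un; rewrite dig_bar // gE.
  case: (EM (exists t, lt t n /\ Q1 u t)) => h; [rewrite condT //|rewrite condF //].
    split; first exact: nle_refl.
    by move=> t tn; split=> // q0; have [t' [_ q1]] := h; case: (dis _ _ _ q1 q0).
  split; first exact: nle0.
  by move=> t tn; split=> // q1; case: h; exists t.
exists b => u; pose n t := sc (add u t).
have hb' t : lt u (n t) /\ lt t (n t) by split; apply/nltS; [exact: nle_add|exact: nle_addr].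
have key t : le (b @ u) o1 /\ (Q1 u t -> b @ u = o1) /\ (Q0 u t -> b @ u = cZ).
  have /hT/(_ u) := hb (n t); rewrite len_bar dig_bar; last exact: (hb' t).1.
  by case=> [|h1 h2]; [exact: (hb' t).1|split=> //; apply: h2; exact: (hb' t).2].
by split=> [|t]; [exact: (key cZ).1|exact: (key t).2].
Qed.

End SequenceCodes.

(** * Unbounded usco functions in the presence of (∃²) *)

Section UscoBounded.
Context {M : model}.
Notation hM := (mrca M).
Notation NN := (car M N).
Notation RR := (car M t1).
Local Open Scope ring_scope.
Notation "n %:K" := (inN n) (at level 2, format "n %:K").

Lemma not_ler (x y : RR) : ~ ler x y -> ltr y x.
Proof. by move/contrapT. Qed.

Lemma in01_eqr (x y : RR) : isr x -> isr y -> eqr x y -> in01r x -> in01r y.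
Proof.
move=> rx ry [xy yx] [h0 h1]; split; last exact: (ler_tr ry rx real_oner).
exact: (ler_tr real_zeror rx ry).
Qed.

Lemma ltr_ball_l (x y : RR) : isr x -> isr y -> ltr x y ->
  exists n, forall z, isr z -> ballr x n z -> ltr z y.
Proof.
move=> rx ry /(rltP rx ry) [k [n h]]; exists (sc k) => z rz b.
apply/(rltP rz ry); exists (sc (sc k)), (add n (sc (sc (sc k)))) => m nm.
have /abs_lt[_] := ballr_elim m rx rz b; have := h m (nle_trans (nle_add _ _) nm).
have := eps_le (nle_trans (nle_addr _ _) nm); rewrite !epsS; have := eps_gt0 k; lra.
Qed.

Lemma ltr_ball_r (x y : RR) : isr x -> isr y -> ltr y x ->
  exists n, forall z, isr z -> ballr x n z -> ltr y z.
Proof.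
move=> rx ry /(rltP ry rx) [k [n h]]; exists (sc k) => z rz b.
apply/(rltP ry rz); exists (sc (sc k)), (add n (sc (sc (sc k)))) => m nm.
have /abs_lt[+ _] := ballr_elim m rx rz b; have := h m (nle_trans (nle_add _ _) nm).
have := eps_le (nle_trans (nle_addr _ _) nm); rewrite !epsS; have := eps_gt0 k; lra.
Qed.

Lemma ltr_addr_eps (x y : RR) : isr x -> isr y -> ltr x y ->
  exists k, ltr (addr x (ipow2r k)) y.
Proof.
move=> rx ry /(rltP rx ry) [k [n h]]; exists (sc k).
apply/(rltP (real_addr rx (real_constr _)) ry); exists (sc (sc k)), (add n (sc (sc (sc k)))) => m nm.
rewrite q_addr q_ipow2r; have := h m (nle_trans (nle_add _ _) nm).
have [_] := real_le2 rx (nle_S (nle_refl m)).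
have := eps_le (nle_trans (nle_addr _ _) nm); rewrite !epsS; have := eps_gt0 k; lra.
Qed.

Section Unbounded.
Variable f : car M (t1 ~> t1).
Hypotheses (hf : is01m f) (uf : uscom f) (nb : ~ boundm f).

Lemma unbounded_at n : exists x, isr x /\ in01r x /\ ltr (natr n) (f @ x).
Proof.
apply: contrapT => h; apply: nb; exists (natr n); split; first exact: real_natr.
by move=> x rx ix l; apply: h; exists x.
Qed.

Lemma unbounded_E2 : @ClCm M -> @E2m M -> False.
Proof.
move=> clc e2; have [E hE] := e2.
have d1 : P2 (@ltr M).
  have [h e] : D2 (fun x y : RR => E @ LAM (fun n => cond (ltrw n x y) cZ o1)).
    by apply: D2_intro; def.
  exists h => x y; rewrite e hE; split=> -[n hn]; exists n; move: hn; rewrite beta; try by def.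
    by move=> hn; rewrite condT.
  by case: (EM (ltrw n x y)) => // w; rewrite condF // => /(r_S0 hM).
have d2 : P2 (@ler M) by apply: P2_intro; rewrite /ler; dec.
have d3 : P1 (@in01r M) by apply: P1_intro; rewrite /in01r; dec.
pose C (n : NN) (x : RR) := in01r x /\ ler (natr n) (f @ x).
have dn : D1 (@natr M) by apply: D1_intro; rewrite /natr; def.
have [H hH] : D2 (fun n x => cond (C n x) oner zeror) by apply: D2_intro; rewrite /C; def.
have mE n x : memr x (H @ n) <-> C n x.
  rewrite /memr hH; case: (EM (C n x)) => c; [rewrite condT //|rewrite condF //]; split=> //.
    by move=> _; apply: ltr_constr; rewrite !toK_nat inN0 inN1 ltr01.
  by move/rltE => [m]; rewrite q_zeror; have := eps_gt0 m; lra.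
have [n|X hX] := clc H.
  split; last split.
  - split; first split.
    + by move=> x rx; rewrite hH; case: (EM (C n x)) => c; [rewrite condT|rewrite condF] => //;
        apply: real_constr.
    + move=> x rx y ry e; rewrite !hH.
      suff eC : C n x <-> C n y.
        case: (EM (C n x)) => c; [rewrite !condT|rewrite !condF]; try exact: eqr_refl;
          by rewrite ?eC // -?eC.
      suff imp u v : isr u -> isr v -> eqr u v -> C n u -> C n v.
        by split; apply: imp => //; apply: eqr_sym.
      move=> ru rv euv [iu l]; have iv := in01_eqr ru rv euv iu; split=> //.
      have [k _] := hf.2 _ ru _ rv iu iv euv.
      by apply: ler_tr l k; [exact: real_natr|exact: hf.1|exact: hf.1].
    (* Upper semi-continuity is available inside the unit interval only; a point outside it has a
       ball on one side of 0 or of 1, and no element of the set lies there. *)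
    + move=> x rx /mE nC; case: (EM (in01r x)) => ix.
        have [k hk] := ltr_addr_eps (hf.1 _ rx ix) (real_natr n) (not_ler (fun l => nC (conj ix l))).
        have [j hj] := uf rx ix k; exists j => y ry b /mE[iy l].
        have rs := real_addr (hf.1 _ rx ix) (real_constr (ipow2q k)).
        have l1 := hj y ry iy b; have ry' := hf.1 _ ry iy.
        exact: l (ltr_ler_tr ry' rs (real_natr n) l1 (ltr_ler rs (real_natr n) hk)).
      case: (EM (ler zeror x)) => h0; last first.
        have [j hj] := ltr_ball_l rx real_zeror (not_ler h0).
        by exists j => y ry /hj-/(_ ry) l /mE[[l' _] _].
      have h1 : ~ ler x oner by move=> h1; apply: ix.
      have [j hj] := ltr_ball_r rx real_oner (not_ler h1).
      by exists j => y ry /hj-/(_ ry) l /mE[[_ l'] _].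
  - by move=> x _ /mE[].
  - have [x [rx [ix l]]] := unbounded_at n; exists x; split=> //; apply/mE; split=> //.
    by apply: ltr_ler l; [exact: real_natr|exact: hf.1].
apply: (unbounded_sequence_contra (E2_ACA e2) hf uf (Y := X)) => n.
by have [rx /mE[ix l]] := hX n.
Qed.

End Unbounded.
End UscoBounded.

(** * Grilliot's trick *)

Section Grilliot.
Context {M : model}.
Notation hM := (mrca M).
Notation NN := (car M N).
Notation RR := (car M t1).
Local Open Scope ring_scope.
Notation "n %:K" := (inN n) (at level 2, format "n %:K").

Lemma nlt_trans (y x z : NN) : lt x y -> lt y z -> lt x z.
Proof. by move=> h /nltW; apply: nlt_le_trans. Qed.

Lemma eqr_close (x y : RR) : (forall n, `|q x n - q y n| <= 2 * eps n) -> eqr x y.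
Proof.
by move=> h; split; apply/rleE => n; have := h n; rewrite ler_norml => /andP[]; lra.
Qed.

Definition pt (m j : NN) : RR := constr (dy m j).
#[global] Instance D2_pt : D2 pt. Proof. by apply: D2_intro; rewrite /pt; def. Qed.
Lemma q_pt m j n : q (pt m j) n = m%:K * eps j.
Proof. by rewrite q_constr toK_dy. Qed.

Lemma in01_pt m j : lt m (pow2 j) -> in01r (pt m j).
Proof.
move=> /nltW l; have e0 := eps_gt0 j; have m0 := inN_ge0 m.
have : m%:K * eps j <= (pow2 j)%:K * eps j by rewrite ler_pM2r //; apply/inN_le.
rewrite pow2_eps => l1; have l0 : 0 <= m%:K * eps j by apply: mulr_ge0 => //; apply: ltW.
by split; apply/rleE => n; rewrite q_pt ?q_zeror ?q_oner; have := eps_gt0 n; lra.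
Qed.

Section Approx.
Variable y : RR.
Hypotheses (ry : isr y) (iy : in01r y).

(** Four extra levels turn the error [2 * eps (lev j)] of the approximation into [eps j / 8], which
    leaves room for the modulus of [y]. *)
Definition lev (j : NN) : NN := sc (sc (sc (sc j))).
(** The search stops at [2^(lev j) - 1], so that even [y = 1] is approximated by dyadic points below
    1, those for which binary digits after the point are defined later. *)
Definition apx (j : NN) : NN :=
  bmin (prd (pow2 (lev j))) (fun i => ltq (y @ sc (lev j)) (dy (sc i) (lev j))).

Lemma apx_lt j : lt (apx j) (pow2 (lev j)).
Proof.
have d : Dec (G := [:: N]) (fun e : env M [:: N] => ltq (y @ sc (lev j)) (dy (sc e.1) (lev j))) by dec.
apply: nle_lt_trans (@bmin_le M (fun i => ltq (y @ sc (lev j)) (dy (sc i) (lev j))) d _) _.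
case: (nn_case (pow2 (lev j))) => [/pow2_neq0 //|[k ->]]; rewrite prdS; exact: nltn_S.
Qed.

Lemma apx_close j : `|(apx j)%:K * eps (lev j) - q y (sc (lev j))| <= 2 * eps (lev j).
Proof.
pose P i := ltq (y @ sc (lev j)) (dy (sc i) (lev j)).
have d : Dec (G := [:: N]) (fun e : env M [:: N] => P e.1) by rewrite /P; dec.
have PE i : P i <-> q y (sc (lev j)) < (sc i)%:K * eps (lev j) by rewrite /P ltqE toK_dy.
have [h0 h1] := iy; have /rleE/(_ (sc (lev j))) := h0; have /rleE/(_ (sc (lev j))) := h1.
rewrite q_zeror q_oner [X in 2 * X]epsS => l1 l0; have e0 := eps_gt0 (lev j).
rewrite ler_norml; apply/andP; split.
  case: (EM (lt (apx j) (prd (pow2 (lev j))))) => h.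
    have := @bmin_true M P d _ h; rewrite PE -/(apx j) inNS mulrDl; lra.
  have e : apx j = prd (pow2 (lev j)).
    by apply: nle_anti; [apply: (@bmin_le M P d)|apply/nlt_le].
  have : (sc (apx j))%:K * eps (lev j) = 1.
    rewrite e; case: (nn_case (pow2 (lev j))) => [/pow2_neq0 //|[k ek]].
    by rewrite ek prdS -ek pow2_eps.
  rewrite inNS mulrDl; lra.
case: (nn_case (apx j)) => [->|[i e]]; first by rewrite inN0; lra.
have : ~ P i by apply: (@bmin_min M P d (prd (pow2 (lev j)))); rewrite -/(apx j) e; apply: nltn_S.
rewrite PE -e => /negP; rewrite -leNgt; lra.
Qed.
End Approx.

(* If [f] jumps at [y] from its values at the dyadic approximations of [y], then
   following these approximations until a zero of [g] is found decides whether there is one. *)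
Lemma grilliot (f : car M (t1 ~> t1)) n : is01m f ->
  (exists y, isr y /\ in01r y /\ ltr (natr (sc n)) (f @ y)) ->
  (forall m j, lt m (pow2 j) -> ler (f @ pt m j) (natr n)) -> @E2m M.
Proof.
move=> hf [y [ry [iy fy]]] fd.
pose fz (g : RR) j := bmin j (fun i => g @ i = cZ).
have dfz : D2 fz by apply: D2_intro; rewrite /fz; def.
have dapx : D1 (apx y) by apply: D1_intro; rewrite /apx /lev; def.
have dlev : D1 lev by apply: D1_intro; rewrite /lev; def.
pose yg (g : RR) : RR := LAM (fun j => dy (apx y (fz g j)) (lev (fz g j))).
have dyg : D1 yg by apply: D1_intro; rewrite /yg; def.
pose D j := (apx y j)%:K * eps (lev j).
have qyg g j : q (yg g) j = D (fz g j).
  by rewrite /q /yg beta ?toK_dy //; def.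
have dg (g : RR) : Dec (G := [:: N]) (fun e : env M [:: N] => g @ e.1 = cZ) by dec.
have fz_cases g j i : le j i -> fz g j = j /\ le j (fz g i) \/ fz g i = fz g j.
  move=> ji; have [k1 k2] : le (fz g j) j /\ le (fz g i) i.
    by split; apply: (@bmin_le M (fun i => g @ i = cZ) (dg g)).
  case: (EM (lt (fz g j) j)) => h; [right|left].
    have z := @bmin_true M (fun i => g @ i = cZ) (dg g) j h.
    apply: nle_anti.
      exact: (@bmin_ex M (fun i => g @ i = cZ) (dg g) i _ (nlt_le_trans h ji) z).2.2.
    apply/nlt_le => l; have z' := @bmin_true M (fun i => g @ i = cZ) (dg g) i
      (nlt_trans l (nlt_le_trans h ji)).
    exact: (@bmin_min M (fun i => g @ i = cZ) (dg g) j _ l z').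
  have e : fz g j = j by apply: nle_anti => //; apply/nlt_le.
  split=> //; apply/nlt_le => l.
  have z' := @bmin_true M (fun i => g @ i = cZ) (dg g) i (nlt_le_trans l ji).
  by apply: (@bmin_min M (fun i => g @ i = cZ) (dg g) j (fz g i)) => //; rewrite -/(fz g j) e.
have Dy j : q y (sc (lev j)) - eps j / 8 <= D j <= q y (sc (lev j)) + eps j / 8.
  have := apx_close iy j; rewrite ler_norml -/(D j) => /andP[].
  by rewrite /lev !epsS => ??; apply/andP; split; lra.
have DD j i : le j i -> `|D j - D i| < eps j.
  move=> ji; have /andP[??] := Dy j; have /andP[??] := Dy i.
  have ji' : le (sc (lev j)) (sc (lev i)) by rewrite !nleSS.
  have [] := real_le2 ry ji'; have := eps_le ji; have := eps_gt0 j.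
  rewrite {3 4}/lev !epsS => ????; apply/abs_lt; split; lra.
have ryg g : isr (yg g).
  apply/isrE => j i; rewrite !qyg; case: (fz_cases g j _ (nle_add j i)) => [[-> l]|->].
    exact: DD.
  by rewrite subrr normr0 eps_gt0.
have yg_zero g z : g @ z = cZ -> exists m j, lt m (pow2 j) /\ eqr (yg g) (pt m j).
  move=> gz; pose z0 := fz g (sc z); exists (apx y z0), (lev z0); split; first exact: apx_lt.
  apply: eqr_close => j; rewrite qyg q_pt -/(D z0).
  have [l0 [gz0 _]] := @bmin_ex M (fun i => g @ i = cZ) (dg g) (sc z) z (nltn_S z) gz.
  rewrite -/(fz g (sc z)) -/z0 in l0 gz0.
  case: (nle_total j (sc z)) => l; last first.
    case: (fz_cases g _ _ l) => [[e _]|->]; first by move: l0; rewrite {1}/z0 e => /nlt_irr.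
    by rewrite subrr normr0; have := eps_gt0 j; lra.
  case: (fz_cases g _ _ l) => [[-> l']|<-].
    by have := DD _ _ l'; have := eps_gt0 j; lra.
  by rewrite subrr normr0; have := eps_gt0 j; lra.
have yg_nozero g : (forall z, g @ z <> cZ) -> eqr (yg g) y.
  move=> nz; apply: eqr_close => j; rewrite qyg.
  have -> : fz g j = j.
    apply: nle_anti; first exact: (@bmin_le M (fun i => g @ i = cZ) (dg g)).
    by apply/nlt_le => /(@bmin_true M (fun i => g @ i = cZ) (dg g)); apply: nz.
  have /andP[??] := Dy j; have lj : le j (sc (lev j)) by rewrite /lev; do 5 apply: nle_S; apply: nle_refl.
  have [] := real_le2 ry lj; have := eps_gt0 j => ???.
  by rewrite ler_norml; apply/andP; split; lra.
(* The threshold [n + 1/2] separates the values up to [n] at dyadic points from the value above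
   [n + 1] at [y]; the approximation of index [lev cZ] is fine enough to tell them apart. *)
pose c := frq (sc (add n n)) cZ (pow2 o1).
have qc : toK c = n%:K + 1 / 2.
  rewrite -/(dy _ _) toK_dy epsS eps0 inNS inND; lra.
have [E hE] : D1 (fun g => cond (ltq ((f @ yg g) @ lev cZ) c) cZ o1).
  by apply: D1_intro; def.
exists E => g; rewrite hE.
case: (EM (exists z, g @ z = cZ)) => [[z gz]|nz].
  have [m [j [mj e]]] := yg_zero g z gz; have ip := in01_pt mj.
  have iyg := in01_eqr (real_constr _) (ryg g) (eqr_sym e) ip.
  have [l _] := hf.2 _ (ryg g) _ (real_constr _) iyg ip e.
  have rf1 := hf.1 _ (ryg g) iyg; have rf2 := hf.1 _ (real_constr _) ip.
  have := ler_tr rf1 rf2 (real_natr n) l (fd _ _ mj) => /rleE/(_ (lev cZ)).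
  rewrite q_natr => l2; rewrite condT; first by split=> // _; exists z.
  by rewrite ltqE qc; move: l2; rewrite /q /lev !epsS eps0; lra.
have e : eqr (yg g) y by apply: yg_nozero => z gz; apply: nz; exists z.
have iyg := in01_eqr ry (ryg g) (eqr_sym e) iy.
have [_ l] := hf.2 _ (ryg g) _ ry iyg iy e.
have rf1 := hf.1 _ (ryg g) iyg; have rf2 := hf.1 _ ry iy.
have := ltr_ler_tr (real_natr (sc n)) rf2 rf1 fy l.
move=> /(ltr_ler (real_natr (sc n)) rf1)/rleE/(_ (lev cZ)); rewrite q_natr inNS => l2.
rewrite condF; first by split=> [/(r_S0 hM) //|/nz].
by rewrite ltqE qc; move: l2; rewrite /q /lev !epsS eps0; lra.
Qed.

End Grilliot.

(** * From weak König's lemma and an unbounded function to arithmetical comprehension *)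

Section WeakKoenig.
Context {M : model}.
Notation hM := (mrca M).
Notation NN := (car M N).
Notation RR := (car M t1).
Local Open Scope ring_scope.
Notation "n %:K" := (inN n) (at level 2, format "n %:K").

(** The axiom chooses numbers for functions; here a number is represented by the constant function
    with that value. *)
Lemma number_choice (R : NN -> NN -> Prop) : P2 R -> (forall n, exists m, R n m) ->
  exists g : RR, forall n, R n (g @ n).
Proof.
move=> [h hR] ex; have [P hP] : D2 (fun (f : RR) m => h @ (f @ cZ) @ m) by apply: D2_intro; def.
have [f|F hF] := @r_ac _ hM P.
  by have [m /hR hm] := ex (f @ cZ); exists m; rewrite hP.
exists (LAM (fun n => F @ LAM (fun _ => n))) => n; rewrite beta; last by def.
by apply/hR; have := hF (LAM (fun _ => n)); rewrite hP beta //; def.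
Qed.

Lemma first_witness (R : NN -> NN -> Prop) c t : P2 R -> R c t ->
  exists t0, R c t0 /\ forall t', lt t' t0 -> ~ R c t'.
Proof.
move=> dR h; have d : Dec (G := [:: N]) (fun e : env M [:: N] => R c e.1) by dec.
have [_ [h1 _]] := @bmin_ex M (fun i => R c i) d (sc t) t (nltn_S t) h.
by exists (bmin (sc t) (fun i => R c i)); split=> // t'; apply: (@bmin_min M (fun i => R c i) d).
Qed.

Section Expansion.

(** The integer part of [m * 2^l / 2^j], that is, the first [l] binary digits of [m / 2^j] read as a
    number. *)
Definition flr := sval (seal (T := NN -> NN -> NN -> NN) (fun m j l =>
  bmin (pow2 l) (fun i => lt (mul m (pow2 l)) (mul (sc i) (pow2 j))))).
Definition flr_unlock : flr = _ := svalP (seal _).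
#[global] Instance D3_flr : D3 flr. Proof. by apply: D3_intro; rewrite flr_unlock; def. Qed.

Lemma flrP m j l : lt m (pow2 j) ->
  (flr m j l)%:K * eps l <= m%:K * eps j < (flr m j l)%:K * eps l + eps l.
Proof.
move=> mj; pose P i := lt (mul m (pow2 l)) (mul (sc i) (pow2 j)).
have d : Dec (G := [:: N]) (fun e : env M [:: N] => P e.1) by rewrite /P; dec.
have pl := pow2_pos l; have pj := pow2_pos j; have el := pow2_eps l; have ej := pow2_eps j.
have el0 := eps_gt0 l; have ej0 := eps_gt0 j.
have PE i : P i <-> m%:K * eps j < i%:K * eps l + eps l.
  have -> : i%:K * eps l + eps l = (sc i)%:K * eps l by rewrite inNS mulrDl mul1r.
  rewrite /P -inN_lt !inNM -(ltr_pM2r (mulr_gt0 el0 ej0)).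
  have -> : m%:K * (pow2 l)%:K * (eps l * eps j) = m%:K * eps j.
    by rewrite -mulrA (mulrA (pow2 l)%:K) el mul1r.
  suff -> : (sc i)%:K * (pow2 j)%:K * (eps l * eps j) = (sc i)%:K * eps l by [].
  by rewrite -mulrA (mulrCA (pow2 j)%:K) ej mulr1.
have [k ek] : exists k, pow2 l = sc k.
  by case: (nn_case (pow2 l)) => [/pow2_neq0 //|]; exact.
have Pk : P k.
  have e1 : k%:K * eps l + eps l = 1 by rewrite -el ek inNS mulrDl mul1r.
  apply/PE; rewrite e1 -ej ltr_pM2r //; exact/inN_lt.
have [_ [h _]] := @bmin_ex M P d (pow2 l) k ltac:(by rewrite ek; apply: nltn_S) Pk.
have e : flr m j l = bmin (pow2 l) P by rewrite flr_unlock.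
rewrite -e in h; apply/andP; split; last exact/PE.
case: (nn_case (flr m j l)) => [->|[i ei]].
  by rewrite inN0 mul0r; apply: mulr_ge0; [exact: inN_ge0|exact: ltW].
have : ~ P i by apply: (@bmin_min M P d (pow2 l)); rewrite -e ei; apply: nltn_S.
by rewrite PE ei inNS mulrDl mul1r => /negP; rewrite -leNgt.
Qed.

Definition bit (m j l : NN) : NN := sub (flr m j (sc l)) (add (flr m j l) (flr m j l)).
#[global] Instance D3_bit : D3 bit. Proof. by apply: D3_intro; rewrite /bit; def. Qed.

Lemma lt_of_eps (a b l : NN) : a%:K * eps l < b%:K * eps l -> lt a b.
Proof. by rewrite ltr_pM2r ?eps_gt0 // inN_lt. Qed.

Lemma flrS m j l : lt m (pow2 j) ->
  flr m j (sc l) = add (add (flr m j l) (flr m j l)) (bit m j l) /\ (bit m j l = cZ \/ bit m j l = o1).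
Proof.
move=> mj; have /andP[] := flrP l mj; have /andP[] := flrP (sc l) mj; rewrite /bit.
set F := flr m j l; set F' := flr m j (sc l); have e : eps l = 2 * eps (sc l) by rewrite epsS; lra.
rewrite e => h1 h2 h3 h4.
have l1 : lt (add F F) (sc F').
  by apply: (@lt_of_eps _ _ (sc l)); rewrite inNS inND !mulrDl; lra.
have l2 : lt F' (sc (sc (add F F))).
  by apply: (@lt_of_eps _ _ (sc l)); rewrite !inNS inND !mulrDl; lra.
have /nleE[c ec] := (nltS _ _).1 l1; rewrite ec naddKr; split=> //.
have : le c o1.
  by move: l2 => /nltS/inN_le; rewrite ec inND inNS inND => h; apply/inN_le; rewrite inN1; lra.
by rewrite /o1 => /nleS_cases[/nle_n0|]; [left|right].
Qed.

Lemma flr0 m j : lt m (pow2 j) -> flr m j cZ = cZ.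
Proof.
move=> mj; apply: nle_n0; apply/nltS; apply: (@lt_of_eps _ _ j).
have /andP[h _] := flrP cZ mj; rewrite inNS inN0 add0r mul1r.
have : m%:K * eps j < 1 by rewrite -(pow2_eps j) ltr_pM2r ?eps_gt0 // inN_lt.
move: h; rewrite eps0 mulr1 => h h'.
have l1 : lt (flr m j cZ) o1 by apply/inN_lt; rewrite inN1; lra.
have -> : flr m j cZ = cZ by apply: nle_n0; apply/nltS.
by rewrite inN0 mul0r eps_gt0.
Qed.
End Expansion.

(** * Reals from binary digits *)

(** The first [l] digits of row [c] of [b], read in binary. One function carries the digits of all
    the reals, because weak König's lemma yields a single path. *)
Definition bval := sval (seal (T := RR -> NN -> NN -> NN) (fun b c l =>
  recf (fun i r => add (add r r) (b @ pairn c i)) cZ l)).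
Definition bval_unlock : bval = _ := svalP (seal _).
#[global] Instance D3_bval : D3 bval. Proof. by apply: D3_intro; rewrite bval_unlock; def. Qed.

Lemma bval0 b c : bval b c cZ = cZ. Proof. by rewrite bval_unlock recf0. Qed.
Lemma bvalS b c l : bval b c (sc l) = add (add (bval b c l) (bval b c l)) (b @ pairn c l).
Proof. by rewrite bval_unlock recfS //; def. Qed.

Section Digits.
Variable b : RR.
Hypothesis hb : forall u, le (b @ u) o1.

Lemma bval_add c n i : le (mul (bval b c n) (pow2 i)) (bval b c (add n i)) /\
  lt (bval b c (add n i)) (mul (sc (bval b c n)) (pow2 i)).
Proof.
move: i; apply: nn_ind; first by dec.
  by rewrite naddr0 pow2_0 !(nmulrC _ o1) !nmul1r; split; [exact: nle_refl|exact: nltn_S].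
move=> i [/inN_le h1 /nlt_leS h2]; have /inN_le := hb (pairn c (add n i)); rewrite inN1 => h3.
have h0 := inN_ge0 (b @ pairn c (add n i)).
rewrite naddrS bvalS pow2S; split.
  by apply/inN_le; move: h1; rewrite !(inND, inNM); lra.
by apply/nlt_leS; move: h2; rewrite !(inND, inNM, inNS); lra.
Qed.

Definition breal c : RR := LAM (fun l => dy (bval b c l) l).
Lemma q_breal c l : q (breal c) l = (bval b c l)%:K * eps l.
Proof. by rewrite /q /breal beta ?toK_dy //; def. Qed.

Lemma real_breal c : isr (breal c).
Proof.
apply/isrE => n i; rewrite !q_breal epsD.
have [/inN_le h1 /inN_lt h2] := bval_add c n i; have e0 := eps_gt0 n; have i0 := eps_gt0 i.
move: h1 h2; rewrite !inNM inNS -(ler_pM2r i0) -(ltr_pM2r i0) -!mulrA pow2_eps !mulr1.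
rewrite -(ler_pM2r e0) -(ltr_pM2r e0) -!mulrA (mulrC (eps i)) mulrDl mul1r => h1 h2.
by apply/abs_lt; split; lra.
Qed.

Lemma in01_breal c : in01r (breal c).
Proof.
split; apply/rleE => n; rewrite q_breal ?q_zeror ?q_oner; have e0 := eps_gt0 n.
  have : 0 <= (bval b c n)%:K * eps n by apply: mulr_ge0; [exact: inN_ge0|exact: ltW].
  lra.
have [_] := bval_add c cZ n; rewrite nadd0r bval0 -/o1 nmul1r => /inN_lt.
by rewrite -(ltr_pM2r e0) pow2_eps; lra.
Qed.

Lemma breal_pt c m j : lt m (pow2 j) -> (forall i, b @ pairn c i = bit m j i) ->
  eqr (breal c) (pt m j).
Proof.
move=> mj hbit; have e l : bval b c l = flr m j l.
  move: l; apply: nn_ind; first by dec.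
    by rewrite bval0 flr0.
  by move=> l h; rewrite bvalS h hbit (flrS l mj).1.
apply: eqr_close => l; rewrite q_breal q_pt e.
have /andP[??] := flrP l mj; have := eps_gt0 l => ?.
by rewrite ler_norml; apply/andP; split; lra.
Qed.
End Digits.

(* If [c] first satisfies [R c t] at [t], the digits of the real with index [c] are
   prescribed to be those of [pt (mm t) (jj t)], where [f] exceeds [t]; so the value of
   [f] at that real bounds the search for [t]. *)
Lemma WKL_unbounded_ACA (f : car M (t1 ~> t1)) (mm jj : RR) : @WKLm M -> is01m f ->
  (forall n, lt (mm @ n) (pow2 (jj @ n)) /\ ler (natr n) (f @ pt (mm @ n) (jj @ n))) ->
  @ACAm M.
Proof.
move=> wkl hf hp h.
pose R c t := h @ c @ t = cZ; have dR : P2 R by apply: P2_intro; rewrite /R; dec.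
(* Only the first witness prescribes digits; two witnesses could prescribe different ones, and then
   [Q1] and [Q0] would not be disjoint. *)
pose R0 c t := R c t /\ forall t', lt t' t -> ~ R c t'.
have dR0 : P2 R0 by apply: P2_intro; rewrite /R0; dec.
pose Q1 u t := R0 (fstn u) t /\ bit (mm @ t) (jj @ t) (sndn u) = o1.
pose Q0 u t := R0 (fstn u) t /\ bit (mm @ t) (jj @ t) (sndn u) = cZ.
have d1 : P2 Q1 by apply: P2_intro; rewrite /Q1; dec.
have d0 : P2 Q0 by apply: P2_intro; rewrite /Q0; dec.
have uniq c t t' : R0 c t -> R0 c t' -> t = t'.
  move=> [r k] [r' k']; apply: nle_anti; apply/nlt_le => l; [exact: k l r'|exact: k' l r].
have [|b hb] := WKL_separation wkl d1 d0.
  move=> u t t' [r e] [r' e']; rewrite (uniq _ _ _ r r') e' in e.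
  exact: (r_S0 hM (esym e)).
have hb1 u := (hb u).1.
have key c t : R0 c t -> ler (natr t) (f @ breal b c).
  move=> r; have [mj l] := hp t.
  have e : eqr (breal b c) (pt (mm @ t) (jj @ t)).
    apply: breal_pt => // i; have [_ /(_ t)[q1 q0]] := hb (pairn c i).
    case: (flrS i mj) => _ [e|e]; rewrite e; [apply: q0|apply: q1];
      by split; rewrite ?fstn_pair ?sndn_pair.
  have rb := real_breal hb1 c; have ib := in01_breal hb1 c; have ip := in01_pt mj.
  have [_ l'] := hf.2 _ rb _ (real_constr _) ib ip e.
  exact: ler_tr (real_natr t) (hf.1 _ (real_constr _) ip) (hf.1 _ rb ib) l l'.
have db : D1 (breal b) by apply: D1_intro; rewrite /breal; def.
(* The denominator is at least 1, so the positive part of the numerator bounds the approximation of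
   index 0; the 3 exceeds the error 2 of a comparison at that index. *)
pose v c := add (posq ((f @ breal b c) @ cZ)) (sc (sc o1)).
have [p hv] : D1 (fun c => cond (exists t, lt t (v c) /\ R c t) cZ o1).
  by apply: D1_intro; rewrite /v; def.
exists p => c; rewrite hv; case: (EM (exists t, lt t (v c) /\ R c t)) => k.
  by rewrite condT //; split=> // _; case: k => t [_ r]; exists t.
rewrite condF //; split=> [/(r_S0 hM) //|[t r]]; case: k.
have [t0 r0] := first_witness dR r; exists t0; split; last by case: r0.
apply/inN_lt; have /rleE/(_ cZ) := key c t0 r0; rewrite q_natr eps0 /v inND !inNS inN0 /q toKE.
have d1' : 1 <= (denq ((f @ breal b c) @ cZ))%:K.
  by rewrite denq_unlock inNS; have := inN_ge0 (sndn ((f @ breal b c) @ cZ)); lra.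
set P := (posq _)%:K; set Nq := (negq _)%:K; set D := (denq _)%:K in d1' *.
have : (P - Nq) / D <= P.
  rewrite ler_pdivrMr; last by lra.
  have := inN_ge0 (posq ((f @ breal b c) @ cZ)); have := inN_ge0 (negq ((f @ breal b c) @ cZ)).
  rewrite -/P -/Nq; nra.
lra.
Qed.

Lemma WKL_UB : @ClCm M -> @WKLm M -> @UBm M.
Proof.
move=> clc wkl f hf uf; apply: contrapT => nb.
case: (EM (@E2m M)) => [e2|ne2]; first exact: (unbounded_E2 hf uf nb clc e2).
(* Otherwise [f] is at most [n] at all dyadic points but above [n + 1] somewhere, and Grilliot's
   trick produces (∃²). *)
have ex n : exists m, exists j, lt m (pow2 j) /\ ltr (natr n) (f @ pt m j).
  apply: contrapT => h; apply: ne2; apply: (grilliot hf (unbounded_at nb (sc n))) => m j mj.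
  by move=> l; apply: h; exists m, j.
have dn : D1 (@natr M) by apply: D1_intro; rewrite /natr; def.
pose R n w := lt (fstn (fstn w)) (pow2 (sndn (fstn w))) /\
  ltrw (sndn w) (natr n) (f @ pt (fstn (fstn w)) (sndn (fstn w))).
have dR : P2 R by apply: P2_intro; rewrite /R; dec.
have [n|g hg] := number_choice dR.
  have [m [j [mj [k hk]]]] := ex n; exists (pairn (pairn m j) k).
  by rewrite /R !(fstn_pair, sndn_pair).
pose mm : RR := LAM (fun n => fstn (fstn (g @ n))); pose jj : RR := LAM (fun n => sndn (fstn (g @ n))).
have mE n : mm @ n = fstn (fstn (g @ n)) by rewrite beta //; def.
have jE n : jj @ n = sndn (fstn (g @ n)) by rewrite beta //; def.
have hp n : lt (mm @ n) (pow2 (jj @ n)) /\ ler (natr n) (f @ pt (mm @ n) (jj @ n)).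
  rewrite mE jE; have [mj l] := hg n; split=> //.
  apply: ltr_ler; [exact: real_natr|apply: hf.1; [exact: real_constr|exact: in01_pt]|].
  by exists (sndn (g @ n)).
have aca := WKL_unbounded_ACA wkl hf hp.
have [Y hY] : D1 (fun n => pt (mm @ n) (jj @ n)) by apply: D1_intro; def.
apply: (unbounded_sequence_contra aca hf uf (Y := Y)) => n; rewrite hY.
by have [mj l] := hp n; split; [exact: real_constr|split=> //; exact: in01_pt].
Qed.

End WeakKoenig.

(** * Definable rational functions *)

Section RationalFunctions.
Context {M : model}.
Notation hM := (mrca M).
Notation NN := (car M N).
Notation RR := (car M t1).
Local Open Scope ring_scope.
Notation "n %:K" := (inN n) (at level 2, format "n %:K").

(** The field is not a type of the model, so definability of a rational-valued function means that
    codes of its values are definable; comparisons of such functions are decidable. *)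
Definition DefK G (f : env M G -> K M) :=
  exists c : env M G -> NN, Def c /\ forall g, toK (c g) = f g.

Lemma DefK_toK G (c : env M G -> NN) : Def c -> DefK (fun g => toK (c g)).
Proof. by move=> d; exists c. Qed.
Lemma DefK_inN G (c : env M G -> NN) : Def c -> DefK (fun g => (c g)%:K).
Proof. by move=> d; exists (fun g => natq (c g)); split=> [|g]; [exact: Def_op1 d|rewrite toK_nat]. Qed.
Lemma DefK_eps G (c : env M G -> NN) : Def c -> DefK (fun g => eps (c g)).
Proof. by move=> d; exists (fun g => ipow2q (c g)); split=> [|g]; [exact: Def_op1 d|rewrite toK_ipow2]. Qed.
Lemma DefK_nat G (n : nat) : @DefK G (fun _ => n%:R).
Proof.
exists (fun _ => natq (iter n sc cZ)); split=> [|g]; first by def.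
by rewrite toK_nat; elim: n => [|n /= IH]; rewrite ?inN0 // inNS IH -natr1.
Qed.
Lemma DefK_one G : @DefK G (fun _ => 1). Proof. exact: (@DefK_nat G 1). Qed.
Lemma DefK_zero G : @DefK G (fun _ => 0). Proof. exact: (@DefK_nat G 0). Qed.
Lemma DefK_add G (f h : env M G -> K M) : DefK f -> DefK h -> DefK (fun g => f g + h g).
Proof.
by move=> [c [dc ec]] [d [dd ed]]; exists (fun g => addq (c g) (d g)); split=> [|g];
  [exact: Def_op2 dc dd|rewrite toK_add ec ed].
Qed.
Lemma DefK_opp G (f : env M G -> K M) : DefK f -> DefK (fun g => - f g).
Proof.
by move=> [c [dc ec]]; exists (fun g => oppq (c g)); split=> [|g]; [exact: Def_op1 dc|rewrite toK_opp ec].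
Qed.
Lemma DefK_abs G (f : env M G -> K M) : DefK f -> DefK (fun g => `|f g|).
Proof.
by move=> [c [dc ec]]; exists (fun g => absq (c g)); split=> [|g]; [exact: Def_op1 dc|rewrite toK_abs ec].
Qed.

Definition mulq (c e : NN) := frq (add (mul (posq c) (posq e)) (mul (negq c) (negq e)))
  (add (mul (posq c) (negq e)) (mul (negq c) (posq e))) (mul (denq c) (denq e)).
#[global] Instance D2_mulq : D2 mulq. Proof. by apply: D2_intro; rewrite /mulq; def. Qed.
Lemma toK_mul c e : toK (mulq c e) = toK c * toK e.
Proof.
rewrite toK_frq; last by rewrite !denq_unlock; apply: mul_sc_neq0.
rewrite !toKE !(inND, inNM) mulf_div; congr (_ / _); ring.
Qed.
Lemma DefK_mul G (f h : env M G -> K M) : DefK f -> DefK h -> DefK (fun g => f g * h g).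
Proof.
by move=> [c [dc ec]] [d [dd ed]]; exists (fun g => mulq (c g) (d g)); split=> [|g];
  [exact: Def_op2 dc dd|rewrite toK_mul ec ed].
Qed.

Lemma Dec_Klt G (f h : env M G -> K M) : DefK f -> DefK h -> Dec (fun g => f g < h g).
Proof.
move=> [c [dc ec]] [d [dd ed]]; apply: (Dec_ext (P := fun g => ltq (c g) (d g))).
  by move=> g; rewrite ltqE ec ed.
exact: Dec_op2 dc dd.
Qed.
Lemma Dec_Kle G (f h : env M G -> K M) : DefK f -> DefK h -> Dec (fun g => f g <= h g).
Proof.
move=> df dh; apply: Dec_ext (Dec_not (Dec_Klt dh df)) => g.
by rewrite leNgt; split=> /negP.
Qed.
End RationalFunctions.

Ltac defk :=
  cbv beta;
  lazymatch goal with
  | |- DefK (fun g => toK (@?c g)) => apply (@DefK_toK _ _ c); def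
  | |- DefK (fun g => inN (@?c g)) => apply (@DefK_inN _ _ c); def
  | |- DefK (fun g => eps (@?c g)) => apply (@DefK_eps _ _ c); def
  | |- DefK (fun _ => (_ *+ ?n)%R) => exact (@DefK_nat _ _ n)
  | |- DefK (fun g => GRing.add (@?a g) (@?b g)) => apply (@DefK_add _ _ a b); defk
  | |- DefK (fun g => GRing.mul (@?a g) (@?b g)) => apply (@DefK_mul _ _ a b); defk
  | |- DefK (fun g => GRing.opp (@?a g)) => apply (@DefK_opp _ _ a); defk
  | |- DefK (fun g => Num.norm (@?a g)) => apply (@DefK_abs _ _ a); defk
  | |- DefK (fun _ => @GRing.one _) => exact (@DefK_one _ _)
  | |- DefK (fun _ => @GRing.zero _) => exact (@DefK_zero _ _)
  end.
Ltac dec_K :=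
  lazymatch goal with
  | |- Dec (fun g => is_true (Order.le (@?a g) (@?b g))) => apply (@Dec_Kle _ _ a b); defk
  | |- Dec (fun g => is_true (Order.lt (@?a g) (@?b g))) => apply (@Dec_Klt _ _ a b); defk
  end.
Ltac dec_hook ::= dec_K.

(** * Intervals attached to the nodes of a binary tree, and their tents *)

Section Tents.
Context {M : model}.
Notation hM := (mrca M).
Notation NN := (car M N).
Notation RR := (car M t1).
Local Open Scope ring_scope.
Notation "n %:K" := (inN n) (at level 2, format "n %:K").

Definition numer := sval (seal (T := RR -> NN -> NN) (fun g n =>
  recf (fun i r => add (add (add r r) (add r r)) (add (g @ i) (g @ i))) cZ n)).
Definition numer_unlock : numer = _ := svalP (seal _).
#[global] Instance D2_numer : D2 numer. Proof. by apply: D2_intro; rewrite numer_unlock; def. Qed.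

(* The point with digits [2 g(0), ..., 2 g(n-1)] in base 4, and the length [4^-n]. *)
Definition cen g n := dy (numer g n) (add n n).
#[global] Instance D2_cen : D2 cen. Proof. by apply: D2_intro; rewrite /cen; def. Qed.
Definition wid (n : NN) : K M := eps (add n n).

Lemma wid0 : wid cZ = 1. Proof. by rewrite /wid naddr0 eps0. Qed.
Lemma widS n : wid (sc n) = wid n / 4.
Proof. by rewrite /wid naddSr naddrS !epsS; lra. Qed.
Lemma wid_gt0 n : 0 < wid n. Proof. exact: eps_gt0. Qed.
Lemma cen0 g : toK (cen g cZ) = 0.
Proof. by rewrite toK_dy numer_unlock recf0 inN0 mul0r. Qed.
Lemma cenS g n : toK (cen g (sc n)) = toK (cen g n) + (g @ n)%:K * wid n / 2.
Proof.
rewrite !toK_dy -!/(wid _) widS numer_unlock recfS; last by def.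
by rewrite !inND; field.
Qed.

Lemma cen_ext g g' n : (forall i, lt i n -> g @ i = g' @ i) -> toK (cen g n) = toK (cen g' n).
Proof.
move=> h; rewrite !toK_dy; congr (inN _ * _).
suff: forall m, le m n -> numer g m = numer g' m by apply; apply: nle_refl.
apply: nn_ind; first by dec.
  by rewrite numer_unlock !recf0.
move=> m IH mn; move: (IH (nltW mn)); rewrite numer_unlock !recfS ?h //; try by def.
by move=> ->.
Qed.

(** Base-4 digits up to 2 after place [n] add at most the geometric tail [2/3 * 4^-n]. This is less
    than the radius [wid n], while different centres of level [n] are at least [2 * wid n] apart. *)
Lemma cen_drift g n d : (forall i, lt i (add n d) -> le (g @ i) o1) ->
  0 <= toK (cen g (add n d)) - toK (cen g n) /\
  toK (cen g (add n d)) - toK (cen g n) <= 2 / 3 * (wid n - wid (add n d)).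
Proof.
move=> h.
suff: forall m, le m d -> 0 <= toK (cen g (add n m)) - toK (cen g n) /\
    3 * (toK (cen g (add n m)) - toK (cen g n)) <= 2 * (eps (add n n) - eps (add (add n m) (add n m))).
  by move=> /(_ d (nle_refl d)) []; rewrite -!/(wid _); split=> //; lra.
apply: nn_ind; first by dec.
  by rewrite !naddr0; split; lra.
move=> m IH md; have [] := IH (nltW md); rewrite -!/(wid _) !naddrS cenS widS.
have /inN_le : le (g @ add n m) o1.
  by apply: h; apply/inN_lt; rewrite !inND; move/nlt_leS: md; lra.
rewrite inN1; have := inN_ge0 (g @ add n m); have w0 := wid_gt0 (add n m).
move: (wid _) w0 => w w0 h0 h1 h2 h3.
have := mulr_ge0 h0 (ltW w0); have : (g @ add n m)%:K * w <= w by rewrite ger_pMl.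
by split; lra.
Qed.

(* The supports of the tents of a level are disjoint, and each support contains
   those of the nodes above it. *)
Lemma cen_prefix g n d (x : K M) : (forall i, lt i (add n (sc d)) -> le (g @ i) o1) ->
  `|x - toK (cen g (add n (sc d)))| < wid (add n (sc d)) -> `|x - toK (cen g n)| < 3 / 4 * wid n.
Proof.
move=> /cen_drift[h0 h1] /abs_lt[h2 h3].
have w : wid (add n (sc d)) <= wid n / 4.
  by rewrite -widS naddrS; apply: eps_le; apply: nleD; rewrite nleSS; apply: nle_add.
by apply/abs_lt; split; lra.
Qed.

Lemma cen_inj g g' n (x : K M) : (forall i, lt i n -> le (g @ i) o1 /\ le (g' @ i) o1) ->
  `|x - toK (cen g n)| < wid n -> `|x - toK (cen g' n)| < wid n ->
  forall i, lt i n -> g @ i = g' @ i.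
Proof.
move=> hb h h'.
suff key : forall m, le m n -> forall i, lt i m -> g @ i = g' @ i by exact: key (nle_refl n).
apply: nn_ind; first by dec.
  by move=> _ i /nlt0.
move=> m IH mn i /nltS im; have IHm := IH (nltW mn).
case: (EM (i = m)) => [->|ne]; last by apply: IHm; apply/nlt_neq.
have e := cen_ext IHm.
have near k : (forall i, lt i n -> le (k @ i) o1) -> `|x - toK (cen k n)| < wid n ->
    `|x - toK (cen k (sc m))| < wid (sc m).
  move=> hk; have /nleE[c] := mn; case: (nn_case c) => [->|[d ->]] ec.
    by rewrite ec naddr0.
  rewrite ec in hk * => /(cen_prefix hk) hd; apply: lt_le_trans hd _.
  by have := wid_gt0 (sc m); lra.
have hm : lt m n by [].
have := near g' (fun i l => (hb i l).2) h'; have := near g (fun i l => (hb i l).1) h.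
rewrite !cenS widS e; have w0 := wid_gt0 m; have [a1 b1] := hb m hm.
have cases (b : NN) : le b o1 -> b = cZ \/ b = o1 by move=> /nleS_cases[/nle_n0|]; [left|right].
move=> /abs_lt[k1 k2] /abs_lt[k3 k4].
(* Centres that agree up to level [m] and then have different digits are [2 * wid (sc m)] apart, too
   far for [x] to be within [wid (sc m)] of both. *)
have [ea|ea] := cases _ a1; have [eb|eb] := cases _ b1; rewrite ?ea ?eb //;
  exfalso; move: k1 k2 k3 k4; rewrite ea eb inN0 inN1; lra.
Qed.

Lemma bar_ext (g g' : RR) n : (forall i, lt i n -> g @ i = g' @ i) -> bar g n = bar g' n.
Proof.
move=> h; suff: forall m, le m n -> bar g m = bar g' m by apply; apply: nle_refl.
apply: nn_ind; first by dec.
  by rewrite !bar0.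
by move=> m IH mn; rewrite !barS h // IH //; apply: nltW.
Qed.

Lemma pow2_le (m n : NN) : le m n -> (pow2 m)%:K <= (pow2 n)%:K.
Proof.
move=> /nleE[c ->]; rewrite pow2D inNM.
have : lt cZ (pow2 c) by apply/nle_lt => /nle_n0/pow2_neq0.
by move=> /nlt_leS; rewrite inN0 add0r => h; rewrite ler_peMr ?inN_ge0.
Qed.

Variable T : RR.
Hypothesis tT : treem T.

Lemma tree_prefix g n d : T @ bar g (add n d) = cZ -> T @ bar g n = cZ.
Proof.
move: d; apply: nn_ind; first by dec.
  by rewrite naddr0.
by move=> d IH; rewrite naddrS barS => /(tT.1 _ _)[/IH].
Qed.

Lemma tree_le g m n : le m n -> T @ bar g n = cZ -> T @ bar g m = cZ.
Proof. by move=> /nleE[d ->]; apply: tree_prefix. Qed.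

Lemma tree_binary g n i : T @ bar g n = cZ -> lt i n -> le (g @ i) o1.
Proof. by move=> h /tree_le/(_ h); rewrite barS => /(tT.1 _ _)[]. Qed.

Definition ctr s := cen (digs s) (len s).
#[global] Instance D1_ctr : D1 ctr. Proof. by apply: D1_intro; rewrite /ctr /digs; def. Qed.

Lemma ctr_bar g n : toK (ctr (bar g n)) = toK (cen g n).
Proof.
by rewrite /ctr len_bar; apply: cen_ext => i l; rewrite digsE dig_bar.
Qed.

(** * Tents *)

Definition tent := sval (seal (T := NN -> NN -> NN) (fun s c =>
  cond (T @ s = cZ /\ ltq (absq (subq c (ctr s))) (ipow2q (add (len s) (len s))))
    (subq (natq o1) (mulq (natq (pow2 (add (len s) (len s)))) (absq (subq c (ctr s))))) (natq cZ))).
Definition tent_unlock : tent = _ := svalP (seal _).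
#[global] Instance D2_tent : D2 tent. Proof. by apply: D2_intro; rewrite tent_unlock; def. Qed.

Lemma tentT s c : T @ s = cZ -> `|toK c - toK (ctr s)| < wid (len s) ->
  toK (tent s c) = 1 - (pow2 (add (len s) (len s)))%:K * `|toK c - toK (ctr s)|.
Proof.
move=> h1 h2; rewrite tent_unlock condT ?toK_sub ?toK_mul ?toK_abs ?toK_sub ?toK_nat ?inN1 //.
by split=> //; rewrite ltqE toK_abs toK_sub toK_ipow2.
Qed.

Lemma tentF s c : ~ (T @ s = cZ /\ `|toK c - toK (ctr s)| < wid (len s)) -> toK (tent s c) = 0.
Proof.
move=> h; rewrite tent_unlock condF ?toK_nat ?inN0 // => -[h1 h2]; apply: h; split=> //.
by move: h2; rewrite ltqE toK_abs toK_sub toK_ipow2.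
Qed.

Lemma pow2_wid n : (pow2 (add n n))%:K * wid n = 1. Proof. exact: pow2_eps. Qed.

Lemma tent_cases s c : let B := (pow2 (add (len s) (len s)))%:K in
  (toK (tent s c) = 1 - B * `|toK c - toK (ctr s)| /\ B * `|toK c - toK (ctr s)| < 1) \/
  (toK (tent s c) = 0 /\ (T @ s = cZ -> 1 <= B * `|toK c - toK (ctr s)|)).
Proof.
move=> B; have p := pow2_pos (add (len s) (len s)).
case: (EM (T @ s = cZ /\ `|toK c - toK (ctr s)| < wid (len s))) => [[h1 h2]|h].
  by left; rewrite tentT //; split=> //; rewrite -(pow2_wid (len s)) ltr_pM2l.
right; rewrite tentF //; split=> // h1; rewrite -(pow2_wid (len s)) ler_pM2l // leNgt.
by apply/negP => h2; apply: h.
Qed.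

Lemma tent_ge0 s c : 0 <= toK (tent s c).
Proof. by case: (tent_cases s c) => -[-> ?]; lra. Qed.

Lemma tent_lip s c c' :
  `|toK (tent s c) - toK (tent s c')| <= (pow2 (add (len s) (len s)))%:K * `|toK c - toK c'|.
Proof.
set B := (pow2 _)%:K; have B0 : 0 < B := pow2_pos _.
have t1 : B * `|toK c - toK (ctr s)| <= B * `|toK c - toK c'| + B * `|toK c' - toK (ctr s)|.
  by rewrite -mulrDr ler_pM2l //; apply: le_trans (ler_normD _ _); rewrite subrKA.
have t2 : B * `|toK c' - toK (ctr s)| <= B * `|toK c - toK c'| + B * `|toK c - toK (ctr s)|.
  rewrite -mulrDr ler_pM2l // (distrC (toK c) (toK c')).
  by apply: le_trans (ler_normD _ _); rewrite subrKA.
have d0 : 0 <= B * `|toK c - toK c'| by rewrite mulr_ge0 // ltW.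
case: (EM (T @ s = cZ)) => h; last first.
  by rewrite !tentF ?subrr ?normr0 // => -[].
rewrite ler_norml; case: (tent_cases s c) (tent_cases s c') => [][-> h1] [][-> h2];
  move: h1 h2; rewrite -/B => h1 h2; apply/andP; try (have := h1 h); try (have := h2 h); split; lra.
Qed.

Definition ssum := sval (seal (T := NN -> NN -> NN) (fun n c => recf (fun s r => addq r (tent s c)) (natq cZ) n)).
Definition ssum_unlock : ssum = _ := svalP (seal _).
#[global] Instance D2_ssum : D2 ssum. Proof. by apply: D2_intro; rewrite ssum_unlock; def. Qed.

Lemma ssum0 c : toK (ssum cZ c) = 0. Proof. by rewrite ssum_unlock recf0 toK_nat inN0. Qed.
Lemma ssumS n c : toK (ssum (sc n) c) = toK (ssum n c) + toK (tent n c).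
Proof. by rewrite ssum_unlock recfS ?toK_add //; def. Qed.

Lemma ssum_le n m c : le n m -> toK (ssum n c) <= toK (ssum m c).
Proof.
move=> /nleE[d ->]; move: d; apply: nn_ind; first by dec.
  by rewrite naddr0.
by move=> d h; rewrite naddrS ssumS; have := tent_ge0 (add n d) c; lra.
Qed.

Lemma len_le (s : NN) : le (len s) s.
Proof. by rewrite -{2}(bar_len s); apply: le_bar. Qed.

(** A Lipschitz constant of [ssum n]: there are [n] tents, each of slope at most [4^n], since a
    sequence is no longer than its code. *)
Definition slope (n : NN) : K M := n%:K * (pow2 (add n n))%:K.

Lemma slope_eps (n : NN) : slope n * eps (add n (add n n)) <= 1.
Proof.
rewrite epsD /slope mulrACA pow2_wid mulr1; exact: eps_mul_le.
Qed.

Lemma ssum_lip n c c' : `|toK (ssum n c) - toK (ssum n c')| <= slope n * `|toK c - toK c'|.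
Proof.
suff: forall m, le m n -> `|toK (ssum m c) - toK (ssum m c')| <=
  m%:K * ((pow2 (add n n))%:K * `|toK c - toK c'|).
  by rewrite /slope -mulrA; apply; apply: nle_refl.
apply: nn_ind; first by dec.
  by rewrite !ssum0 subrr normr0 inN0 mul0r.
move=> m IH mn; rewrite !ssumS inNS mulrDl mul1r.
have -> (a b a' b' : K M) : a + b - (a' + b') = (a - a') + (b - b') by ring.
apply: le_trans (ler_normD _ _) _; apply: lerD; first exact: IH (nltW mn).
apply: le_trans (tent_lip _ _ _) _; rewrite ler_wpM2r //; apply: pow2_le.
by apply: nleD; apply: nle_trans (len_le _) (nltW mn).
Qed.

(** * Bounds on the codes of binary sequences *)

(** Each step passes from [r] to the code of its extension by the entry 1, the largest code that a
    binary extension of a sequence with code up to [r] can have. *)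
Definition cbound := sval (seal (T := NN -> NN) (fun n => recf (fun _ r => sc (add (tri (add r o1)) o1)) cZ n)).
Definition cbound_unlock : cbound = _ := svalP (seal _).
#[global] Instance D1_cbound : D1 cbound. Proof. by apply: D1_intro; rewrite cbound_unlock; def. Qed.
Lemma cboundS n : cbound (sc n) = sc (add (tri (add (cbound n) o1)) o1).
Proof. by rewrite cbound_unlock recfS //; def. Qed.

Lemma cbound_le m n : le m n -> le (cbound m) (cbound n).
Proof.
move=> /nleE[d ->]; move: d; apply: nn_ind; first by dec.
  by rewrite naddr0; apply: nle_refl.
move=> d h; rewrite naddrS cboundS; apply: nle_trans h _.
set r := cbound _; apply: nle_S; apply: nle_trans (nle_add _ _).
rewrite /o1 naddrS naddr0 triS; exact: nle_trans (nle_S (nle_refl r)) (nle_addr _ _).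
Qed.

Lemma bar_cbound (g : RR) n : (forall i, lt i n -> le (g @ i) o1) -> le (bar g n) (cbound n).
Proof.
move=> h; suff: forall m, le m n -> le (bar g m) (cbound m) by apply; apply: nle_refl.
apply: nn_ind; first by dec.
  by rewrite bar0 => _; apply: nle0.
move=> m IH mn; rewrite barS cboundS snoc_unlock nleSS pairn_unlock.
apply: nleD (h _ mn); apply: tri_le; apply: nleD (h _ mn); exact: IH (nltW mn).
Qed.

Lemma tree_cbound s : T @ s = cZ -> le s (cbound (len s)).
Proof.
move=> h; rewrite -{1}(bar_len s); apply: bar_cbound => i l.
by apply: tree_binary l; rewrite bar_len.
Qed.

Lemma tree_len s n : T @ s = cZ -> lt (cbound n) s -> lt n (len s).
Proof.
move=> h l; apply/nle_lt => /cbound_le l'; apply: (@nlt_irr _ s).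
exact: nle_lt_trans (nle_trans (tree_cbound h) l') l.
Qed.

(** * The levels at which a real lies outside the tree *)

Definition wlev (n : NN) : NN := sc (sc (sc (sc (add n n)))).
Lemma eps_wlev n : eps (wlev n) = wid n / 16.
Proof. by rewrite /wlev !epsS -/(wid n); field. Qed.

(** The factor 7/8 is [3/4 + 1/8]: supports of tents above level [n] lie within [3/4 * wid n] of a
    centre of level [n], so these tents vanish within [wid n / 8] of the approximation. As
    [7/8 + 1/16 < 1], at an invalid level the real itself, whose approximation has error
    [wid n / 16], is within [wid n] of a centre. *)
Definition valid (x : RR) (n : NN) := forall s, lt s (sc (cbound n)) -> T @ s = cZ /\ len s = n ->
  7 * eps (add n n) <= 8 * `|toK (x @ wlev n) - toK (ctr s)|.
#[global] Instance P2_valid : P2 valid. Proof. by apply: P2_intro; rewrite /valid /wlev; dec. Qed.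

(** If no level is valid, choose at each level a node whose centre is near [x]. Disjointness of the
    supports makes each chosen node extend the previous one, and the nodes form a path. *)
Lemma valid_exists x : ~ (exists b, forall n, T @ bar b n = cZ) -> isr x -> exists n, valid x n.
Proof.
move=> np rx; apply: contrapT => nv; apply: np.
pose R n s := (T @ s = cZ /\ len s = n) /\
  8 * `|toK (x @ wlev n) - toK (ctr s)| < 7 * eps (add n n).
have dR : P2 R by apply: P2_intro; rewrite /R /wlev; dec.
have [n|G hG] := number_choice dR.
  apply: contrapT => h; apply: nv; exists n => s _ hs; rewrite leNgt; apply/negP => l.
  by apply: h; exists s.
have near n k : le (wlev n) k -> `|q x k - toK (cen (digs (G @ n)) n)| < wid n.
  move=> l; have [[_ ln]] := hG n; rewrite /ctr ln -/(wid n) -/(q x _) => h.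
  have /abs_lt[] : `|q x (wlev n) - q x k| < wid n / 16 by rewrite -eps_wlev; apply: real_le.
  have w0 := wid_gt0 n.
  have /abs_lt[] : `|q x (wlev n) - toK (cen (digs (G @ n)) n)| < 7 / 8 * wid n by lra.
  by move=> *; apply/abs_lt; split; lra.
have eG n : bar (digs (G @ n)) n = G @ n by rewrite -{2}(hG n).1.2 bar_len.
have bin n i : lt i n -> le (digs (G @ n) @ i) o1.
  by apply: tree_binary; rewrite eG (hG n).1.1.
pose b : RR := LAM (fun n => digs (G @ sc n) @ n).
have bE n : b @ n = digs (G @ sc n) @ n by rewrite beta //; rewrite /digs; def.
have e : forall n, bar b n = G @ n.
  apply: nn_ind; first by dec.
    by rewrite bar0 -(eG cZ) bar0.
  move=> n IH; rewrite barS IH bE -[RHS]eG barS; congr snoc.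
  rewrite -{1}(eG n); apply: bar_ext.
  have l : le (wlev n) (wlev (sc n)).
    by apply/inN_le; rewrite /wlev !(inNS, inND); lra.
  apply: (cen_inj (x := q x (wlev (sc n)))) (near n _ l) _ => [i il|].
    by split; [exact: bin|apply: bin; apply: nle_S].
  have := @cen_prefix (digs (G @ sc n)) n cZ (q x (wlev (sc n))).
  rewrite naddrS naddr0 => h; apply: lt_le_trans (h _ _) _ => [i|  |].
  - exact: bin.
  - by apply: near; apply: nle_refl.
  - by have := wid_gt0 n; lra.
by exists b => n; rewrite e (hG n).1.1.
Qed.

Lemma ssum_tail x n c m : valid x n -> `|toK c - q x (wlev n)| <= wid n / 8 ->
  le (sc (cbound n)) m -> toK (ssum m c) = toK (ssum (sc (cbound n)) c).
Proof.
move=> hv near /nleE[d ->]; rewrite -[RHS]addr0.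
suff z s : lt (cbound n) s -> toK (tent s c) = 0.
  suff: forall d, toK (ssum (add (sc (cbound n)) d) c) <= toK (ssum (sc (cbound n)) c).
    move=> h; apply/eqP; rewrite eq_le addr0 h /=; apply: ssum_le; exact: nle_add.
  apply: nn_ind; first by dec.
    by rewrite naddr0.
  by move=> d' IH; rewrite naddrS ssumS z ?addr0 // naddSr; apply/nltS/nle_add.
move=> l; apply: tentF => -[ts hs]; have nl := tree_len ts l.
have /nleE[d' ed] := nl.
have tn : T @ bar (digs s) (len s) = cZ by rewrite bar_len.
have hp : `|toK c - toK (cen (digs s) n)| < 3 / 4 * wid n.
  have e : len s = add n (sc d') by rewrite ed naddSr naddrS.
  apply: (@cen_prefix (digs s) n d'); rewrite -e //.
  by move=> i; apply: tree_binary tn.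
have tp : T @ bar (digs s) n = cZ := tree_le (nltW nl) tn.
have := hv (bar (digs s) n); rewrite len_bar ctr_bar => /(_ _ (conj tp erefl)).
have lp : lt (bar (digs s) n) (sc (cbound n)).
  by apply/nltS; apply: bar_cbound => i; apply: tree_binary tp.
move=> /(_ lp); rewrite -/(wid n) -/(q x _) => h.
have t : `|q x (wlev n) - toK (cen (digs s) n)| <=
    `|toK c - q x (wlev n)| + `|toK c - toK (cen (digs s) n)|.
  rewrite (distrC (toK c)); apply: le_trans (ler_normD _ _); by rewrite subrKA.
by lra.
Qed.
End Tents.

Ltac nle_lra := apply/inN_le; rewrite ?(inND, inNS);
  repeat match goal with |- context [inN ?x] =>
    lazymatch goal with
    | _ : is_true (Order.le _ (inN x)) |- _ => fail
    | _ => have ? := inN_ge0 x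
    end end; lra.

(** * The continuous unbounded function of an infinite tree without path *)

Section TreeFunction.
Context {M : model}.
Notation hM := (mrca M).
Notation NN := (car M N).
Notation RR := (car M t1).
Local Open Scope ring_scope.
Notation "n %:K" := (inN n) (at level 2, format "n %:K").

Variable T : RR.
Hypothesis tT : treem T.
Variable nu : car M t2.
Hypothesis nuP : forall x, isr x -> valid T x (nu @ x).

(** Since [n * 4^n * 2^(-3 n) <= 1], reading [x] at index [j + 3 n] compensates the slope of
    [ssum n] and leaves an error below [eps j]. *)
Definition trip (n : NN) := add n (add n n).
#[global] Instance D1_trip : D1 trip. Proof. by apply: D1_intro; rewrite /trip; def. Qed.
Definition cut (x : RR) := sc (cbound (nu @ x)).

(** The cut depends on the sequence that represents the real and not only on the real; by
    [ssum_tail] the values nevertheless agree for equal reals. *)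
Fact treefun_ex : {f : car M (t1 ~> t1) |
  forall x j, f @ x @ j = ssum T (cut x) (x @ add j (trip (cut x)))}.
Proof.
apply: cid; have [f hf] : D2 (fun (x : RR) j => ssum T (cut x) (x @ add j (trip (cut x)))).
  by apply: D2_intro; rewrite /cut; def.
by exists f.
Qed.
Let F := sval treefun_ex.
Let FE x j : F @ x @ j = ssum T (cut x) (x @ add j (trip (cut x))) := svalP treefun_ex x j.

Lemma slope_gt0 x : 0 < slope (cut x).
Proof. by rewrite mulr_gt0 ?pow2_pos // inNS; have := inN_ge0 (cbound (nu @ x)); lra. Qed.

Lemma slope_trip x j : slope (cut x) * eps (add j (trip (cut x))) <= eps j.
Proof.
rewrite epsD mulrCA ger_pMr ?eps_gt0 //; exact: slope_eps.
Qed.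

Lemma treefun_approx x j k : isr x -> le (add j (trip (cut x))) k ->
  `|q (F @ x) j - toK (ssum T (cut x) (x @ k))| < eps j.
Proof.
move=> rx l; rewrite /q FE; apply: le_lt_trans (ssum_lip _ _ _ _) _.
apply: lt_le_trans (slope_trip x j); rewrite ltr_pM2l ?slope_gt0 //; exact: real_le.
Qed.

Lemma real_treefun x : isr x -> isr (F @ x).
Proof.
move=> rx; apply/isrE => n i; rewrite /q !FE; apply: le_lt_trans (ssum_lip _ _ _ _) _.
apply: lt_le_trans (slope_trip x n); rewrite ltr_pM2l ?slope_gt0 //; apply: real_le => //.
by apply/inN_le; rewrite !inND; have := inN_ge0 i; lra.
Qed.

(* Beyond the cut of [x], the tents vanish near [x]. *)
Lemma treefun_close x y k1 d j : isr x -> isr y -> d <= wid (nu @ x) / 16 ->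
  (forall k, le k1 k -> `|q x k - q y k| <= d) ->
  `|q (F @ x) j - q (F @ y) j| <= 2 * eps j + slope (cut x) * d.
Proof.
move=> rx ry dw hd.
pose k := add (add k1 (add (wlev (nu @ x)) (wlev (nu @ y)))) (add j (add (trip (cut x)) (trip (cut y)))).
have l1 : le k1 k by rewrite /k; nle_lra.
have l2 : le (wlev (nu @ x)) k by rewrite /k; nle_lra.
have l3 : le (wlev (nu @ y)) k by rewrite /k; nle_lra.
have l4 : le (add j (trip (cut x))) k by rewrite /k; nle_lra.
have l5 : le (add j (trip (cut y))) k by rewrite /k; nle_lra.
have /abs_lt[a1 a2] := treefun_approx rx l4; have /abs_lt[a3 a4] := treefun_approx ry l5.
(* At [y] the sum up to either cut equals the longer common sum: for the cut of [y] by validity of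
   [nu @ y], for the cut of [x] by validity of [nu @ x], because [y] is close to [x]. *)
pose m := add (cut x) (cut y).
have nx := nuP rx; have ny := nuP ry; have dk := hd k l1.
have e1 : toK (ssum T m (y @ k)) = toK (ssum T (cut x) (y @ k)).
  apply: (ssum_tail tT nx); last exact: nle_add.
  have := real_le rx l2; rewrite eps_wlev -/(q y k) => h.
  have t : `|q y k - q x (wlev (nu @ x))| <= `|q x k - q y k| + `|q x (wlev (nu @ x)) - q x k|.
    rewrite (distrC (q x k)) (distrC (q x (wlev _)) (q x k)).
    by apply: le_trans (ler_normD _ _); rewrite subrKA.
  lra.
have e2 : toK (ssum T m (y @ k)) = toK (ssum T (cut y) (y @ k)).
  apply: (ssum_tail tT ny); last exact: nle_addr.
  have := real_le ry l3; rewrite eps_wlev -/(q y k) distrC => h; have := wid_gt0 (nu @ y); lra.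
have : `|toK (ssum T (cut x) (x @ k)) - toK (ssum T (cut x) (y @ k))| <= slope (cut x) * d.
  by apply: le_trans (ssum_lip _ _ _ _) _; rewrite ler_pM2l ?slope_gt0.
rewrite -e1 e2 !ler_norml => /andP[b1 b2]; apply/andP; split; lra.
Qed.

Definition radius x k := add (add k (trip (cut x))) (wlev (nu @ x)).

Lemma slope_radius x k : slope (cut x) * eps (radius x k) <= eps k /\
  eps (radius x k) <= wid (nu @ x) / 16.
Proof.
split; last by rewrite -eps_wlev; apply: eps_le; exact: nle_addr.
apply: le_trans (slope_trip x k); rewrite ler_pM2l ?slope_gt0 //.
by apply: eps_le; exact: nle_add.
Qed.

Lemma is01_treefun : is01m F.
Proof.
split=> [x rx _|x rx y ry _ _ [/rleE h1 /rleE h2]]; first exact: real_treefun.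
apply: eqr_close => j; apply: le_eps => k.
have [r1 r2] := slope_radius x k.
apply: le_trans (treefun_close (k1 := sc (radius x k)) j rx ry r2 _) _; last by lra.
move=> m lm; have := eps_le lm; rewrite epsS => e.
by have := h1 m; have := h2 m => ??; rewrite ler_norml; apply/andP; split; lra.
Qed.

Lemma usco_treefun : uscom F.
Proof.
move=> x rx ix k; pose k' := sc (sc (sc (sc k))); pose r := sc (sc (radius x k')).
exists r => y ry iy b; apply/rltE; exists k'; rewrite q_addr q_ipow2r.
have [r1 r2] := slope_radius x k'.
have : `|q (F @ x) k' - q (F @ y) k'| <= 2 * eps k' + slope (cut x) * eps (radius x k').
  apply: (treefun_close (k1 := r)) => // m lm.
  have := ballr_elim m rx ry b; have := eps_le lm; rewrite distrC !epsS.
  by have := eps_gt0 (radius x k'); lra.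
rewrite ler_norml => /andP[h1 h2].
have [h3 h4] := real_le2 (real_treefun rx) (nle_S (nle_refl k')).
by have := eps_gt0 k; rewrite /k' !epsS in h1 h2 h3 h4 r1 *; lra.
Qed.

(** The drift from the centre of a prefix is at most 2/3 of its width, so each of the [n + 1]
    prefixes contributes at least 1/3, and prefixes have increasing codes. *)
Lemma ssum_prefixes g n c : T @ bar g n = cZ -> toK c = toK (cen g n) ->
  n%:K + 1 <= 3 * toK (ssum T (sc (bar g n)) c).
Proof.
move=> tn ec.
have high m : le m n -> 1 <= 3 * toK (tent T (bar g m) c).
  move=> /nleE[d e]; have tm : T @ bar g m = cZ by apply: (tree_prefix tT (d := d)); rewrite -e.
  have [i l|d0 d1] := @cen_drift M g m d; first by apply: (tree_binary tT tn); rewrite e.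
  have w := wid_gt0 m; have w' := wid_gt0 (add m d).
  have dist : `|toK c - toK (ctr (bar g m))| <= 2 / 3 * wid m.
    by rewrite ctr_bar ec e ger0_norm //; lra.
  rewrite tentT ?len_bar //; last by lra.
  have e1 := pow2_wid m; have p := pow2_pos (add m m); rewrite -(ler_pM2l p) mulrCA e1 in dist.
  lra.
suff: forall m, le m n -> m%:K + 1 <= 3 * toK (ssum T (sc (bar g m)) c) by apply; apply: nle_refl.
apply: nn_ind; first by dec.
  move=> _; rewrite inN0 ssumS; have := high cZ (nle0 _).
  by have := ssum_le T c (nle0 (bar g cZ)); rewrite ssum0; lra.
move=> m IH mn; rewrite inNS ssumS; have := IH (nltW mn); have := high _ mn.
have : le (sc (bar g m)) (bar g (sc m)) by rewrite barS; exact: lt_snoc.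
by move=> /(ssum_le T c); lra.
Qed.

Lemma in01_ctr s : T @ s = cZ -> in01r (constr (ctr s)).
Proof.
move=> ts; have tn : T @ bar (digs s) (len s) = cZ by rewrite bar_len.
have [i l|] := @cen_drift M (digs s) cZ (len s).
  by apply: (tree_binary tT tn); rewrite nadd0r in l.
rewrite nadd0r cen0 wid0 -/(ctr s) => h0 h1; have w := wid_gt0 (len s).
by split; apply/rleE => n; rewrite q_constr ?q_zeror ?q_oner; have := eps_gt0 n; lra.
Qed.

Lemma unbounded_treefun : ~ boundm F.
Proof.
move=> [B [rB hB]]; have [b hb] := K_archi (3 * (q B cZ + 3)).
have [s [ls ts]] := tT.2 (sc (cbound b)).
have l := tree_len tT ts ls; have rc := real_constr (ctr s); set x : RR := constr (ctr s) in rc.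
have /rleE/(_ cZ) := hB x rc (in01_ctr ts).
have tn : T @ bar (digs s) (len s) = cZ by rewrite bar_len.
rewrite eps0 /q FE => h.
have h1 := @ssum_prefixes (digs s) (len s) (ctr s) tn erefl.
(* At the centre of [s] no level up to [len s] is valid, because the prefixes of [s] have centres
   within 2/3 of their width; hence the cut covers all the prefixes. *)
have ln : lt (len s) (nu @ x).
  apply/nle_lt => /nleE[d e]; have := nuP rc.
  have tm : T @ bar (digs s) (nu @ x) = cZ by apply: (tree_prefix tT (d := d)); rewrite -e.
  move=> /(_ (bar (digs s) (nu @ x))); rewrite len_bar.
  have lb : lt (bar (digs s) (nu @ x)) (sc (cbound (nu @ x))).
    by apply/nltS; apply: bar_cbound => i; apply: (tree_binary tT tm).
  move=> /(_ lb (conj tm erefl)); rewrite -/(q x _) q_constr ctr_bar /ctr e -/(wid _).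
  have [i li|d0 d1] := @cen_drift M (digs s) (nu @ x) d.
    by apply: (tree_binary tT tn); rewrite e.
  by have := wid_gt0 (nu @ x); have := wid_gt0 (add (nu @ x) d); rewrite ger0_norm //; lra.
have le1 : le (sc (bar (digs s) (len s))) (cut x).
  rewrite bar_len nleSS; apply: nle_trans (tree_cbound tT ts) _; apply: cbound_le; exact: nltW.
have := ssum_le T (ctr s) le1; have /inN_lt := l.
have e : x @ add cZ (trip (cut x)) = ctr s by rewrite /x constr_unlock beta //; def.
by rewrite e in h; move: hb; rewrite /q; lra.
Qed.
End TreeFunction.

Lemma UB_WKL (M : model) : @UBm M -> @WKLm M.
Proof.
move=> ub T tT; apply: contrapT => np.
have [P hP] : P2 (fun x n => valid T (hat x) n) by apply: P2_intro; dec.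
have [x|nu hnu] := @r_ac _ (mrca M) P.
  by have [n hn] := valid_exists tT np (real_hat x); exists n; apply/hP.
have nuP x : isr x -> valid T x (nu @ x).
  by move=> rx; rewrite -{1}(hat_real rx); apply/hP.
by apply: (unbounded_treefun tT nuP); apply: ub; [exact: is01_treefun|exact: usco_treefun].
Qed.

(** * The axioms and the Kleene normal forms in an extensional model *)

Section ModelAxioms.
Context {M : model}.
Notation hM := (mrca M).

Lemma Def_ev G t (a : tm G t) : Def (fun g : env M G => ev a g).
Proof.
by elim: a => [t' x|s t' f hf b hb||  |s t'|r s t'|] /=; try exact: Def_const;
  [exact: Def_var|exact: Def_app].
Qed.

Lemma Dec_sat G (A : form G) : qf A -> Dec (fun g : env M G => sat A g).
Proof.
elim: A => {G} [G a b _|G _|G A hA B hB /= [/hA dA /hB dB]|//].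
- apply: Dec_ext (Dec_eq (Def_ev a) (Def_ev b)) => g; exact: iff_sym ((r_ext hM).1 _ _).
- exact: Dec_const.
- exact: Dec_imp.
Qed.

Lemma rca_sat (B : sentence) : RCA0w B -> sat (M := M) B tt.
Proof.
have E t (a b : car M t) := eqv_eq (r_ext hM) a b; have E0 := (r_ext hM).1.
case=> [||||||||||G A qA|G A qA].
- by move=> x; apply/E0.
- by move=> x y /E0 h; apply/E0; rewrite /= in h *.
- by move=> x y z /E0 h /E0 k; apply/E0; rewrite /= in h k *; rewrite h.
- by move=> x /E0; apply: (r_S0 hM).
- by move=> x y /E0 h; apply/E0; apply: (r_Sinj hM).
- move=> s t; apply/sat_all => x; apply/sat_all => y; rewrite sat_Eq E.
  exact: (r_K hM).
- move=> r s t; apply/sat_all => x; apply/sat_all => y; apply/sat_all => z; rewrite sat_Eq E.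
  exact: (r_S hM).
- by move=> x y; apply/E0; apply: (r_R0 hM).
- by move=> x y z; apply/E0; apply: (r_RS hM).
- move=> s t; apply/sat_all => f; apply/sat_all => x; apply/sat_all => y.
  by rewrite sat_imp !sat_Eq !E /= => ->.
- apply/sat_closure => g; rewrite !sat_imp sat_inst => h0 hS n.
  apply: (r_ind hM) => // m hm; apply/sat_succ; exact: hS.
- apply/sat_closure => g; rewrite sat_imp sat_ex => h.
  have [P hP] : P2 (fun f n => sat A (n, (f, g))).
    apply: P2_intro.
    apply: (Dec_ren (r := fun e : env M [:: N; t1] => (e.1, (e.2.1, g)) : env M [:: N, t1 & G])) (Dec_sat qA) => u.
    elim/var_case=> [|v]; first exact: (Def_var (VZ _ _)).
    elim/var_case=> [|w x]; first exact: (Def_var (VS _ (VZ _ _))).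
    exact: (Def_const _ (lk x g)).
  have [f|F hF] := @r_ac _ hM P.
    by have /sat_ex[n hn] := h f; exists n; apply/hP.
  by exists F; apply/sat_all => f; rewrite sat_choice_matrix; apply/hP.
Qed.

Fixpoint kleenem (k : nat) (b : bool) (f : car M t1) (gs : seq (car M t1)) : Prop :=
  match k with
  | 0 => let P n := f @ List.fold_left (fun c g => snoc c (bar g n)) gs cZ = cZ in
         if b then forall n, P n else exists n, P n
  | k'.+1 => let P g := kleenem k' (~~ b) f (gs ++ [:: g]) in
         if b then forall g, P g else exists g, P g
  end.

Lemma sat_quant G b s (A : form (s :: G)) g : sat (quant b A) g <->
  if b then forall x : car M s, sat A (x, g) else exists x : car M s, sat A (x, g).
Proof. by case: b => //; apply: sat_ex. Qed.

Lemma ev_fold G (g : env M G) (hs : list (tm G t1)) (n : car M N) (c : tm (N :: G) N) :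
  ev (List.fold_left (fun c h => snocN · c · (barN · ↑h · Var (VZ _ _))) hs c) (n, g) =
  List.fold_left (fun c h => snoc c (bar h n)) [seq ev h g | h <- hs] (ev c (n, g)).
Proof.
elim: hs c => [//|h hs IH c]; rewrite [LHS]IH [RHS]/=; congr (List.fold_left _ _ _).
by cbn [ev lk fst snd]; rewrite ev_snocN ev_barN ev_wk.
Qed.

Lemma sat_kleene k : forall G b (f : tm G t1) gs (g : env M G),
  sat (kleene k b f gs) g <-> kleenem k b (ev f g) [seq ev h g | h <- gs].
Proof.
elim: k => [|k IH] G b f gs g; rewrite /= sat_quant.
  by case: b; [apply: iff_all|apply: iff_ex] => n; rewrite sat_eqN /= ev_fold /= ev_wk.
have key h : sat (kleene k (~~ b) (↑f) (map wk gs ++ [:: Var (VZ G t1)])) (h, g) <->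
    kleenem k (~~ b) (ev f g) ([seq ev h g | h <- gs] ++ [:: h]).
  rewrite IH ev_wk map_cat -map_comp /=.
  by under eq_map => a do rewrite /= ev_wk.
by case: b key => key; [apply: iff_all|apply: iff_ex].
Qed.

Lemma sat_S_exists k : sat (M := M) (S_exists k) tt <->
  exists S : car M t2, forall f, S @ f = cZ <-> kleenem k true f [::].
Proof.
rewrite /S_exists sat_ex; apply: iff_ex => S; rewrite sat_all; apply: iff_all => f.
by rewrite sat_iff sat_eqN sat_kleene.
Qed.
End ModelAxioms.

(** * A real that differs from all terms of a sequence *)

Section Diagonal.
Context {M : model}.
Notation hM := (mrca M).
Notation NN := (car M N).
Notation RR := (car M t1).
Local Open Scope ring_scope.
Notation "n %:K" := (inN n) (at level 2, format "n %:K").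

(* The base-4 expansion of [z] has digits 0 and 2, and its digit of index [m] keeps it
   away from [X @ m]. *)
Lemma diagonal (X : car M (N ~> t1)) : exists z : RR, isr z /\ in01r z /\
  forall m, isr (X @ m) -> ~ eqr (X @ m) z.
Proof.
(* The point reached so far is [a * wid m]. With digit 0, [z] exceeds it by at most [wid m / 6],
   with digit 2 by at least [wid m / 2]; the threshold [wid m / 3] is midway and leaves room for the
   error [wid m / 16]. *)
pose C (a m : NN) : Prop := 3 * toK (X @ m @ wlev m) < (3 * a%:K + 1) * wid m.
have dC : P2 C by apply: P2_intro; rewrite /C /wid /wlev; dec.
pose step m a : NN := add (add (add a a) (add a a)) (add (cond (C a m) o1 cZ) (cond (C a m) o1 cZ)).
have dstep : D2 step by apply: D2_intro; rewrite /step; def.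
pose A m := recf step cZ m.
have AS m : A (sc m) = step m (A m) by rewrite /A recfS //; def.
have dA : D1 A by apply: D1_intro; rewrite /A; def.
pose g : RR := LAM (fun m => cond (C (A m) m) o1 cZ).
have gE m : g @ m = cond (C (A m) m) o1 cZ by rewrite beta //; def.
have gA : forall m, numer g m = A m.
  apply: nn_ind; first by dec.
    by rewrite numer_unlock /A !recf0.
  by move=> m; rewrite AS /step -gE numer_unlock recfS ?[recf _ _ m]/A; [move=> ->|def].
have gb i : le (g @ i) o1.
  by rewrite gE; case: (EM (C (A i) i)) => h;
    [rewrite condT //; exact: nle_refl|rewrite condF //; exact: nle0].
have drift n d := @cen_drift M g n d (fun i _ => gb i).
pose z : RR := LAM (fun n => cen g n).
have qz n : q z n = toK (cen g n) by rewrite /q beta //; def.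
have we (n : NN) : wid n <= eps n by apply: eps_le; exact: nle_add.
have rz : isr z.
  apply/isrE => n i; rewrite !qz; have [h0 h1] := drift n i.
  have := wid_gt0 (add n i); have := we n; have := eps_gt0 n => *.
  by apply/abs_lt; split; lra.
exists z; split=> //; split.
  split; apply/rleE => n; rewrite qz ?q_zeror ?q_oner; have [] := drift cZ n;
    rewrite nadd0r cen0 wid0; have := eps_gt0 n; have := wid_gt0 n; lra.
move=> m rx [/rleE h1 /rleE h2]; pose k := sc (sc (wlev m)).
have := h1 k; have := h2 k; rewrite /k 2!epsS eps_wlev -/k qz.
have l : le (wlev m) k by apply: nle_S; apply: nle_S; apply: nle_refl.
have [] := real_le2 rx l; rewrite eps_wlev => r1 r2.
have [d ed] : exists d, k = add (sc m) d.
  by apply/nleE/inN_le; rewrite /k /wlev !(inNS, inND); have := inN_ge0 m; lra.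
have [d0 d1] := drift (sc m) d; rewrite -ed in d0 d1.
have w := wid_gt0 m; have w' := wid_gt0 k.
have cE : toK (cen g m) = (A m)%:K * wid m by rewrite toK_dy gA.
move: d0 d1; rewrite cenS cE widS gE -/(q (X @ m) _) in r1 r2 *.
case: (EM (C (A m) m)) => h; [rewrite condT //|rewrite condF //].
  by move: h; rewrite /C -/(q (X @ m) _) inN1 mulrDl; lra.
by move: h => /negP; rewrite -leNgt -/(q (X @ m) _) inN0 mulrDl; lra.
Qed.
End Diagonal.

(** * Countable closures *)

(** The closure consists of the values of finite trees labelled by operations. Such trees are
    countable, and an operation applied to listed elements is again the value of a tree. *)
Lemma countable_closure (I : countType) (X : Type) (x0 : X) (sem : I -> seq X -> X) :
  exists e : nat -> X, forall i ns, exists m, e m = sem i (map e ns).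
Proof.
pose fix tev (t : GenTree.tree unit) : X :=
  match t with
  | GenTree.Leaf _ => x0
  | GenTree.Node n ts => if unpickle n is Some i then sem i (map tev ts) else x0
  end.
pose e n := if unpickle n is Some t then tev t else x0.
exists e => i ns; exists (pickle (GenTree.Node (pickle i)
  (map (fun n => odflt (GenTree.Leaf tt) (unpickle n)) ns))).
rewrite /e pickleK /= pickleK -map_comp; congr (sem i _); apply: eq_map => n /=.
by rewrite /e; case: (unpickle n).
Qed.

Definition pr (x y : nat) : nat := pickle (x, y).
Definition unpr (c : nat) : nat * nat := odflt (0, 0) (unpickle c).
Lemma unprK x y : unpr (pr x y) = (x, y).
Proof. by rewrite /unpr pickleK. Qed.

Fixpoint tri0 (n : nat) : nat := if n is m.+1 then tri0 m + m.+1 else 0.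
Definition snoc0 (s x : nat) : nat := (tri0 (s + x) + x).+1.
Fixpoint bar0' (g : nat -> nat) (n : nat) : nat :=
  if n is m.+1 then snoc0 (bar0' g m) (g m) else 0.

(** The quantifiers range over all functions on the standard numbers and not over a model, since
    [sem] refers to this notion before the model exists. *)
Fixpoint kleene_true (k : nat) (b : bool) (f : nat -> nat) (gs : seq (nat -> nat)) : Prop :=
  match k with
  | 0 => let P n := f (List.fold_left (fun c g => snoc0 c (bar0' g n)) gs 0) = 0 in
         if b then forall n, P n else exists n, P n
  | k'.+1 => let P g := kleene_true k' (~~ b) f (gs ++ [:: g]) in
         if b then forall g, P g else exists g, P g
  end.

Definition some (T : Type) (x0 : T) (P : T -> Prop) : T :=
  if pselect (exists x, P x) is left h then sval (cid h) else x0.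
Lemma someP T x0 (P : T -> Prop) : (exists x, P x) -> P (some x0 P).
Proof. by move=> h; rewrite /some; case: pselect => // k; exact: svalP (cid k). Qed.

(* Operations 11 and 12 are Skolem functions: they make the reals of the model an
   elementary substructure for the formulas in Kleene normal form. *)
Definition sem (op : nat * nat) (fs : seq (nat -> nat)) : nat -> nat :=
  let: (tag, p) := op in
  let f := nth (fun _ => 0) fs in
  match tag with
  | 0 => fun _ => p
  | 1 => fun n => n
  | 2 => S
  | 3 => fun n => f 0 (f 1 n)
  | 4 => fun n => pr (f 0 n) (f 1 n)
  | 5 => fun n => (unpr n).1
  | 6 => fun n => (unpr n).2
  | 7 => fun n => nat_rect (fun _ => nat) (f 1 n) (fun i r => f 0 (pr n (pr i r))) (f 2 n)
  | 8 => fun n => some 0 (fun m => f 0 (pr n m) = 0)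
  | 9 => fun n => if `[< exists m, f 0 (pr n m) = 0 >] then 0 else 1
  | 10 => fun n => if `[< kleene_true p true (fun i => f 0 (pr n i)) [::] >] then 0 else 1
  | 11 => some (fun _ => 0) (fun g => kleene_true p true (f 0) (behead fs ++ [:: g]))
  | _ => some (fun _ => 0) (fun g => ~ kleene_true p false (f 0) (behead fs ++ [:: g]))
  end.

Definition enumA : nat -> nat -> nat := sval (cid (countable_closure (fun _ => 0) sem)).
Definition inA (f : nat -> nat) := exists n, enumA n = f.

Lemma inA_op op fs : (forall f, List.In f fs -> inA f) -> inA (sem op fs).
Proof.
move=> h; have [ns ->] : exists ns, fs = map enumA ns.
  elim: fs h => [|f fs IH] h; first by exists [::].
  have [ns ->] := IH (fun g k => h g (or_intror k)).
  by have [n <-] := h f (or_introl erefl); exists (n :: ns).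
exact: svalP (cid (countable_closure (fun _ => 0) sem)) op ns.
Qed.

Lemma inA_ops op f g h : inA f -> inA g -> inA h -> inA (sem op [:: f; g; h]).
Proof. by move=> hf hg hh; apply: inA_op => k /= [<-|[<-|[<-|[]]]]. Qed.

Lemma inA_const c : inA (fun _ => c). Proof. exact: (@inA_op (0, c) [::]). Qed.
Lemma inA_id : inA (fun n => n). Proof. exact: (@inA_op (1, 0) [::]). Qed.
Lemma inA_succ : inA S. Proof. exact: (@inA_op (2, 0) [::]). Qed.
Lemma inA_pr1 : inA (fun n => (unpr n).1). Proof. exact: (@inA_op (5, 0) [::]). Qed.
Lemma inA_pr2 : inA (fun n => (unpr n).2). Proof. exact: (@inA_op (6, 0) [::]). Qed.
Lemma inA_comp f g : inA f -> inA g -> inA (fun n => f (g n)).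
Proof. by move=> hf hg; exact: (inA_ops (3, 0) hf hg hg). Qed.

(** * A model whose functionals preserve the sequences of a countable set *)

Record space := Space { points : Type; plot : (nat -> points) -> Prop }.
(** A sequence of maps is distinguished if it sends plots to plots along every reindexing [r] from
    [A]. The reindexing closes plots under composition with functions of [A] at all types, which
    already the combinator K requires. *)
Definition arrow (S T : space) : space :=
  @Space {f : points S -> points T | forall u, plot u -> plot (fun n => f (u n))}
    (fun F => forall r x, inA r -> plot x -> plot (fun n => sval (F (r n)) (x n))).
Fixpoint sp (t : ty) : space :=
  match t with N => @Space nat inA | s ~> t => arrow (sp s) (sp t) end.

Definition mkfun s t (f : points (sp s) -> points (sp t)) (h : forall u, plot u -> plot (fun n => f (u n))) :
  points (sp (s ~> t)) := exist _ f h.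

Lemma plot_const t (c : points (sp t)) : plot (fun _ => c).
Proof. by case: t c => [|s t] c; [exact: inA_const|move=> r x hr hx; exact: (svalP c x hx)]. Qed.

Lemma plot_comp t (u : nat -> points (sp t)) r : plot u -> inA r -> plot (fun n => u (r n)).
Proof.
case: t u => [|s t] u hu hr; first exact: inA_comp.
by move=> r' x hr' hx; apply: (hu (fun n => r (r' n)) x) => //; apply: inA_comp.
Qed.

Lemma plot_app s t (F : nat -> points (sp (s ~> t))) x : plot F -> plot x ->
  plot (fun n => sval (F n) (x n)).
Proof. by move=> hF; apply: hF inA_id. Qed.

Definition mK s t : points (sp (s ~> t ~> s)).
Proof.
apply: (@mkfun s (t ~> s) (fun a => mkfun (fun u (_ : plot u) => plot_const a))) => u hu r x hr hx.
exact: plot_comp hu hr.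
Defined.

Definition mS r s t : points (sp ((r ~> s ~> t) ~> (r ~> s) ~> r ~> t)).
Proof.
unshelve eapply (@mkfun (r ~> s ~> t) ((r ~> s) ~> r ~> t) (fun x =>
  @mkfun (r ~> s) (r ~> t) (fun y => @mkfun r t (fun z => sval (sval x z) (sval y z)) _) _)).
- move=> u hu; apply: (plot_app (F := fun n => sval x (u n)) (x := fun n => sval y (u n))).
    exact: (svalP x u hu).
  exact: (svalP y u hu).
- move=> v hv; move=> i z hi hz /=.
  apply: (plot_app (F := fun n => sval x (z n)) (x := fun n => sval (v (i n)) (z n))).
    exact: (svalP x z hz).
  exact: (@plot_app r s _ z (@plot_comp (r ~> s) v i hv hi) hz).
- move=> u hu; move=> i y hi hy j z hj hz /=.
  have h := plot_app (plot_comp (plot_comp hu hi) hj) hz.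
  apply: (plot_app (F := fun n => sval (u (i (j n))) (z n)) (x := fun n => sval (y (j n)) (z n)) h).
  exact: (@plot_app r s _ z (@plot_comp (r ~> s) y j hy hj) hz).
Defined.

(** A whole sequence of recursions is done at once: evaluated along codes of [(n, (i, r))], the step
    functionals become a single function of [A], to which operation 7 applies. *)
Lemma inA_rec (h : nat -> points (sp (N ~> N ~> N))) (a k : nat -> nat) : plot h -> inA a -> inA k ->
  inA (fun n => nat_rect (fun _ => nat) (a n) (fun i r => sval (sval (h n) i) r) (k n)).
Proof.
move=> hh ha hk.
have h1 := plot_comp hh inA_pr1.
have h2 := @plot_app N t1 _ _ h1 (inA_comp inA_pr1 inA_pr2).
have h3 := @plot_app N N _ _ h2 (inA_comp inA_pr2 inA_pr2).
have := inA_ops (7, 0) h3 ha hk; congr inA; apply: funext => n /=; congr nat_rect.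
by apply: funext => i; apply: funext => r; rewrite !unprK.
Qed.

Definition mR : points (sp ((N ~> N ~> N) ~> N ~> N ~> N)).
Proof.
unshelve eapply (@mkfun (N ~> N ~> N) (N ~> N ~> N) (fun h =>
  @mkfun N (N ~> N) (fun a => @mkfun N N (fun n =>
    nat_rect (fun _ => nat) a (fun i r => sval (sval h i) r) n) _) _)).
- move=> k hk; exact: (inA_rec (plot_const h) (inA_const a) hk).
- move=> a ha; move=> r k hr hk; exact: (inA_rec (plot_const h) (inA_comp ha hr) hk).
- move=> h hh; move=> r a hr ha r' k hr' hk.
  exact: (inA_rec (@plot_comp (N ~> N ~> N) _ _ (@plot_comp (N ~> N ~> N) _ _ hh hr) hr') (inA_comp ha hr') hk).
Defined.

Definition plots : structure :=
  @Str (fun t => points (sp t)) (fun s t f x => sval f x) eq 0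
    (@mkfun N N S (fun u hu => inA_comp inA_succ hu)) mK mS mR.

Lemma inA_graph (u : nat -> points (sp t1)) : plot u ->
  inA (fun c => sval (u (unpr c).1) (unpr c).2).
Proof. by move=> hu; exact: (@plot_app N N _ _ (@plot_comp t1 u _ hu inA_pr1) inA_pr2). Qed.

Lemma rca_plots : rca plots.
Proof.
split=> //.
- split=> // s t f g h; case: f g h => f pf [g pg] h.
  have e : f = g by apply: funext => x; exact: h.
  by clear h; move: pf; rewrite e => pf; congr exist; exact: Prop_irrelevance.
- by move=> m n [].
(* The numbers of this model are standard, so full induction holds. *)
- by move=> G A g _ h0 hS; elim.
- move=> P hP; unshelve eexists.
    apply: (@mkfun t1 N (fun f => some 0 (fun m => sval (sval P f) m = 0))) => u hu.
    have h := inA_graph (svalP P u hu).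
    have := inA_ops (8, 0) h h h; congr inA; apply: funext => n /=; congr some.
    by apply: funext => m; rewrite unprK.
  by move=> f; exact: (@someP _ 0 (fun m => sval (sval P f) m = 0) (hP f)).
Qed.

Definition plot_model := Model rca_plots.

Lemma plot_E2 : @E2m plot_model.
Proof.
unshelve eexists.
  apply: (@mkfun t1 N (fun f => if `[< exists m, sval f m = 0 >] then 0 else 1)) => u hu.
  have h := inA_graph hu; have := inA_ops (9, 0) h h h; congr inA; apply: funext => n /=.
  by congr (if _ then _ else _); congr asbool; congr ex; apply: funext => m; rewrite unprK.
by move=> f /=; case: asboolP.
Qed.

(** * Agreement of truth in the model with truth over all functions *)

Section KleeneFormulas.
Notation NN := (car plot_model N).

Lemma add_nat (x y : NN) : add x y = (x + y)%N.
Proof.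
elim: y => [|y IH]; first by rewrite addn0; exact: naddr0.
by rewrite addnS -IH; exact: (@naddrS plot_model x y).
Qed.
Lemma tri_nat (n : NN) : tri n = tri0 n.
Proof.
elim: n => [|n IH /=]; first by rewrite tri_unlock; exact: recf0.
by rewrite -IH -add_nat; exact: (@triS plot_model n).
Qed.
Lemma snoc_nat (s x : NN) : snoc s x = snoc0 s x.
Proof. by rewrite snoc_unlock pairn_unlock !add_nat tri_nat. Qed.
Lemma bar_nat (g : car plot_model t1) (n : NN) : bar g n = bar0' (sval g) n.
Proof.
elim: n => [|n IH /=]; first exact: bar0.
by rewrite -IH -snoc_nat; exact: (@barS plot_model g n).
Qed.

Lemma car_inA (f : car plot_model t1) : inA (sval f).
Proof. exact: (svalP f _ inA_id). Qed.
Lemma inA_car f : inA f -> exists g : car plot_model t1, sval g = f.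
Proof. by move=> h; exists (@mkfun N N f (fun u hu => inA_comp h hu)). Qed.

(** The Tarski-Vaught criterion: a true existential formula has a witness in [A] by operation 11,
    and a false universal one a counterexample in [A] by operation 12. *)
Lemma kleenem_true k : forall b (f : car plot_model t1) gs,
  kleenem k b f gs <-> kleene_true k b (sval f) [seq sval g | g <- gs].
Proof.
elim: k => [|k IH] b f gs /=.
  have e n : forall c : NN, List.fold_left (fun c g => snoc c (bar g n)) gs c =
      List.fold_left (fun c g => snoc0 c (bar0' g n)) [seq sval g | g <- gs] c.
    by elim: gs => //= g gs IH c; rewrite IH snoc_nat bar_nat.
  by case: b; [apply: iff_all|apply: iff_ex] => n; rewrite e.
have fs : forall h, List.In h (sval f :: [seq sval g | g <- gs]) -> inA h.
  move=> h [<-|]; first exact: car_inA.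
  by elim: gs => //= g gs IHg [<-|//]; exact: car_inA.
have key g : kleenem k (~~ b) f (gs ++ [:: g]) <->
    kleene_true k (~~ b) (sval f) ([seq sval g | g <- gs] ++ [:: sval g]).
  by rewrite IH map_cat.
case: b key => /= key; split.
- move=> h; apply: contrapT => /existsNP ex; have [g eg] := inA_car (@inA_op (12, k) _ fs).
  have := someP (fun _ => 0) ex; rewrite -/(sem (12, k) (sval f :: [seq sval g | g <- gs])) -eg.
  by apply; apply/key.
- by move=> h g; apply/key.
- by move=> [g /key h]; exists (sval g).
- move=> ex; have [g eg] := inA_car (@inA_op (11, k) _ fs).
  have := someP (fun _ => 0) ex; rewrite -/(sem (11, k) (sval f :: [seq sval g | g <- gs])) -eg.
  by move=> h; exists g; apply/key.
Qed.

Lemma plot_S_exists k : sat (M := plot_model) (S_exists k) tt.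
Proof.
apply/sat_S_exists; unshelve eexists.
  apply: (@mkfun t1 N (fun f => if `[< kleene_true k true (sval f) [::] >] then 0 else 1)) => u hu.
  have h := inA_graph hu; have := inA_ops (10, k) h h h; congr inA; apply: funext => n /=.
  by congr (if _ then _ else _); congr asbool; congr kleene_true; apply: funext => i; rewrite unprK.
by move=> f; rewrite kleenem_true /=; case: asboolP.
Qed.
End KleeneFormulas.

Lemma plot_Z2omega B : Z2omega B -> sat (M := plot_model) B tt.
Proof. by case=> [|[k [_ ->]]]; [exact: rca_sat|exact: plot_S_exists]. Qed.

(** * Comprehension for reals with (∃²) *)

Section RealPredicates.
Context {M : model}.
Notation hM := (mrca M).
Notation NN := (car M N).
Notation RR := (car M t1).
Hypothesis e2 : @E2m M.

Lemma E2_P1 (R : RR -> NN -> Prop) : P2 R -> P1 (fun x => exists n, R x n).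
Proof.
move=> [f hf]; have [E hE] := e2; have [h hh] : D1 (fun x => E @ (f @ x)).
  by apply: D1_intro; def.
exists h => x; rewrite hh hE.
by split=> -[n k]; exists n; apply/hf.
Qed.

Lemma E2_ltr_l (y : RR) : P1 (fun x => ltr x y).
Proof. by apply: E2_P1; apply: P2_intro; dec. Qed.
Lemma E2_ltr_r (x : RR) : P1 (fun y => ltr x y).
Proof. by apply: E2_P1; apply: P2_intro; dec. Qed.

Lemma E2_isr : P1 (fun x : RR => isr x).
Proof.
pose R (x : RR) w := ~ ltq (absq (subq (x @ fstn w) (x @ add (fstn w) (sndn w)))) (ipow2q (fstn w)).
have dR : P2 R by apply: P2_intro; rewrite /R; dec.
have d := E2_P1 dR; apply: P1_intro.
apply: (Dec_ext (P := fun g : env M [:: t1] => ~ exists w, R g.1 w)) => [g|].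
  split=> [h n i|h [w]]; last by apply; apply: h.
  apply: contrapT => k; apply: h; exists (pairn n i).
  by rewrite /R fstn_pair sndn_pair.
exact: Dec_not (Dec_op1 d (Def_var (VZ _ _))).
Qed.

Lemma E2_eqr (y : RR) : P1 (fun x => isr x /\ eqr x y).
Proof.
have v : Def (fun g : env M [:: t1] => g.1) := Def_var (VZ _ _).
apply: P1_intro; apply: Dec_and (Dec_op1 E2_isr v) (Dec_and _ _); apply: Dec_not.
  exact: (@Dec_op1 M _ _ _ (E2_ltr_r y) _ v).
exact: (@Dec_op1 M _ _ _ (E2_ltr_l y) _ v).
Qed.

End RealPredicates.

(** * A sequence of singletons without a choice of elements *)

Section PlotModel.
Notation NN := (car plot_model N).
Notation RR := (car plot_model t1).

Lemma seq_plot t (s : car plot_model (N ~> t)) : plot (s := sp t) (fun n => s @ n).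
Proof. exact: (svalP s _ inA_id). Qed.
Lemma plot_seq t (u : nat -> car plot_model t) : plot (s := sp t) u ->
  exists s : car plot_model (N ~> t), forall n, s @ n = u n.
Proof. by move=> hu; exists (@mkfun N t u (fun r hr => @plot_comp t u r hu hr)). Qed.

Definition coded (s : car plot_model (N ~> t1)) (j : nat) :=
  forall n k, enumA j (pr n k) = s @ n @ k.
Lemma coded_ex s : exists j, coded s j.
Proof.
have [j hj] := inA_graph (seq_plot s); exists j => n k.
by rewrite hj unprK.
Qed.
Lemma coded_inj s s' j : coded s j -> coded s' j -> s = s'.
Proof. by move=> h h'; apply: car_ext => n; apply: car_ext => k; rewrite -h -h'. Qed.

Lemma merge (X Y : car plot_model (N ~> t1)) : exists Z : car plot_model (N ~> t1),
  forall n, (exists m, X @ n = Z @ m) /\ (exists m, Y @ n = Z @ m).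
Proof.
exists (LAM (fun w : NN => cond (sndn w = cZ) (X @ fstn w) (Y @ fstn w))) => n.
split; [exists (pairn n cZ)|exists (pairn n o1)]; (rewrite beta; last by def); rewrite fstn_pair sndn_pair.
  by rewrite condT.
by rewrite condF //; apply: (r_S0 (mrca plot_model)).
Qed.

(** Merging the finitely many sequences with codes below [i] into one sequence of the model lets a
    single diagonalization avoid them all. *)
Lemma cover i : exists X : car plot_model (N ~> t1), forall j, j < i -> forall s, coded s j ->
  forall n, exists m, s @ n = X @ m.
Proof.
elim: i => [|i [X hX]]; first by exists (LAM (fun _ : NN => zeror)).
case: (EM (exists s, coded s i)) => [[s hs]|h].
  have [Z hZ] := merge X s; exists Z => j; rewrite ltnS leq_eqVlt => /orP[/eqP-> s' hs'|ji s' hs'] n.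
    by rewrite (coded_inj hs' hs); exact: (hZ n).2.
  by have [m ->] := hX j ji s' hs' n; exact: (hZ m).1.
exists X => j; rewrite ltnS leq_eqVlt => /orP[/eqP-> s' hs'|/hX //].
by case: h; exists s'.
Qed.

Lemma avoid i : exists z : RR, isr z /\ in01r z /\ forall j, j <= i -> forall s, coded s j ->
  forall n : NN, isr (s @ n) -> ~ eqr (s @ n) z.
Proof.
have [X hX] := cover i.+1; have [z [rz [iz hz]]] := diagonal X.
exists z; split=> //; split=> // j ji s hs n.
by have [m ->] := hX j ji s hs n; exact: hz.
Qed.

(* The sets are the singletons of reals z_0, z_1, ..., where z_i is not in the first i
   sequences of reals of the model.  Their sequence belongs to the model: on a given
   sequence of reals, it is equivalent to a finite sequence of sets. *)
Lemma plot_not_ClC : ~ @ClCm plot_model.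
Proof.
have [z hz] := choice avoid.
have rz i : isr (z i) := (hz i).1.
pose P i (x : RR) := isr x /\ eqr x (z i).
have dP i : P1 (P i) := E2_eqr plot_E2 (z i).
pose h i x : RR := cond (P i x) oner zeror.
have finite j : P2 (fun (i : NN) x => exists i0 : nat, i0 < j /\ i = i0 /\ P i0 x).
  elim: j => [|j [f hf]].
    by apply: P2_intro; apply: (Dec_ext (P := fun _ => False)) => [g|]; [by split=> [//|[i0 []]]|exact: Dec_const].
  have [jn ej] : exists k : NN, k = j by exists j.
  apply: P2_intro; apply: (Dec_ext (P := fun g : env plot_model [:: t1; N] =>
    f @ g.2.1 @ g.1 = cZ \/ (g.2.1 = jn /\ P j g.1))) => [g|]; last by dec.
  split=> [[/hf [i0 [l hi]]|[e p]]|[i0 [l [e p]]]].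
  - by exists i0; split=> //; apply: leqW.
  - by exists j; rewrite e ej.
  - move: l; rewrite ltnS leq_eqVlt => /orP[/eqP e'|l]; first by right; rewrite e ej -e'.
    by left; apply/hf; exists i0.
have key (i : nat -> nat) (x : nat -> RR) : inA i -> plot (s := sp t1) x ->
    plot (s := sp t1) (fun n => h (i n) (x n)).
  move=> hi /plot_seq [s hs]; have [iota hiota] := @plot_seq N i hi; have [j hj] := coded_ex s.
  pose Q (i : NN) x := exists i0 : nat, i0 < j /\ i = i0 /\ P i0 x.
  have dQ : P2 Q := finite j.
  pose u : car plot_model (N ~> t1) := LAM (fun n : NN =>
    cond (Q (iota @ n) (s @ n)) oner zeror).
  have := seq_plot u; congr plot; apply: funext => n.
  rewrite /u beta; last by def.
  rewrite hiota hs /Q /h; case: (EM (P (i n) (x n))) => p; last first.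
    by rewrite !condF // => -[i0 [_ [<- p']]].
  rewrite !condT //; exists (i n); split=> //; rewrite ltnNge; apply/negP => ji.
  have := (hz (i n)).2.2 j ji s hj n; rewrite hs; case: p => p1 p2; exact.
have [H hH] : exists H : car plot_model (N ~> t1 ~> t1), forall i x, H @ i @ x = h i x.
  unshelve eexists (@mkfun N (t1 ~> t1) (fun i => @mkfun t1 t1 (h i) (fun x hx => key _ _ (inA_const i) hx)) _).
    move=> i hi r x hr hx; exact: key (inA_comp hi hr) hx.
  by [].
have zo : ltr zeror (oner : RR).
  by apply: ltr_constr; rewrite !toK_nat inN0 inN1 ltr01.
have memE i x : memr x (H @ i) <-> P i x.
  rewrite /memr hH /h; case: (EM (P i x)) => p; [rewrite condT //|rewrite condF //].
  by split=> // l; case: (ler_refl l).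
move=> /(_ H) [i|X hX].
  split; last split.
  - split; first split=> [x rx|x rx y ry exy]; rewrite ?hH.
    + rewrite /h; case: (EM (P i x)) => p; [rewrite condT //|rewrite condF //]; exact: real_constr.
    + rewrite /h; case: (EM (P i x)) => p.
        rewrite !condT //; first exact: eqr_refl.
        by split=> //; apply: eqr_tr p.2 => //; apply: eqr_sym.
      rewrite !condF //; first exact: eqr_refl.
      by move=> [_ q]; apply: p; split=> //; apply: eqr_tr q.
    move=> x rx; rewrite memE => np.
    have [l|l] : ltr x (z i) \/ ltr (z i) x.
      apply: contrapT => n; apply: np; split=> //.
      by split=> l; apply: n; [right|left].
    - have [n hn] := ltr_ball_l rx (rz i) l; exists n => y ry b; rewrite memE => -[_ [_ q]].
      exact: q (hn y ry b).
    have [n hn] := ltr_ball_r rx (rz i) l; exists n => y ry b; rewrite memE => -[_ [q _]].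
    exact: q (hn y ry b).
  - move=> x rx; rewrite memE => -[_ e]; apply: in01_eqr (rz i) rx (eqr_sym e) (hz i).2.1.
  - by exists (z i); rewrite memE; split=> //; split=> //; apply: eqr_refl.
(* A selecting sequence [X] has some code [j], and [z j] avoids all terms of the sequences with
   codes up to [j], among them [X @ j]. *)
have [j hj] := coded_ex X; have [rX mX] := hX j; move: mX; rewrite memE => -[_].
exact: ((hz j).2.2 j (leqnn j) X hj j rX).
Qed.
End PlotModel.

Theorem theorem2p7 :
  ~ (Z2omega ⊢ ClC) /\
  ((Z2Omega ⊢ ClC) /\ (RCA0w ⊕ QFAC01 ⊢ ClC)) /\
  (RCA0w ⊕ ClC ⊢ WKL ⇔ usco_bounded).
Proof.
split.
  move=> /(soundness plot_Z2omega)/(_ tt) h; apply: plot_not_ClC; apply/sat_ClC/h.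
  by move=> B [].
apply: reduction => M.
- exact: E3_ClC.
- exact: QFAC01_ClC.
- by move=> clc; split; [exact: WKL_UB|exact: UB_WKL].
Qed.
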